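(* Assume $p>n$, $n\ge 2$, and $u\in\mathcal{D}^{1,p}(\mathbb{R}^n)$ is the Morrey extremal which satisfies $$\sup_{x\neq y}\left\{\frac{|u(x)-u(y)|}{|x-y|^{1-n/p}}\right\}=\frac{|u(e_n)-u(-e_n)|}{|e_n-(-e_n)|^{1-n/p}},\qquad u(e_n)=1,\qquad u(-e_n)=-1.$$ If $x^1,x^2\in\mathbb{R}^n$ with $$|x^1|=|x^2|\quad\text{and}\quad x^1_n\le x^2_n,$$ then $$u(x^1)\le u(x^2).$$
   Context: $\mathcal{D}^{1,p}(\mathbb{R}^n)$ is the space of weakly differentiable functions $u:\mathbb{R}^n\to\mathbb{R}$ whose first-order weak partial derivatives $u_{x_1},\dots,u_{x_n}$ belong to $L^p(\mathbb{R}^n)$; $Du$ is the weak gradient. Since $p>n$, each such $u$ agrees a.e. with a Hölder continuous function of exponent $1-n/p$, and $u$ is always identified with this continuous representative. $e_n\in\mathbb{R}^n$ is the point with $1$ in its $n$th coordinate and $0$ otherwise; $x^i_n$ denotes the $n$th coordinate of $x^i$. Morrey's inequality states that there is a constant $C$ with $$\sup_{x\neq y}\left\{\frac{|v(x)-v(y)|}{|x-y|^{1-n/p}}\right\}\le C\left(\int_{\mathbb{R}^n}|Dv|^p\,dx\right)^{1/p}\quad\text{for all } v\in\mathcal{D}^{1,p}(\mathbb{R}^n).$$ There is a smallest such constant $C_*>0$. A Morrey extremal is a nonconstant $u\in\mathcal{D}^{1,p}(\mathbb{R}^n)$ for which equality holds in Morrey's inequality with $C=C_*$. It is known (from earlier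 work) that a Morrey extremal satisfying the normalization in the claim exists and is unique, which is the reason for the word ''the''. *)

(* Defs.v *)
From HB Require Import structures.
From mathcomp Require Import all_boot all_order all_algebra.
From mathcomp Require Import all_classical all_reals all_analysis.

Set Implicit Arguments.
Unset Strict Implicit.
Unset Printing Implicit Defensive.

Import Order.TTheory GRing.Theory Num.Theory.
Import numFieldNormedType.Exports.

Local Open Scope classical_set_scope.
Local Open Scope ring_scope.

Definition rV_display : measure_display.
Proof. exact: default_measure_display. Qed.

(* The sigma-algebra generated by the coordinates; on R^n it coincides with the
   Borel sigma-algebra of the (sup-norm, equivalently Euclidean) topology. *)
Section rV_measurable.
Context {R : realType} {n : nat}.

Definition rV_coord (i : 'I_n) (x : 'rV[R]_n) : measurableTypeR R := x 0 i.

Let rV_set0 : g_sigma_preimage rV_coord set0.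
Proof. exact: sigma_algebra0. Qed.

Let rV_setC A : g_sigma_preimage rV_coord A -> g_sigma_preimage rV_coord (~` A).
Proof. exact: sigma_algebraC. Qed.

Let rV_bigcup (F : (set 'rV[R]_n)^nat) :
  (forall i, g_sigma_preimage rV_coord (F i)) ->
  g_sigma_preimage rV_coord (\bigcup_i (F i)).
Proof. exact: sigma_algebra_bigcup. Qed.

HB.instance Definition _ := @isMeasurable.Build rV_display
  'rV[R]_n (g_sigma_preimage rV_coord) rV_set0 rV_setC rV_bigcup.

Lemma measurable_rV_coord (i : 'I_n) : measurable_fun [set: 'rV[R]_n] (rV_coord i).
Proof.
move=> _ Y mY; rewrite setTI; apply: sub_sigma_algebra => /=.
rewrite -bigcup_seq/=; exists i => /=; first by rewrite mem_index_enum.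
by exists Y => //; rewrite setTI.
Qed.

Lemma measurable_fun_rVP d (T : measurableType d) (f : T -> 'rV[R]_n) :
  (forall i, measurable_fun [set: T] (rV_coord i \o f)) ->
  measurable_fun [set: T] f.
Proof.
move=> mf _ A mA; rewrite setTI.
have : g_sigma_preimage (fun i => rV_coord i \o f) (f @^-1` A).
  by rewrite g_sigma_preimage_comp; exists A => //; rewrite setTI.
apply: smallest_sub; first exact: sigma_algebra_measurable.
elim/big_ind : _ => [//|B C sB sC|i _ B [C mC <-]].
  by rewrite subUset.
exact: mf.
Qed.

End rV_measurable.

Section rV_cons.
Context {R : realType} {n : nat}.

Definition rV_cons (z : measurableTypeR R * 'rV[R]_n) : 'rV[R]_n.+1 :=
  \row_i oapp (z.2 0) z.1 (unlift ord0 i).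

Definition rV_uncons (x : 'rV[R]_n.+1) : measurableTypeR R * 'rV[R]_n :=
  (x 0 ord0, \row_i x 0 (lift ord0 i)).

Lemma rV_consK : cancel rV_cons rV_uncons.
Proof.
case=> a v; congr (_, _); first by rewrite mxE unlift_none.
by apply/rowP => i; rewrite !mxE liftK.
Qed.

Lemma rV_unconsK : cancel rV_uncons rV_cons.
Proof.
move=> x; apply/rowP => i; rewrite mxE.
by case: unliftP => [j|] -> //=; rewrite mxE.
Qed.

Lemma measurable_rV_cons : measurable_fun setT rV_cons.
Proof.
apply: measurable_fun_rVP => i; rewrite /rV_coord.
case: (unliftP ord0 i) => [j|] ->.
  rewrite (_ : _ \o _ = rV_coord j \o snd); last first.
    by apply/funext => z /=; rewrite mxE liftK.
  by apply: measurableT_comp => //; exact: measurable_rV_coord.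
rewrite (_ : _ \o _ = fst) //.
by apply/funext => z /=; rewrite mxE unlift_none.
Qed.

Lemma measurable_rV_uncons : measurable_fun setT rV_uncons.
Proof.
apply/measurable_fun_pairP; split; first exact: measurable_rV_coord.
apply: measurable_fun_rVP => i.
rewrite (_ : _ \o _ = rV_coord (lift ord0 i)); first exact: measurable_rV_coord.
by apply/funext => x; rewrite /rV_coord /= mxE.
Qed.

End rV_cons.

Section lebesgue_rV_succ.
Context {R : realType} {n : nat}.
Variable m : {sigma_finite_measure set 'rV[R]_n -> \bar R}.
Local Open Scope ereal_scope.

Let lebR : {sigma_finite_measure set (measurableTypeR R) -> \bar R} :=
  @lebesgue_measure R.

Definition lebesgue_rV_succ : set 'rV[R]_n.+1 -> \bar R :=
  pushforward (lebR \x m) rV_cons.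

Let succ0 : lebesgue_rV_succ set0 = 0.
Proof. by rewrite /lebesgue_rV_succ /pushforward preimage_set0 measure0. Qed.

Let succ_ge0 A : 0 <= lebesgue_rV_succ A.
Proof. by rewrite /lebesgue_rV_succ /pushforward measure_ge0. Qed.

Let succ_sigma_additive : semi_sigma_additive lebesgue_rV_succ.
Proof.
apply: (@measure_semi_sigma_additive _ _ _ (pushforward (lebR \x m) rV_cons)).
exact: measurable_rV_cons.
Qed.

HB.instance Definition _ := isMeasure.Build _ _ _ lebesgue_rV_succ
  succ0 succ_ge0 succ_sigma_additive.

Let succ_sigma_finite : sigma_finite setT lebesgue_rV_succ.
Proof.
have /sigma_finiteP[F [TF ndF Foo]] := sigma_finiteT lebR.
have /sigma_finiteP[G [TG ndG Goo]] := sigma_finiteT m.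
exists (fun k => rV_uncons @^-1` (F k `*` G k)).
  rewrite -preimage_bigcup (_ : \bigcup_k _ = setT) ?preimage_setT//.
  apply/seteqP; split => // -[x y] _.
  have [k _ Fkx] : (\bigcup_k F k) x by rewrite -TF.
  have [l _ Gly] : (\bigcup_l G l) y by rewrite -TG.
  exists (maxn k l) => //; split => /=.
  - by move: x Fkx; exact/subsetPset/ndF/leq_maxl.
  - by move: y Gly; exact/subsetPset/ndG/leq_maxr.
move=> k; have [mFk Fk_fin] := Foo k; have [mGk Gk_fin] := Goo k; split.
  rewrite -[X in measurable X]setTI; apply: measurable_rV_uncons => //.
  exact: measurableX.
rewrite /lebesgue_rV_succ /pushforward -comp_preimage.
rewrite (_ : _ \o _ = id); last by apply/funext => z; exact: rV_consK.
by rewrite preimage_id product_measure1E// lte_mul_pinfty// ge0_fin_numE.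
Qed.

HB.instance Definition _ := Measure_isSigmaFinite.Build _ _ _ lebesgue_rV_succ
  succ_sigma_finite.

Lemma lebesgue_rV_succ_box (A : 'I_n.+1 -> set (measurableTypeR R)) :
  measurable (A ord0) ->
  measurable [set x : 'rV[R]_n | forall i, A (lift ord0 i) (x ord0 i)] ->
  lebesgue_rV_succ [set x | forall i, A i (x ord0 i)] =
  lebR (A ord0) * m [set x | forall i, A (lift ord0 i) (x ord0 i)].
Proof.
move=> mA0 mA; rewrite -product_measure1E// /lebesgue_rV_succ /pushforward.
congr (_ _); apply/seteqP; split => [[a v] /= h|[a v] /= [h0 h] i].
  split=> [|i]; first by have := h ord0; rewrite mxE unlift_none.
  by have := h (lift ord0 i); rewrite mxE liftK.
by rewrite mxE; case: unliftP => [j|] ->.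
Qed.

End lebesgue_rV_succ.

Fixpoint lebesgue_rV {R : realType} (n : nat) :
    {sigma_finite_measure set 'rV[R]_n -> \bar R} :=
  if n is n'.+1 then lebesgue_rV_succ (lebesgue_rV n') else \d_(0 : 'rV[R]_0).

Lemma measurable_rV_box (R : realType) n (A : 'I_n -> set (measurableTypeR R)) :
  (forall i, measurable (A i)) ->
  measurable [set x : 'rV[R]_n | forall i, A i (x 0 i)].
Proof.
move=> mA; rewrite (_ : mkset _ = \bigcap_(i in setT) (rV_coord i @^-1` A i)).
  apply: fin_bigcap_measurable => [|i _]; first exact: finite_finset.
  by rewrite -[X in measurable X]setTI; exact: measurable_rV_coord.
by apply/seteqP; split => x /= h i => [_|]; exact: h.
Qed.

(* Together with sigma-finiteness, this characterizes [lebesgue_rV]. *)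
Lemma lebesgue_rV_box (R : realType) n (A : 'I_n -> set (measurableTypeR R)) :
  (forall i, measurable (A i)) ->
  lebesgue_rV n [set x : 'rV[R]_n | forall i, A i (x 0 i)] =
  (\prod_(i < n) lebesgue_measure (A i))%E.
Proof.
elim: n => [|n IHn] in A * => mA.
  by rewrite big_ord0 /= diracE mem_set// => -[].
rewrite big_ord_recl /= lebesgue_rV_succ_box//.
  by congr (_ * _)%E; exact: (IHn (fun i => A (lift ord0 i))).
exact: (@measurable_rV_box R n (fun i => A (lift ord0 i))).
Qed.

Section rV_calculus.
Context {R : realType} {n : nat}.
Implicit Types (phi u v : 'rV[R]_n -> R) (x y : 'rV[R]_n) (i : 'I_n).

Local Notation mu := (@lebesgue_rV R n).

(* The library norm on ['rV[R]_n] is the sup norm. *)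
Definition enorm x : R := Num.sqrt (\sum_i x 0 i ^+ 2).

Definition partial i phi x : R := 'D_(delta_mx 0 i) phi x.

Definition iter_partial (s : seq 'I_n) phi := foldr partial phi s.

Definition smooth phi := forall s : seq 'I_n,
  continuous (iter_partial s phi) /\
  forall i x, derivable (iter_partial s phi) x (delta_mx 0 i).

Definition test_function phi :=
  smooth phi /\ compact (closure [set x | phi x != 0]).

Definition locally_integrable_rV u :=
  measurable_fun [set: 'rV[R]_n] u /\
  forall K : set 'rV[R]_n, compact K -> mu.-integrable K (EFin \o u).

Definition is_weak_partial i u g :=
  locally_integrable_rV g /\
  forall phi, test_function phi ->
    \int[mu]_x (u x * partial i phi x) = - \int[mu]_x (g x * phi x).

Definition weakly_differentiable u :=
  locally_integrable_rV u /\ forall i, exists g, is_weak_partial i u g.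

(* Weak derivatives are only determined almost everywhere: this picks a
   representative when there is one, and is [0] otherwise. *)
Definition weak_partial i u : 'rV[R]_n -> R :=
  xget (cst 0) [set g | is_weak_partial i u g].

Definition weak_grad u x : 'rV[R]_n := \row_i weak_partial i u x.

Section morrey.
Variable p : R.

(* The elements of D^{1,p}(R^n), p > n, are identified with their continuous
   representatives, hence the last clause. *)
Definition D1p u := [/\ weakly_differentiable u,
  forall i, weak_partial i u \in Lfun mu p%:E & continuous u].

Definition grad_norm u : \bar R :=
  'N[mu]_(p%:E)[EFin \o (enorm \o weak_grad u)]%E.

Definition holder_quotient u x y : R :=
  `|u x - u y| / enorm (x - y) `^ (1 - n%:R / p).

Definition holder_seminorm u : \bar R :=
  ereal_sup [set (holder_quotient u z.1 z.2)%:E | z in [set z | z.1 != z.2]].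

Definition morrey_inequality (C : R) :=
  forall v, D1p v -> (holder_seminorm v <= C%:E * grad_norm v)%E.

Definition sharp_morrey_constant (C : R) :=
  morrey_inequality C /\ forall C', morrey_inequality C' -> C <= C'.

Definition morrey_extremal u :=
  [/\ D1p u, ~ (exists c, forall x, u x = c) &
      exists2 C, sharp_morrey_constant C &
        holder_seminorm u = (C%:E * grad_norm u)%E].

End morrey.

End rV_calculus.

Section last_coordinate.
Context {n : nat}.
Hypothesis n_ge2 : (2 <= n)%N.

Lemma last_coord_subproof : (n.-1 < n)%N.
Proof. by case: n n_ge2. Qed.

Definition last_coord : 'I_n := Ordinal last_coord_subproof.

Definition e_last {R : realType} : 'rV[R]_n := delta_mx 0 last_coord.

End last_coordinate.

(* Main.v *)
(* Polarization.  Let [v] be a vector with [dotp e_n v > 0], let [s] be the reflection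
   exchanging the two sides of the hyperplane orthogonal to [v], and let [z0] be
   the polarization of [u], equal to [max u (u o s)] where [dotp x v > 0] and to
   [min u (u o s)] elsewhere.  Almost everywhere the pair of gradients of [z0] at
   [x] and [s x] is, up to reflection, a rearrangement of that of [u], so
   [\int |D z0|^p = \int |D u|^p].  The midpoint [z = (u + z0) / 2] satisfies
   [z e_n >= 1] and [z (- e_n) <= -1], so the sharp Morrey inequality gives
   [\int |D z|^p >= \int |D u|^p]; as [p >= 2], Clarkson's inequality then forces
   [\int |D (z0 - u)|^p = 0], and Morrey's inequality that [z0 - u] is constant.
   It vanishes at [0], hence [u (s x) <= u x] whenever [dotp x v > 0].  Taking [v]
   close to [x2 - x1] yields the claim, because the reflection orthogonal to
   [x2 - x1] maps [x2] to [x1].  To have reflections that are products of shears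
   and a flip of the first axis, only [v] with [v 0 ord0 != 0] are used.

   The weak gradient of the positive part of a function over a half-space on whose
   boundary it vanishes is obtained by smoothing the function, the positive part
   and the indicator of the half-space. *)
Require Import Defs.
From mathcomp Require Import all_boot all_order all_algebra.
From mathcomp Require Import all_classical all_reals all_analysis.
From mathcomp Require Import measurable_realfun ring lra.

Set Implicit Arguments.
Unset Strict Implicit.
Unset Printing Implicit Defensive.

Import Order.TTheory GRing.Theory Num.Theory.
Import numFieldNormedType.Exports.

Local Open Scope classical_set_scope.
Local Open Scope ring_scope.


(** * Measure-preserving maps of R^n *)

(** The comparison with the midpoint stands in for uniqueness of the extremal. The polarization [z0]
    has the energy of [u] and at least its spread between [e_n] and [- e_n], so it is optimal too,
    and uniform convexity forces two optimal functions with equal energy to differ by a constant. In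
    [extremal_refl_le] the polarization is [u + S] with [S x = T x - T (s x)], where [T] is the
    positive part of [w x = u (s x) - u x] cut off to [dotp x v > 0]. Since [w] vanishes on the
    mirror, the cut creates no jump and the weak gradient of [T] carries no boundary term. Proving
    this is the analytic core: weak derivatives are tested only against smooth functions, whereas
    both the indicator and the positive part are rough. Every smooth function that is constructed
    comes from one family, [flat]: bumps, mollifiers, cutoffs of the half-space and the smoothed
    positive part. Since [weak_grad] is an arbitrary choice of representative, energies of
    explicitly computed gradients are tied to it through the almost everywhere uniqueness of weak
    derivatives. *)

Lemma lebesgue_measure_affine {R : realType} (b : bool) (m : R)
    (A : set (measurableTypeR R)) : measurable A ->
  lebesgue_measure ((fun t : measurableTypeR R => (-1) ^+ b * t + m) @^-1` A)
    = lebesgue_measure A.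
Proof.
move=> mA; set f := fun t : measurableTypeR R => _.
have mf : measurable_fun [set: measurableTypeR R] (f : _ -> measurableTypeR R).
  by apply: measurable_funD => //; exact: measurable_funM.
change (pushforward lebesgue_measure (f : _ -> measurableTypeR R) A =
  lebesgue_measure A).
apply/esym/lebesgue_measure_unique => // _ [[x y] _ <-]; rewrite /pushforward.
(* A negative sign moves the closed endpoint to the left. The length is unchanged in both cases, and
   half-open intervals determine Lebesgue measure. *)
have E : f @^-1` `]x, y]%classic =
    if b then `[m - y, m - x[%classic else `]x - m, y - m]%classic.
  rewrite /f; case: b {f mf}; apply/seteqP;
    split=> z /=; rewrite !in_itv/= ?expr1 ?expr0 ?mulN1r ?mul1r; lra.
transitivity (@lebesgue_measure R (f @^-1` `]x, y]%classic)) => //.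
rewrite E lebesgue_measure_itv/=; case: b {f mf E};
  rewrite lebesgue_measure_itv/= !lte_fin.
  by rewrite ltrD2l ltrN2 -!EFinB; case: ifP => // _; congr (_%:E); ring.
by rewrite ltrD2r -!EFinB; case: ifP => // _; congr (_%:E); ring.
Qed.

Definition measure_preserving {R : realType} n (s : 'rV[R]_n -> 'rV[R]_n) :=
  measurable_fun [set: 'rV[R]_n] s /\
  forall A, measurable A -> lebesgue_rV n (s @^-1` A) = lebesgue_rV n A.

Section measure_preserving.
Context {R : realType}.
Local Notation mu := (@lebesgue_rV R).

Lemma measurable_rV_comp n (s : 'rV[R]_n -> 'rV[R]_n) A :
  measurable_fun [set: 'rV[R]_n] s -> measurable A -> measurable (s @^-1` A).
Proof. by move=> ms mA; rewrite -[X in measurable X]setTI; exact: ms. Qed.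

Lemma measure_preserving_comp n (s t : 'rV[R]_n -> 'rV[R]_n) :
  measure_preserving s -> measure_preserving t -> measure_preserving (s \o t).
Proof.
move=> [ms sE] [mt tE]; split; first exact: measurableT_comp.
by move=> A mA; rewrite comp_preimage tE ?sE//; exact: measurable_rV_comp.
Qed.

Lemma ge0_integral_measure_preserving n s (f : 'rV[R]_n -> \bar R) :
  measure_preserving s -> measurable_fun setT f -> (forall x, 0 <= f x)%E ->
  (\int[mu n]_x f (s x) = \int[mu n]_x f x)%E.
Proof.
move=> [ms sE] mf f0.
transitivity (\int[pushforward (mu n) s]_x f x)%E.
  by rewrite ge0_integral_pushforward.
by apply: eq_measure_integral => A mA _; exact: sE.
Qed.

Lemma integral_measure_preserving n s (f : 'rV[R]_n -> \bar R) :
  measure_preserving s -> measurable_fun setT f ->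
  (\int[mu n]_x f (s x) = \int[mu n]_x f x)%E.
Proof.
move=> sP mf; rewrite [LHS]integralE [RHS]integralE.
rewrite -(ge0_integral_measure_preserving (f := f^\+%E) sP)//; last first.
  exact: measurable_funepos.
rewrite -(ge0_integral_measure_preserving (f := f^\-%E) sP)//; last first.
  exact: measurable_funeneg.
by rewrite -[X in X^\+%E]/(f \o s) -[X in X^\-%E]/(f \o s) funepos_comp funeneg_comp.
Qed.

Lemma Rintegral_measure_preserving n s (f : 'rV[R]_n -> R) :
  measure_preserving s -> measurable_fun setT f ->
  \int[mu n]_x f (s x) = \int[mu n]_x f x.
Proof.
move=> sP mf; congr fine.
by rewrite (integral_measure_preserving (f := EFin \o f))//; exact/measurable_EFinP.
Qed.

Lemma integrable_measure_preserving n s (f : 'rV[R]_n -> \bar R) :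
  measure_preserving s -> (mu n).-integrable setT f ->
  (mu n).-integrable setT (f \o s).
Proof.
move=> sP /integrableP[mf f_fin]; apply/integrableP; split.
  by apply: measurableT_comp => //; exact: sP.1.
rewrite (ge0_integral_measure_preserving (f := fun x => `|f x|%E))//.
exact: measurableT_comp.
Qed.

Lemma measurable_rV_coordE n (i : 'I_n) :
  measurable_fun [set: 'rV[R]_n] (fun x => x 0 i : measurableTypeR R).
Proof. exact: measurable_rV_coord. Qed.

Lemma measurable_rV_translation n (a : 'rV[R]_n) :
  measurable_fun setT (fun x : 'rV[R]_n => x + a).
Proof.
apply: measurable_fun_rVP => i.
rewrite (_ : _ \o _ = fun x : 'rV[R]_n => x 0 i + a 0 i); last first.
  by apply/funext => x; rewrite /rV_coord /= mxE.
by apply: measurable_funD => //; exact: measurable_rV_coordE.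
Qed.

Lemma lebesgue_rV_xsection n (A : set 'rV[R]_n.+1) :
  (mu n.+1 A = \int[lebesgue_measure]_a
    mu n (fun v => A (rV_cons (a : measurableTypeR R, v))))%E.
Proof.
rewrite /= /lebesgue_rV_succ /pushforward /product_measure1.
apply: eq_integral => a _ /=; congr (mu n _).
by apply/seteqP; split => v /=; rewrite /xsection/= inE.
Qed.

(** The measure is built with the integral over the first axis outermost. The opposite order of
    slicing comes from uniqueness of the product measure on rectangles. *)
Lemma lebesgue_rV_ysection n (A : set 'rV[R]_n.+1) : measurable A ->
  (mu n.+1 A = \int[mu n]_v
    lebesgue_measure (fun a : measurableTypeR R => A (rV_cons (a, v))))%E.
Proof.
move=> mA; rewrite /= /lebesgue_rV_succ /pushforward.
rewrite (product_measure_unique (m' := (lebesgue_measure \x^ mu n)%E)).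
- rewrite /product_measure2; apply: eq_integral => v _ /=; congr lebesgue_measure.
  by apply/seteqP; split => a /=; rewrite /ysection/= inE.
- by move=> X Y mX mY; exact: product_measure2E.
- by rewrite -[X in measurable X]setTI; exact: measurable_rV_cons.
Qed.

Lemma measurable_xsection_rV n (A : set 'rV[R]_n.+1) (a : R) : measurable A ->
  measurable (fun v : 'rV[R]_n => A (rV_cons (a : measurableTypeR R, v))).
Proof.
move=> mA; rewrite (_ : (fun v => _) =
  (fun v => rV_cons (a : measurableTypeR R, v)) @^-1` A)//.
rewrite -[X in measurable X]setTI; apply: measurableT_comp => //.
exact: measurable_rV_cons.
Qed.

Lemma measurable_ysection_rV n (A : set 'rV[R]_n.+1) (v : 'rV[R]_n) :
  measurable A -> measurable (fun a : measurableTypeR R => A (rV_cons (a, v))).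
Proof.
move=> mA; rewrite (_ : (fun a => _) = (fun a => rV_cons (a, v)) @^-1` A)//.
rewrite -[X in measurable X]setTI; apply: measurableT_comp => //.
exact: measurable_rV_cons.
Qed.

Lemma measurable_lebesgue_rV_xsection n (A : set 'rV[R]_n.+1) : measurable A ->
  measurable_fun [set: measurableTypeR R]
    (fun a => mu n (fun v => A (rV_cons (a, v)))).
Proof.
move=> mA; pose B := @rV_cons R n @^-1` A.
have mB : measurable B.
  by rewrite -[X in measurable X]setTI; exact: measurable_rV_cons.
have := @measurable_fun_xsection _ _ _ _ _ (mu n) B mB.
congr measurable_fun; apply/funext => a /=; congr (mu n _).
by apply/seteqP; split => v /=; rewrite /xsection/= inE.
Qed.

(** Induction on the dimension: the slice at [t] of the preimage of [A] is a translate of the slice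
    of [A] at [t + a 0 ord0]. The induction hypothesis absorbs the tail of [a], and invariance on
    the line absorbs its head. *)
Lemma measure_preserving_translation n (a : 'rV[R]_n) :
  measure_preserving (fun x => x + a).
Proof.
split; first exact: measurable_rV_translation.
elim: n => [|n IHn] in a * => A mA.
  congr (mu 0 _); apply/seteqP; split=> x /=.
    by rewrite [_ + _]thinmx0 [x]thinmx0.
  by rewrite [_ + _]thinmx0 [x]thinmx0.
rewrite !lebesgue_rV_xsection.
pose a' : 'rV[R]_n := \row_i a 0 (lift ord0 i).
have consD (t : R) v : rV_cons (t : measurableTypeR R, v) + a =
    rV_cons (t + a 0 ord0 : measurableTypeR R, v + a').
  apply/rowP => i; rewrite !mxE.
  by case: unliftP => [j|] -> /=; rewrite ?mxE.
pose F (t : measurableTypeR R) := mu n (fun v => A (rV_cons (t, v))).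
pose s (t : R) : measurableTypeR R := t + a 0 ord0.
transitivity (\int[@lebesgue_measure R]_t F (s t))%E.
  apply: eq_integral => t _; rewrite /F.
  rewrite -(IHn a' (fun v => A (rV_cons (t + a 0 ord0 : measurableTypeR R, v)))).
    by congr (mu n _); apply/seteqP; split => v /=; rewrite consD.
  exact: measurable_xsection_rV.
have ms : measurable_fun [set: measurableTypeR R] s.
  by apply: measurable_funD => //; exact: measurable_cst.
transitivity (\int[pushforward lebesgue_measure s]_t F t)%E.
  rewrite ge0_integral_pushforward//.
  exact: measurable_lebesgue_rV_xsection.
apply: eq_measure_integral => B mB _; rewrite /pushforward.
have /= <- := lebesgue_measure_affine false (a 0 ord0) mB.
by congr lebesgue_measure; apply/seteqP; split => t /=; rewrite expr0 mul1r.
Qed.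

(* The two shears below generate the reflections in hyperplanes not containing
   the first axis. *)
Definition shear_tail n (c : 'rV[R]_n) (x : 'rV[R]_n.+1) : 'rV[R]_n.+1 :=
  \row_i (x 0 i + oapp (fun j => x 0 ord0 * c 0 j) 0 (unlift ord0 i)).

Definition flip_head n (m : 'rV[R]_n) (x : 'rV[R]_n.+1) : 'rV[R]_n.+1 :=
  \row_i oapp (fun j => x 0 (lift ord0 j))
    (- x 0 ord0 + \sum_j m 0 j * x 0 (lift ord0 j)) (unlift ord0 i).

(** With the first coordinate frozen at [a], the shear translates the tail by [a *: c]. *)
Lemma measure_preserving_shear_tail n (c : 'rV[R]_n) :
  measure_preserving (shear_tail c).
Proof.
have ms : measurable_fun [set: 'rV[R]_n.+1] (shear_tail c).
  apply: measurable_fun_rVP => i.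
  rewrite (_ : _ \o _ = fun x : 'rV[R]_n.+1 =>
    x 0 i + x 0 ord0 * oapp (fun j => c 0 j) 0 (unlift ord0 i)); last first.
    apply/funext => x; rewrite /rV_coord /= mxE.
    by case: unliftP => [j|] _ //=; rewrite mulr0.
  by apply: measurable_funD;
    [|apply: measurable_funM => //]; exact: measurable_rV_coordE.
split=> // A mA; rewrite !lebesgue_rV_xsection; apply: eq_integral => a _.
rewrite -((measure_preserving_translation (a *: c)).2
  (fun v => A (rV_cons (a : measurableTypeR R, v)))); last first.
  exact: measurable_xsection_rV.
congr (mu n _); apply/seteqP; split => v /=.
  rewrite (_ : shear_tail _ _ = rV_cons (a : measurableTypeR R, v + a *: c))//.
  apply/rowP => i; rewrite !mxE unlift_none/=.
  by case: unliftP => [j|] _ /=; rewrite ?addr0 ?mxE.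
rewrite (_ : shear_tail _ _ = rV_cons (a : measurableTypeR R, v + a *: c))//.
apply/rowP => i; rewrite !mxE unlift_none/=.
by case: unliftP => [j|] _ /=; rewrite ?addr0 ?mxE.
Qed.

(** With the tail frozen, the first coordinate undergoes [a |-> - a + m'] for a constant [m']; hence
    the slicing along the first axis. *)
Lemma measure_preserving_flip_head n (m : 'rV[R]_n) :
  measure_preserving (flip_head m).
Proof.
have ms : measurable_fun [set: 'rV[R]_n.+1] (flip_head m).
  apply: measurable_fun_rVP => i; case: (unliftP ord0 i) => [j|] ->.
    rewrite (_ : _ \o _ = fun x : 'rV[R]_n.+1 => x 0 (lift ord0 j)).
      exact: measurable_rV_coordE.
    by apply/funext => x; rewrite /rV_coord /= mxE liftK.
  rewrite (_ : _ \o _ = fun x : 'rV[R]_n.+1 =>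
    - x 0 ord0 + \sum_j m 0 j * x 0 (lift ord0 j)).
    apply: measurable_funD.
      by apply: measurableT_comp => //; exact: measurable_rV_coordE.
    apply: measurable_sum => j; apply: measurable_funM => //.
    exact: measurable_rV_coordE.
  by apply/funext => x; rewrite /rV_coord /= mxE unlift_none.
split=> // A mA; rewrite !lebesgue_rV_ysection//; last exact: measurable_rV_comp.
apply: eq_integral => v _.
have /= <- := lebesgue_measure_affine true (\sum_j m 0 j * v 0 j)
  (measurable_ysection_rV v mA).
have E (a : R) : flip_head m (rV_cons (a : measurableTypeR R, v)) =
    rV_cons ((-1) ^+ true * a + \sum_j m 0 j * v 0 j : measurableTypeR R, v).
  apply/rowP => i; rewrite !mxE unlift_none/= expr1 mulN1r.
  case: unliftP => [j|] _ /=; first by rewrite mxE liftK.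
  by congr (_ + _); apply: eq_bigr => j _; rewrite mxE liftK.
by congr lebesgue_measure; apply/seteqP; split => a /=; rewrite E.
Qed.

End measure_preserving.

(** * Compactness and integrability in R^n *)

Section rV_borel.
Context {R : realType} {n : nat}.
Implicit Types (x y : 'rV[R]_n) (A : set 'rV[R]_n) (f g h : 'rV[R]_n -> R).
Local Notation mu := (@lebesgue_rV R n).

Lemma rV_norm_leP x r : 0 <= r -> (`|x| <= r) <-> (forall i, `|x 0 i| <= r).
Proof.
move=> r0; rewrite [`|x|]/Num.norm /= mx_normrE; split=> [/bigmax_leP[_ h] i|h].
  exact: (h (0, i)).
by apply/bigmax_leP; split => // -[i j] _ /=; rewrite ord1.
Qed.

Lemma rV_norm_coord x i : `|x 0 i| <= `|x|.
Proof. by move: i; apply/rV_norm_leP. Qed.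

(** The sigma-algebra is generated by coordinates, so an open set has to be exhausted by countably
    many products of intervals: the cells of side [1 / k.+1] with corners in the scaled integer
    lattice that lie inside it. *)
Lemma open_measurable_rV A : open A -> measurable A.
Proof.
move=> oA.
pose cell (k : nat * 'rV[int]_n) : set 'rV[R]_n :=
  [set x | forall i, [set t | t * k.1.+1%:R \in
     `[(k.2 0 i)%:~R, (k.2 0 i)%:~R + 1[] (x 0 i)].
pose F k := if `[< cell k `<=` A >] then cell k else set0.
have -> : A = \bigcup_k F k.
  apply/seteqP; split => [x Ax|x [k _]]; last first.
    by rewrite /F; case: asboolP => // + cx; exact.
  have /nbhs_ballP[e e0 eA] : nbhs x A by exact: open_nbhs_nbhs.
  have [k ke] : exists k : nat, k.+1%:R^-1 < e.
    exists (Num.truncn e^-1); rewrite -[ltRHS]invrK ltf_pV2 ?posrE ?invr_gt0//.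
    by rewrite truncnS_gt.
  pose z : 'rV[int]_n := \row_i Num.floor (x 0 i * k.+1%:R).
  exists (k, z) => //; rewrite /F.
  have cx : cell (k, z) x.
    move=> i /=; rewrite in_itv/= mxE.
    by rewrite Num.Theory.floor_le// -intrD1 floorD1_gt.
  case: asboolP => // ncell; exfalso; apply: ncell => y cy; apply: eA.
  rewrite -ball_normE /ball_ /=; apply: le_lt_trans ke.
  apply/rV_norm_leP => // i; rewrite !mxE.
  have := cx i; have := cy i; rewrite /= !in_itv/=.
  move=> /andP[y1 y2] /andP[x1 x2].
  rewrite -(ler_pM2r (x := k.+1%:R))// mulVf// -[X in _ * X]ger0_norm//.
  rewrite -normrM mulrBl ler_norml; apply/andP; split; lra.
apply: countable_bigcupT_measurable => [|k]; first exact: countableP.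
rewrite /F; case: asboolP => // _.
apply: (measurable_rV_box (A := fun i => [set t | t * k.1.+1%:R \in
     `[(k.2 0 i)%:~R, (k.2 0 i)%:~R + 1[])) => i.
rewrite -[X in measurable X]setTI.
have mM : measurable_fun [set: measurableTypeR R]
  (fun t : measurableTypeR R => t * k.1.+1%:R : measurableTypeR R).
  by apply: measurable_funM.
exact: (mM measurableT [set t | t \in _] (measurable_itv _)).
Qed.

Lemma closed_measurable_rV A : closed A -> measurable A.
Proof.
by move=> cA; rewrite -[A]setCK; apply/measurableC; apply: open_measurable_rV; exact: closed_openC.
Qed.

Lemma compact_measurable_rV A : compact A -> measurable A.
Proof.
move=> cA; apply: closed_measurable_rV.
by apply: (compact_closed _ cA); exact: norm_hausdorff.
Qed.

Lemma continuous_measurable_rV f : continuous f -> measurable_fun setT f.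
Proof.
move=> cf; apply: (measurability _ (RGenOpens.measurableE R)) => _ [_ [a [b ->]] <-].
rewrite setTI; apply: open_measurable_rV.
by apply: open_comp; [move=> x _; exact: cf|exact: interval_open].
Qed.

Definition cube (r : R) : set 'rV[R]_n := [set x | `|x| <= r].

Lemma cubeE r : 0 <= r -> cube r = [set x | forall i, `[-r, r]%classic (x 0 i)].
Proof.
move=> r0; apply/seteqP; split=> x.
  by move/(rV_norm_leP _ r0) => h i; rewrite /= in_itv/= -ler_norml.
by move=> h; apply/(rV_norm_leP _ r0) => i; have := h i; rewrite /= in_itv/= -ler_norml.
Qed.

Lemma compact_cube r : compact (cube r).
Proof.
have [r0|r0] := leP 0 r.
  by rewrite cubeE//; apply: (rV_compact (A := fun=> `[- r, r]%classic)) => _; exact: segment_compact.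
rewrite (_ : cube r = set0); first exact: compact0.
by apply/seteqP; split=> // x /(le_trans (normr_ge0 _)); rewrite leNgt r0.
Qed.

Lemma measurable_cube r : measurable (cube r).
Proof. by apply: compact_measurable_rV; exact: compact_cube. Qed.

Lemma cube_finite r : (mu (cube r) < +oo)%E.
Proof.
have [r0|r0] := leP 0 r.
  rewrite cubeE// (lebesgue_rV_box (A := fun=> `[- r, r]%classic))//.
  rewrite (eq_bigr (fun=> (r + r)%:E)) ?prodEFin ?ltry// => i _.
  rewrite lebesgue_measure_itv/= lte_fin; case: ltP => h.
    by rewrite -EFinB opprK.
  by congr (_%:E); lra.
rewrite (_ : cube r = set0) ?measure0//.
by apply/seteqP; split=> // x /(le_trans (normr_ge0 _)); rewrite leNgt r0.
Qed.

Lemma compact_sub_cube A : compact A -> exists2 r, 0 <= r & A `<=` cube r.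
Proof.
move=> /compact_bounded[M [_ h]].
exists (`|M| + 1); first by rewrite addr_ge0.
by move=> x Ax; apply: (h (`|M| + 1)) => //; rewrite ltr_pwDr// ler_norm.
Qed.

Lemma continuous_bounded_cube f r : continuous f ->
  exists2 M, 0 <= M & forall x, `|x| <= r -> `|f x| <= M.
Proof.
move=> cf.
have : compact (f @` cube r).
  by apply: continuous_compact; [exact: continuous_subspaceT|exact: compact_cube].
move=> /compact_bounded[M [_ h]]; exists (`|M| + 1); first by rewrite addr_ge0.
move=> x xr; apply: (h (`|M| + 1)); first by rewrite ltr_pwDr// ler_norm.
by exists x.
Qed.

Lemma continuous_locally_integrable f : continuous f -> locally_integrable_rV f.
Proof.
move=> cf; have mf := continuous_measurable_rV cf; split => // K cK.
have [r r0 Kr] := compact_sub_cube cK.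
apply: (integrableS (measurable_cube r)) => //; first exact: compact_measurable_rV.
apply: measurable_bounded_integrable.
- exact: measurable_cube.
- exact: cube_finite.
- exact: measurable_funS mf.
- have [M M0 h] := continuous_bounded_cube r cf.
  exists M; split; first exact: num_real.
  by move=> z Mz x xr; exact: le_trans (h _ xr) (ltW Mz).
Qed.

Lemma locally_integrable_cst (c : R) :
  locally_integrable_rV (fun _ : 'rV[R]_n => c).
Proof. by apply: continuous_locally_integrable; exact: cst_continuous. Qed.

(** The dominating function for products of a locally integrable [g] with factors bounded by [M] and
    supported in a common cube. *)
Lemma integrable_majorant g M r : locally_integrable_rV g ->
  mu.-integrable setT (fun x => (M * `|g x| * (\1_(cube r) x))%:E).
Proof.
move=> [mg ig].
have := ig _ (@compact_cube r).
rewrite integrable_mkcond; last exact: measurable_cube.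
move=> /(integrableZl measurableT (`|M|)) h.
apply: le_integrable h => //.
  apply/measurable_EFinP; apply: measurable_funM; last first.
    by apply: measurable_indic; exact: measurable_cube.
  by apply: measurable_funM => //; exact: measurableT_comp.
move=> x _ /=; rewrite patchE /=; rewrite indicE.
case: ifPn => _; last by rewrite mulr0 mule0.
by rewrite mulr1 -EFinM lee_fin !normrM !normr_id.
Qed.

Lemma mul_majorant g h M r : (forall x, `|h x| <= M) ->
  (forall x, r < `|x| -> h x = 0) ->
  forall x, `|g x * h x| <= M * `|g x| * \1_(cube r) x.
Proof.
move=> hM hr x; rewrite indicE; have [xr|xr] := leP `|x| r.
  by rewrite mem_set// mulr1 normrM mulrC ler_wpM2r.
by rewrite hr// mulr0 normr0 memNset ?mulr0//; apply/negP; rewrite -ltNge.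
Qed.

Lemma integrable_mul g h M r : locally_integrable_rV g ->
  measurable_fun setT h -> (forall x, `|h x| <= M) ->
  (forall x, r < `|x| -> h x = 0) ->
  mu.-integrable setT (fun x => (g x * h x)%:E).
Proof.
move=> ig mh hM hr; apply: le_integrable (integrable_majorant M r ig) => //.
  by apply/measurable_EFinP; apply: measurable_funM => //; exact: ig.1.
move=> x _; rewrite lee_fin; apply: le_trans (ler_norm _).
exact: mul_majorant.
Qed.

Lemma integrable_bounded_support h M r :
  measurable_fun setT h -> (forall x, `|h x| <= M) ->
  (forall x, r < `|x| -> h x = 0) ->
  mu.-integrable setT (fun x => (h x)%:E).
Proof.
move=> mh hM hr; have := integrable_mul (locally_integrable_cst 1) mh hM hr.
by apply: eq_integrable => // x _; rewrite /= mul1r.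
Qed.

Lemma cvg_Rintegral (f_ : nat -> 'rV[R]_n -> R) f (G : 'rV[R]_n -> R) :
  (forall k, measurable_fun setT (f_ k)) ->
  (forall x, f_ k x @[k --> \oo] --> f x) ->
  (forall k x, `|f_ k x| <= G x) -> mu.-integrable setT (EFin \o G) ->
  \int[mu]_x f_ k x @[k --> \oo] --> \int[mu]_x f x.
Proof.
move=> mf_ ff fG iG.
have mf : measurable_fun setT f by exact: measurable_fun_cvg mf_ (fun x _ => ff x).
have [] := @dominated_convergence _ _ _ mu setT measurableT
  (fun k x => (f_ k x)%:E) (fun x => (f x)%:E) (EFin \o G).
- by move=> k; exact/measurable_EFinP.
- exact/measurable_EFinP.
- by apply: aeW => x _; apply: cvg_EFin; [exact: nearW|exact: ff].
- exact: iG.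
- by apply: aeW => x k _ /=; rewrite lee_fin.
move=> /integrable_fin_num fin _ h.
apply: fine_cvg; rewrite fineK//; exact: fin.
Qed.

Lemma cvg_Rintegral_mul g (h_ : nat -> 'rV[R]_n -> R) h M r :
  locally_integrable_rV g -> (forall k, measurable_fun setT (h_ k)) ->
  (forall k x, `|h_ k x| <= M) -> (forall k x, r < `|x| -> h_ k x = 0) ->
  (forall x, h_ k x @[k --> \oo] --> h x) ->
  \int[mu]_x (g x * h_ k x) @[k --> \oo] --> \int[mu]_x (g x * h x).
Proof.
move=> ig mh hM hr hh.
apply: (cvg_Rintegral (f_ := fun k x => g x * h_ k x) (f := fun x => g x * h x)
  (G := fun x => M * `|g x| * \1_(cube r) x)).
- by move=> k; apply: measurable_funM => //; exact: ig.1.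
- by move=> x; apply: cvgM; [exact: cvg_cst|exact: hh].
- by move=> k x; apply: mul_majorant; [exact: hM|exact: hr].
- exact: integrable_majorant.
Qed.

Lemma cvg_Rintegral_bounded (h_ : nat -> 'rV[R]_n -> R) h M r :
  (forall k, measurable_fun setT (h_ k)) -> (forall k x, `|h_ k x| <= M) ->
  (forall k x, r < `|x| -> h_ k x = 0) ->
  (forall x, h_ k x @[k --> \oo] --> h x) ->
  \int[mu]_x h_ k x @[k --> \oo] --> \int[mu]_x h x.
Proof.
move=> mh hM hr hh.
have := cvg_Rintegral_mul (locally_integrable_cst 1) mh hM hr hh.
under eq_fun do under eq_Rintegral do rewrite mul1r.
by under eq_Rintegral do rewrite mul1r.
Qed.

End rV_borel.

(** * Derivatives along paths *)

(** Reduces directional derivatives to derivatives on the line, where the chain rule and the mean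
    value theorem are available. *)
Lemma is_derive_path0 {R : realType} {V : normedModType R} (f : V -> R)
    (x v : V) (d : R) :
  is_derive x v f d <-> is_derive (0 : R) 1 (fun t : R => f (t *: v + x)) d.
Proof.
suff E : (fun h : R => h^-1 *: ((f \o shift x) (h *: v) - f x)) =
   (fun h : R => h^-1 *: (((fun t : R => f (t *: v + x)) \o shift 0) (h *: 1) -
     f (0 *: v + x))).
  by split=> -[df fE]; split; move: df fE; rewrite /derivable /derive E.
by apply/funext => h /=; rewrite scale0r add0r [_ *: 1]mulr1 addr0.
Qed.

Section directional_derivative.
Context {R : realType} {V : normedModType R}.
Implicit Types (f : V -> R) (x v : V).

Lemma is_derive_path f x v (t d : R) :
  is_derive (t *: v + x) v f d ->
  is_derive t 1 (fun s : R => f (s *: v + x)) d.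
Proof.
move=> /is_derive_path0 h; apply/is_derive_path0; move: h.
congr is_derive; apply/funext => s.
by rewrite addrA -scalerDl [s *: 1]mulr1.
Qed.

(** Bounding [c] only through absolute values lets one statement serve positive, negative and zero
    [h]. *)
Lemma MVT_path f (df : V -> R) x v (h : R) :
  (forall y, is_derive y v f (df y)) ->
  exists2 c, `|c| <= `|h| & f (h *: v + x) - f x = h * df (c *: v + x).
Proof.
move=> fE; pose g (t : R) := f (t *: v + x).
have gE (t : R) : is_derive t 1 g (df (t *: v + x)) by exact: is_derive_path.
have cg (A : set R) : {within A, continuous g}.
  apply: continuous_subspaceT => t; apply: differentiable_continuous.
  by apply/derivable1_diffP; case: (gE t).
have g0 : g 0 = f x by rewrite /g scale0r add0r.
have [h0|h0|h0] := ltgtP 0 h.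
- have [c] := MVT h0 (fun t _ => gE t) (cg _).
  rewrite in_itv/= g0 subr0 mulrC => /andP[c0 ch] E; exists c => //.
  by rewrite !gtr0_norm// ltW.
- have [c] := MVT h0 (fun t _ => gE t) (cg _).
  rewrite in_itv/= g0 sub0r => /andP[c0 ch] E; exists c.
    by rewrite !ltr0_norm// lerN2 ltW.
  by apply: oppr_inj; rewrite opprB E; ring.
- by exists 0; rewrite -?h0 ?normr0// scale0r !add0r subrr mul0r.
Qed.

Lemma is_derive_comp f x v (F : R -> R) (a b : R) :
  is_derive (f x) 1 F a -> is_derive x v f b -> is_derive x v (F \o f) (a * b).
Proof.
move=> FE /is_derive_path0 fE; apply/is_derive_path0.
by apply: is_derive1_comp => //; rewrite scale0r add0r.
Qed.

Lemma is_derive_mul f g x v (a b : R) : is_derive x v f a ->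
  is_derive x v g b ->
  is_derive x v (fun y => f y * g y) (f x * b + g x * a).
Proof. by move=> fE gE; exact: is_deriveM. Qed.

End directional_derivative.

Lemma is_derive_affine1 {R : realType} (a b t : R) :
  is_derive t 1 (fun s : R => s * a + b) a.
Proof.
have := is_deriveD (is_derive_mul (is_derive_id t 1) (is_derive_cst a t 1))
  (is_derive_cst b t 1).
by rewrite mulr0 add0r mulr1 addr0.
Qed.

(** * Flat functions: powers of [1 / t] times [exp (- 1 / t)], extended by zero *)

Section flat.
Context {R : realType}.
Implicit Types (t : R) (j : nat).

(* The derivative of [flat j] is [flat j.+2 - j%:R * flat j.+1], so the family is
   closed under differentiation up to linear combinations. *)
Definition flat j t : R := if 0 < t then t^-1 ^+ j * expR (- t^-1) else 0.

Lemma flat_ge0 j t : 0 <= flat j t.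
Proof.
rewrite /flat; case: ifPn => // t0.
by rewrite mulr_ge0 ?expR_ge0// exprn_ge0// invr_ge0 ltW.
Qed.

Lemma flat0_gt0 t : 0 < t -> 0 < flat 0 t.
Proof. by move=> t0; rewrite /flat t0 mul1r expR_gt0. Qed.

Lemma flat_eq0 j t : t <= 0 -> flat j t = 0.
Proof. by rewrite /flat ltNge => ->. Qed.

Lemma flat0_le1 t : flat 0 t <= 1.
Proof.
rewrite /flat; case: ifPn => // t0.
by rewrite mul1r expR_le1 oppr_le0 invr_ge0 ltW.
Qed.

(** The exponential dominates powers: with [y = 1 / t] and [N = (j + k).+1], the bound
    [y ^ N <= N! * exp y] absorbs [y ^ j] and leaves [t ^ k.+1]. *)
Lemma flat_le j k t : flat j t <= (j + k).+1`!%:R * `|t| ^+ k.+1.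
Proof.
rewrite /flat; case: ifPn => [t0|_]; last by rewrite mulr_ge0.
rewrite (gtr0_norm t0) expRN.
have y0 : 0 < t^-1 by rewrite invr_gt0.
have h : t^-1 ^+ (j + k).+1 <= (j + k).+1`!%:R * expR t^-1.
  rewrite mulrC -ler_pdivrMr ?ltr0n ?fact_gt0//.
  by apply: le_trans (expR_ge1Dxn (j + k) (ltW y0)); rewrite lerDr.
rewrite ler_pdivrMr ?expR_gt0// -mulrA (mulrC (t ^+ _)) mulrA.
have -> : t^-1 ^+ j = t^-1 ^+ (j + k).+1 * t ^+ k.+1.
  by rewrite -addnS exprD -mulrA -exprMn mulVf ?expr1n ?mulr1// gt_eqF.
by rewrite ler_wpM2r// exprn_ge0// ltW.
Qed.

Lemma is_derive_flat j t :
  is_derive t 1 (flat j) (flat j.+2 t - j%:R * flat j.+1 t).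
Proof.
have [t0|t0|<-] := ltgtP 0 t.
- have E : \forall s \near t, s^-1 ^+ j * expR (- s^-1) = flat j s.
    by near=> s; rewrite /flat ifT//; near: s; exact: lt_nbhsr.
  apply: (near_eq_is_derive E).
  have dV : is_derive t 1 (fun s : R => s^-1) (- t ^- 2 *: 1).
    by apply: is_deriveV; rewrite gt_eqF.
  have dX : is_derive t 1 (fun s : R => s^-1 ^+ j)
      ((j%:R * t^-1 ^+ j.-1) *: (- t ^- 2 *: 1)).
    by rewrite -[X in is_derive _ _ X]exprfctE; exact: is_deriveX.
  have dE : is_derive t 1 (fun s : R => expR (- s^-1))
      (expR (- t^-1) * - (- t ^- 2 *: 1)).
    by apply: (is_derive1_comp (f := expR) (g := fun s => - s^-1)).
  apply: is_derive_eq (is_derive_mul dX dE) _.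
  rewrite /flat t0; case: j {E dX} => [|j] /=.
    by rewrite !mul0r !scale0r !expr0 !mul1r mulr0 addr0 subr0 /GRing.scale/=
      exprVn; ring.
  by rewrite /GRing.scale/= -exprVn !exprS; ring.
- have E : \forall s \near t, cst 0 s = flat j s.
    by near=> s; rewrite flat_eq0// ltW//; near: s; exact: lt_nbhsl.
  apply: (near_eq_is_derive E).
  by rewrite !flat_eq0 ?mulr0 ?subr0 ?ltW//; exact: is_derive_cst.
- rewrite !flat_eq0// mulr0 subr0.
  have h : (fun h : R => h^-1 *: ((flat j \o shift 0) (h *: 1) - flat j 0)) @ 0^'
      --> (0 : R).
    apply/cvgr0Pnorm_le => e e0; near=> h.
    rewrite /= addr0 [h *: 1]mulr1 (@flat_eq0 _ 0)// subr0 normrM normfV.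
    rewrite ler_pdivrMl ?normr_gt0; last by near: h; exact: nbhs_dnbhs_neq.
    rewrite ger0_norm ?flat_ge0//.
    (* Taking [k = 1] gives a quadratic bound at [0], so the difference quotient is [O(h)] and the
       derivative there is [0]. *)
    apply: le_trans (flat_le j 1 h) _.
    rewrite expr2 mulrA mulrC ler_wpM2l// -ler_pdivlMl ?ltr0n ?fact_gt0//.
    near: h; apply: dnbhs0_le.
    by rewrite mulr_gt0// invr_gt0 ltr0n fact_gt0.
  by split; [apply: cvgP h|apply: cvg_lim h].
Unshelve. all: by end_near. Qed.

Lemma continuous_flat j : continuous (flat j).
Proof.
move=> t; apply: differentiable_continuous; apply/derivable1_diffP.
by case: (is_derive_flat j t).
Qed.

End flat.

(** * Smooth functions and test functions *)

Lemma continuous_atP {R : realType} {V W : normedModType R} (f : V -> W) x :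
  {for x, continuous f} <-> forall e, 0 < e ->
    exists2 d, 0 < d & forall y, `|x - y| < d -> `|f x - f y| <= e.
Proof.
split=> [/cvgrPdist_le fx e /fx/nbhs_ballP[d /= d0 dP]|fx].
  by exists d => // y xy; apply: dP; rewrite -ball_normE.
apply/cvgrPdist_le => e /fx[d d0 dP]; apply/nbhs_ballP; exists d => // y.
by rewrite -ball_normE /ball_ /= => /dP.
Qed.

Section smooth.
Context {R : realType} {n : nat}.
Implicit Types (f g : 'rV[R]_n -> R) (x v w a : 'rV[R]_n) (i : 'I_n).
Local Notation e_ i := (delta_mx 0 i : 'rV[R]_n).

Lemma smooth_continuous f : smooth f -> continuous f.
Proof. by move=> /(_ [::])[]. Qed.

Lemma smooth_is_derive f i x :
  smooth f -> is_derive x (e_ i) f (partial i f x).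
Proof. by move=> /(_ [::])[_ /(_ i x) df]; exact: derivableP. Qed.

Lemma smooth_partial f i : smooth f -> smooth (partial i f).
Proof.
move=> sf s; have := sf (rcons s i).
by rewrite /iter_partial -cats1 foldr_cat.
Qed.

(** Smoothness quantifies over all iterated partial derivatives. A class stable under a single
    differentiation allows induction on the list of directions, and each smoothness proof then
    amounts to finding such a class. *)
Lemma smooth_class (C : ('rV[R]_n -> R) -> Prop) :
  (forall f, C f -> continuous f /\ forall i,
     exists2 df, C df & forall x, is_derive x (e_ i) f (df x)) ->
  forall f, C f -> smooth f.
Proof.
move=> HC f Cf s; have {Cf} : C (iter_partial s f).
  elim: s => [//|i s /HC[_ /(_ i)[df Cdf dfE]]] /=.
  rewrite (_ : partial _ _ = df)//.
  by apply/funext => x; case: (dfE x).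
by move=> /HC[cf df]; split => // i x; have [g _ /(_ x)[]] := df i.
Qed.

Lemma is_derive_coord i x v : is_derive x v (fun y : 'rV[R]_n => y 0 i) (v 0 i).
Proof.
apply/is_derive_path0.
rewrite (_ : (fun t => _) = (fun t : R => t * v 0 i + x 0 i)); last first.
  by apply/funext => t; rewrite !mxE.
exact: is_derive_affine1.
Qed.

(** The closure properties have to be proved together: differentiating a product or [flat j (f x)]
    yields sums of products of members, including other members of the [flat] family. *)
Inductive smooth_generated : ('rV[R]_n -> R) -> Prop :=
| SgSmooth f : smooth f -> smooth_generated f
| SgCst c : smooth_generated (fun=> c)
| SgCoord i : smooth_generated (fun x => x 0 i)
| SgAdd f g : smooth_generated f -> smooth_generated g ->
    smooth_generated (fun x => f x + g x)
| SgMul f g : smooth_generated f -> smooth_generated g ->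
    smooth_generated (fun x => f x * g x)
| SgFlat j f : smooth_generated f -> smooth_generated (fun x => flat j (f x)).

Lemma smooth_generatedP f : smooth_generated f -> smooth f.
Proof.
move: f; apply: smooth_class => f; elim => {f}
  [f sf|c|i|f g _ [cf df] _ [cg dg]|f g Cf [cf df] Cg [cg dg]|j f Cf [cf df]].
- split=> [|i]; first exact: smooth_continuous.
  exists (partial i f); first by apply: SgSmooth; exact: smooth_partial.
  by move=> x; exact: smooth_is_derive.
- split=> [|i]; first exact: cst_continuous.
  exists (fun=> 0); first exact: SgCst.
  by move=> x; exact: is_derive_cst.
- split=> [|k]; first exact: coord_continuous.
  exists (fun=> e_ k 0 i); first exact: SgCst.
  by move=> x; exact: is_derive_coord.
- split=> [x|i]; first by apply: continuousD; [exact: cf|exact: cg].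
  have [df' Cdf' dfE] := df i; have [dg' Cdg' dgE] := dg i.
  exists (fun x => df' x + dg' x); first exact: SgAdd.
  by move=> x; exact: is_deriveD.
- split=> [x|i]; first by apply: continuousM; [exact: cf|exact: cg].
  have [df' Cdf' dfE] := df i; have [dg' Cdg' dgE] := dg i.
  exists (fun x => f x * dg' x + g x * df' x).
    by apply: SgAdd; exact: SgMul.
  by move=> x; exact: is_derive_mul.
- split=> [x|i].
    by apply: continuous_comp; [exact: cf|exact: continuous_flat].
  have [df' Cdf' dfE] := df i.
  exists (fun x => (flat j.+2 (f x) + - j%:R * flat j.+1 (f x)) * df' x).
    apply: SgMul => //; apply: SgAdd; first exact: SgFlat.
    by apply: SgMul; [exact: SgCst|exact: SgFlat].
  move=> x; apply: is_derive_comp => //.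
  by rewrite mulNr; exact: is_derive_flat.
Qed.

Lemma smooth_cst (c : R) : smooth (fun _ : 'rV[R]_n => c : R).
Proof. exact/smooth_generatedP/SgCst. Qed.

Lemma smooth_coord i : smooth (fun x : 'rV[R]_n => x 0 i).
Proof. exact/smooth_generatedP/SgCoord. Qed.

Lemma smoothD f g : smooth f -> smooth g -> smooth (fun x => f x + g x).
Proof.
by move=> sf sg; apply: smooth_generatedP; apply: SgAdd; exact: SgSmooth.
Qed.

Lemma smoothM f g : smooth f -> smooth g -> smooth (fun x => f x * g x).
Proof.
by move=> sf sg; apply: smooth_generatedP; apply: SgMul; exact: SgSmooth.
Qed.

Lemma smooth_flat j f : smooth f -> smooth (fun x => flat j (f x)).
Proof. by move=> sf; apply: smooth_generatedP; apply: SgFlat; exact: SgSmooth. Qed.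

Lemma smooth_prod (I : Type) (r : seq I) (F : I -> 'rV[R]_n -> R) :
  (forall k, smooth (F k)) -> smooth (fun x => \prod_(i <- r) F i x).
Proof.
move=> sF; elim: r => [|i r IHr].
  by under eq_fun do rewrite big_nil; exact: smooth_cst.
by under eq_fun do rewrite big_cons; exact: smoothM.
Qed.

Lemma smooth_sum (I : Type) (r : seq I) (F : I -> 'rV[R]_n -> R) :
  (forall k, smooth (F k)) -> smooth (fun x => \sum_(i <- r) F i x).
Proof.
move=> sF; elim: r => [|i r IHr].
  by under eq_fun do rewrite big_nil; exact: smooth_cst.
by under eq_fun do rewrite big_cons; exact: smoothD.
Qed.

Lemma partialM i f g x : smooth f -> smooth g ->
  partial i (fun y => f y * g y) x = f x * partial i g x + g x * partial i f x.
Proof.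
move=> sf sg.
by case: (is_derive_mul (smooth_is_derive i x sf) (smooth_is_derive i x sg)).
Qed.

(* The mean value theorem along [v] makes directional derivatives additive as
   soon as one of them is continuous. *)
Lemma is_derive_dirD f (D E : 'rV[R]_n -> R) v w : continuous D ->
  (forall x, is_derive x v f (D x)) -> (forall x, is_derive x w f (E x)) ->
  forall x, is_derive x (v + w) f (D x + E x).
Proof.
move=> cD dD dE x.
have h : (fun h : R => h^-1 *: ((f \o shift x) (h *: (v + w)) - f x)) @ 0^'
    --> D x + E x.
  rewrite (_ : (fun h => _) = (fun h : R =>
    h^-1 * (f (h *: v + (h *: w + x)) - f (h *: w + x)) +
    h^-1 *: ((f \o shift x) (h *: w) - f x))); last first.
    apply/funext => h /=.
    rewrite /shift /= (scalerDr h v w) -addrA; set a := f _; set b := f (h *: w + x).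
    by change (h^-1 * (a - f x) = h^-1 * (a - b) + h^-1 * (b - f x)); ring.
  apply: cvgD; last by case: (dE x) => df <-.
  apply/cvgrPdist_le => e e0.
  have /cvgrPdist_le/(_ e e0) := cD x.
  move=> /nbhs_ballP[d /= d0 dP]; near=> h.
  have [c ch ->] := MVT_path (h *: w + x) h dD.
  have h0 : h != 0 by near: h; exact: nbhs_dnbhs_neq.
  rewrite mulKf//; apply: dP; rewrite -ball_normE /ball_ /=.
  rewrite addrA opprD [- _ - x]addrC addrA subrr sub0r normrN.
  apply: le_lt_trans (ler_normD _ _) _; rewrite !normrZ.
  apply: (@le_lt_trans _ _ (`|h| * (`|v| + `|w|))).
    by rewrite mulrDr lerD2r ler_wpM2r.
  apply: (@le_lt_trans _ _ (`|h| * (1 + `|v| + `|w|))).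
    by rewrite ler_wpM2l// -addrA lerDr.
  have p : 0 < 1 + `|v| + `|w| by rewrite -addrA ltr_pwDl// addr_ge0.
  rewrite -ltr_pdivlMr//; near: h; apply: dnbhs0_lt.
  by rewrite divr_gt0.
by split; [apply: cvgP h|apply: cvg_lim h].
Unshelve. all: by end_near. Qed.

Lemma is_derive_dirZ f (d : R) v x (c : R) :
  is_derive x v f d -> is_derive x (c *: v) f (c * d).
Proof.
move=> /is_derive_path0 h; apply/is_derive_path0.
rewrite (_ : (fun t => _) = (fun t : R => f (t *: v + x)) \o (fun t => t * c));
  last by apply/funext => t /=; rewrite scalerA.
rewrite mulrC; apply: is_derive1_comp; first by rewrite mul0r.
by have := is_derive_affine1 c 0 0; under eq_fun do rewrite addr0.
Qed.

(** Expands [v] in the standard basis and adds one direction at a time. Continuity of the partial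
    derivatives is what makes directional derivatives additive. *)
Lemma smooth_is_derive_dir f x v : smooth f ->
  is_derive x v f (\sum_i v 0 i * partial i f x).
Proof.
move=> sf.
suff H (r : seq 'I_n) : forall y, is_derive y (\sum_(i <- r) v 0 i *: e_ i) f
    (\sum_(i <- r) v 0 i * partial i f y).
  by have := H (index_enum _) x; rewrite -row_sum_delta.
elim: r => [|i r IHr] y; first by rewrite !big_nil; exact: is_derive0.
rewrite !big_cons; move: y; apply: (is_derive_dirD (D := fun y => v 0 i * _)).
- move=> y; apply: continuousM; first exact: cst_continuous.
  by apply: smooth_continuous; exact: smooth_partial.
- by move=> y; apply: is_derive_dirZ; exact: smooth_is_derive.
Qed.

Lemma is_derive_affine_comp f (M : 'M[R]_n) a i x : smooth f ->
  is_derive x (e_ i) (fun y => f (y *m M + a))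
    (\sum_j M i j * partial j f (x *m M + a)).
Proof.
move=> sf; apply/is_derive_path0.
have /is_derive_path0 := smooth_is_derive_dir (x *m M + a) (e_ i *m M) sf.
congr is_derive.
  by apply/funext => t; rewrite mulmxDl scalemxAl addrA.
by apply: eq_bigr => j _; rewrite -rowE mxE.
Qed.

(** Differentiating [f (x *m M + a)] gives a linear combination of functions of the same shape, so
    closing under sums is enough; constants account for the empty sum. *)
Inductive affine_generated (M : 'M[R]_n) a : ('rV[R]_n -> R) -> Prop :=
| AgComp f : smooth f -> affine_generated M a (fun x => f (x *m M + a))
| AgCst c : affine_generated M a (fun=> c)
| AgAdd f g : affine_generated M a f -> affine_generated M a g ->
    affine_generated M a (fun x => f x + g x).

Lemma mulmx_norm_le (M : 'M[R]_n) :
  exists2 K, 0 <= K & forall x, `|x *m M| <= K * `|x|.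
Proof.
exists (\sum_i \sum_j `|M i j|) => [|x].
  by apply: sumr_ge0 => i _; apply: sumr_ge0.
apply/rV_norm_leP => [|j].
  by rewrite mulr_ge0//; apply: sumr_ge0 => i _; apply: sumr_ge0.
rewrite mxE; apply: le_trans (ler_norm_sum _ _ _) _; rewrite mulr_suml.
apply: ler_sum => i _; rewrite normrM mulrC ler_pM//; last exact: rV_norm_coord.
by rewrite (bigD1 j)//= lerDl sumr_ge0.
Qed.

Lemma continuous_mulmx (M : 'M[R]_n) : continuous (mulmx^~ M : 'rV[R]_n -> _).
Proof.
move=> x; have [K K0 MK] := mulmx_norm_le M.
have K1 : 0 < 1 + K by rewrite ltr_pwDl.
apply/continuous_atP => e e0.
exists ((1 + K)^-1 * e) => [|y xy]; first by rewrite mulr_gt0// invr_gt0.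
rewrite -mulmxBl.
apply: le_trans (MK _) _.
apply: (@le_trans _ _ ((1 + K) * `|x - y|)).
  by rewrite ler_wpM2r// lerDr.
by rewrite -ler_pdivlMl// ltW.
Qed.

Lemma smooth_affine_comp f (M : 'M[R]_n) a : smooth f ->
  smooth (fun x => f (x *m M + a)).
Proof.
move=> sf; apply: (smooth_class (C := affine_generated M a)); last exact: AgComp.
have cs : continuous (fun x : 'rV[R]_n => x *m M + a).
  move=> x; apply/continuous_atP => e e0.
  have [d d0 dP] := (continuous_atP _ _).1 (@continuous_mulmx M x) e e0.
  by exists d => // y /dP; rewrite opprD addrACA subrr addr0.
move=> {sf}f; elim => {f} [f sf|c|f g _ [cf df] _ [cg dg]].
- split=> [x|i].
    by apply: (continuous_comp (f := fun x : 'rV[R]_n => x *m M + a));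
      [exact: cs|exact: smooth_continuous].
  exists (fun x => \sum_j M i j * partial j f (x *m M + a)); last first.
    by move=> x; exact: is_derive_affine_comp.
  elim: (index_enum _) => [|j r IHr].
    by under eq_fun do rewrite big_nil; exact: AgCst.
  under eq_fun do rewrite big_cons; apply: AgAdd => //.
  apply: (AgComp _ _ (f := fun y => M i j * partial j f y)).
  by apply: smoothM; [exact: smooth_cst|exact: smooth_partial].
- split=> [|i]; first exact: cst_continuous.
  by exists (fun=> 0); [exact: AgCst|move=> x; exact: is_derive_cst].
- split=> [x|i]; first by apply: continuousD; [exact: cf|exact: cg].
  have [df' Cdf' dfE] := df i; have [dg' Cdg' dgE] := dg i.
  exists (fun x => df' x + dg' x); first exact: AgAdd.
  by move=> x; exact: is_deriveD.
Qed.

(** Supports are handled from here on by a radius in the sup norm. *)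
Lemma test_functionP f :
  test_function f <-> smooth f /\ exists r, forall x, r < `|x| -> f x = 0.
Proof.
split=> -[sf]; last first.
  move=> [r fr]; split => //; apply: bounded_closed_compact; last first.
    exact: closed_closure.
  exists r; split; first exact: num_real.
  move=> M rM x cx; have cM : closed (cube M : set 'rV[R]_n).
    by apply: compact_closed; [exact: norm_hausdorff|exact: compact_cube].
  apply: cM; apply: closure_subset cx => y /= fy0.
  rewrite /cube /= leNgt; apply/negP => yM; move/negP: fy0; apply.
  by apply/eqP/fr; exact: lt_trans yM.
move=> /compact_sub_cube[r r0 fr]; split => //; exists r => x rx.
apply/eqP; apply: contraTT rx => fx0; rewrite -leNgt; apply: fr.
exact: subset_closure.
Qed.

Lemma test_function_bounded f : test_function f ->
  exists2 M, 0 <= M & forall x, `|f x| <= M.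
Proof.
move=> /test_functionP[sf [r fr]].
have [M M0 h] := continuous_bounded_cube r (smooth_continuous sf).
exists M => // x; have [/h//|rx] := leP `|x| r.
by rewrite fr// normr0.
Qed.

Lemma partial_outside f r i x : (forall y, r < `|y| -> f y = 0) ->
  r < `|x| -> partial i f x = 0.
Proof.
move=> fr rx; rewrite /partial.
rewrite -(near_eq_derive (f := cst 0)) ?derive_cst//.
have : \forall y \near x, r < `|y|.
  have o : open [set y : 'rV[R]_n | r < `|y|].
    apply: (open_comp (f := fun y : 'rV[R]_n => `|y|) (D := [set t | r < t])).
      by move=> y _; exact: norm_continuous.
    exact: open_gt.
  exact: (open_nbhs_nbhs (conj o rx)).
by apply: filterS => y ry; rewrite fr.
Qed.

Lemma test_function_partial f i : test_function f -> test_function (partial i f).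
Proof.
move=> /test_functionP[sf [r fr]]; apply/test_functionP; split.
  exact: smooth_partial.
by exists r => x rx; apply: (partial_outside _ fr).
Qed.

Lemma test_functionMl f g : smooth f -> test_function g ->
  test_function (fun x => f x * g x).
Proof.
move=> sf /test_functionP[sg [r gr]]; apply/test_functionP; split.
  exact: smoothM.
by exists r => x rx; rewrite gr// mulr0.
Qed.

Lemma test_function_affine_comp f (M : 'M[R]_n) a : M \in unitmx ->
  test_function f -> test_function (fun x => f (x *m M + a)).
Proof.
move=> Mu /test_functionP[sf [r fr]]; apply/test_functionP; split.
  exact: smooth_affine_comp.
have [K K0 MK] := mulmx_norm_le (invmx M).
exists (K * (`|r| + `|a|)) => x rx; apply: fr.
rewrite ltNge; apply/negP => xr; move: rx; apply/negP; rewrite -leNgt.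
rewrite -[x](mulmxK Mu); apply: le_trans (MK _) _; rewrite ler_wpM2l//.
rewrite -[_ *m _](addrK a); apply: le_trans (ler_normB _ _) _.
by rewrite lerD2r; apply: le_trans xr (ler_norm _).
Qed.

End smooth.

(** * The fundamental lemma and uniqueness of weak derivatives *)

Lemma cvg_cst_eq {R : realType} (u : nat -> R) (l c : R) :
  u @ \oo --> l -> (forall k, u k = c) -> l = c.
Proof.
move=> + uc; have -> : u = cst c by apply/funext => k; exact: uc.
by move=> /(cvg_lim (@Rhausdorff R)) <-; rewrite lim_cst.
Qed.

Section fundamental_lemma.
Context {R : realType} {n : nat}.
Implicit Types (a b x : 'rV[R]_n) (g : 'rV[R]_n -> R) (A : set 'rV[R]_n).
Local Notation mu := (@lebesgue_rV R n).

Definition open_box a b : set 'rV[R]_n :=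
  [set x | forall i, a 0 i < x 0 i < b 0 i].

(** The parameter [k] is a steepness. As it grows, each factor tends to [1] inside the box and stays
    [0] outside, so these test functions tend boundedly to the indicator of the box. *)
Definition box_bump (k : R) a b x : R :=
  \prod_i (flat 0 (k * (x 0 i - a 0 i)) * flat 0 (k * (b 0 i - x 0 i))).

Lemma box_bump_ge0 k a b x : 0 <= box_bump k a b x.
Proof. by apply: prodr_ge0 => i _; rewrite mulr_ge0// flat_ge0. Qed.

Lemma box_bump_gt0 k a b x : 0 < k -> open_box a b x -> 0 < box_bump k a b x.
Proof.
move=> k0 abx; apply: prodr_gt0 => i _; have /andP[ax xb] := abx i.
by rewrite mulr_gt0// flat0_gt0// mulr_gt0// subr_gt0.
Qed.

Lemma box_bump_norm_le1 k a b x : `|box_bump k a b x| <= 1.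
Proof.
rewrite normr_prod; apply: prodr_ile1 => i _; rewrite normr_ge0/=.
by rewrite ger0_norm ?mulr_ge0 ?flat_ge0// mulr_ile1 ?flat_ge0 ?flat0_le1.
Qed.

Lemma box_bump_eq0 k a b x : 0 < k -> ~ open_box a b x -> box_bump k a b x = 0.
Proof.
move=> k0 /existsNP[i] /negP; rewrite negb_and -!leNgt => abx.
rewrite /box_bump (bigD1 i)//=; case/orP: abx => h.
  by rewrite flat_eq0 ?mul0r// pmulr_rle0// subr_le0.
by rewrite [X in _ * X * _]flat_eq0 ?mulr0 ?mul0r// pmulr_rle0// subr_le0.
Qed.

Lemma open_box_norm a b x : open_box a b x -> `|x| <= `|a| + `|b|.
Proof.
move=> abx; apply/rV_norm_leP => [|i]; first exact: addr_ge0.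
have /andP[ax xb] := abx i.
have := rV_norm_coord a i; have := rV_norm_coord b i.
rewrite !ler_norml => /andP[? ?] /andP[? ?]; apply/andP; split.
  by rewrite opprD; lra.
lra.
Qed.

Lemma box_bump_outside k a b x : 0 < k -> `|a| + `|b| < `|x| -> box_bump k a b x = 0.
Proof. by move=> k0 xab; apply: box_bump_eq0 => // /open_box_norm; rewrite leNgt xab. Qed.

Lemma test_function_box_bump k a b : 0 < k -> test_function (box_bump k a b).
Proof.
move=> k0; apply/test_functionP; split; last first.
  by exists (`|a| + `|b|) => x; exact: box_bump_outside.
have lin (c d : R) i : smooth (fun x : 'rV[R]_n => c * (x 0 i + d)).
  by apply: smoothM; [exact: smooth_cst|apply: smoothD; [exact: smooth_coord|exact: smooth_cst]].
apply: smooth_prod => i; apply: smoothM; apply: smooth_flat; first exact: lin.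
have := lin (- k) (- b 0 i) i; congr smooth; apply/funext => x; ring.
Qed.

Lemma cvg_flat0 (c : R) : 0 < c ->
  flat 0 (m.+1%:R * c) @[m --> \oo] --> (1 : R).
Proof.
move=> c0; rewrite (_ : (fun m => _) = (fun m => expR (- (c^-1 * m.+1%:R^-1)))).
  have h : - (c^-1 * m.+1%:R^-1) @[m --> \oo] --> (- (c^-1 * 0) : R).
    by apply: cvgN; apply: cvgM; [exact: cvg_cst|exact: cvg_harmonic].
  have := @continuous_cvg _ _ _ \oo _ _ _ _ (@continuous_expR R _) h.
  by rewrite mulr0 oppr0 expR0; apply.
by apply/funext => m; rewrite /flat mulr_gt0// mul1r invfM mulrC.
Qed.

Lemma cvg_box_bump a b x :
  box_bump m.+1%:R a b x @[m --> \oo] --> (\1_(open_box a b) x : R).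
Proof.
rewrite indicE; have [abx|abx] := asboolP (open_box a b x); last first.
  rewrite memNset//= (_ : (fun m => _) = cst 0); first exact: cvg_cst.
  by apply/funext => m; exact: box_bump_eq0.
rewrite mem_set//= /box_bump.
elim: (index_enum _) => [|i r IHr].
  by under eq_fun do rewrite big_nil; exact: cvg_cst.
have M1 (u v : nat -> R) : u @ \oo --> (1 : R) -> v @ \oo --> (1 : R) ->
    u k * v k @[k --> \oo] --> (1 : R).
  by move=> hu hv; have := cvgM hu hv; rewrite mulr1; apply.
under eq_fun do rewrite big_cons.
apply: (M1) => //.
have /andP[ax xb] := abx i.
by apply: (M1); apply: cvg_flat0; rewrite subr_gt0.
Qed.

Definition open_boxes : set (set 'rV[R]_n) :=
  [set A | exists a b, A = open_box a b].

Lemma open_boxI a b a' b' : open_box a b `&` open_box a' b' =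
  open_box (\row_i Num.max (a 0 i) (a' 0 i)) (\row_i Num.min (b 0 i) (b' 0 i)).
Proof.
apply/seteqP; split => x.
  move=> [h h'] i; rewrite !mxE gt_max lt_min.
  by move: (h i) (h' i) => /andP[h1 h2] /andP[h3 h4]; rewrite h1 h2 h3 h4.
move=> h; split => i; have := h i;
  by rewrite !mxE gt_max lt_min => /andP[/andP[h1 h2] /andP[h3 h4]]; apply/andP.
Qed.

Lemma setI_closed_open_boxes : setI_closed open_boxes.
Proof.
move=> _ _ [a [b ->]] [a' [b' ->]]; rewrite open_boxI.
by do 2 eexists.
Qed.

(** The slab where one coordinate lies in an open interval is the union over [k] of the boxes
    confining all other coordinates to []-k, k[]. *)
Lemma measurable_open_boxes : measurable `<=` <<s open_boxes >>.
Proof.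
apply: smallest_sub; first exact: smallest_sigma_algebra.
elim/big_ind : _ => [//|A B sA sB|i _ _ [Y mY <-]].
  by rewrite subUset.
have mi : measurable_fun [set: g_sigma_algebraType open_boxes]
    (@rV_coord R n i : g_sigma_algebraType open_boxes -> R).
  apply: (measurability _ (RGenOpens.measurableE R)) => _ [_ [a [b ->]] <-].
  rewrite setTI.
  pose c (s : R) (k : nat) (d : R) : 'rV[R]_n :=
    \row_j if j == i then d else s * k%:R.
  rewrite (_ : _ @^-1` _ = \bigcup_k open_box (c (-1) k a) (c 1 k b)).
    apply: bigcup_measurable => k _; apply: sub_sigma_algebra.
    by exists (c (-1) k a), (c 1 k b).
  apply/seteqP; split => [x|x [k _ /(_ i)]] /=; last first.
    by rewrite in_itv/= !mxE eqxx.
  rewrite in_itv/= => xab; exists (Num.truncn `|x|).+1 => // j; rewrite !mxE.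
  case: eqP => [->//|_]; rewrite mulN1r mul1r -ltr_norml.
  by apply: le_lt_trans (rV_norm_coord x j) _; exact: truncnS_gt.
exact: mi.
Qed.

Lemma Rintegral_box0 g a b : locally_integrable_rV g ->
  (forall phi, test_function phi -> \int[mu]_x (g x * phi x) = 0) ->
  \int[mu]_x (g x * \1_(open_box a b) x) = 0.
Proof.
move=> ig g0.
have cv : \int[mu]_x (g x * box_bump k.+1%:R a b x) @[k --> \oo]
    --> \int[mu]_x (g x * \1_(open_box a b) x).
  apply: (cvg_Rintegral_mul (h_ := fun m => box_bump m.+1%:R a b) (M := 1)
    (r := `|a| + `|b|)) => //.
  - move=> m; apply: continuous_measurable_rV; apply: smooth_continuous.
    by have [] := test_function_box_bump a b (ltr0Sn R m).
  - by move=> m x; exact: box_bump_norm_le1.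
  - by move=> m x; exact: box_bump_outside.
  - exact: cvg_box_bump.
have z k : \int[mu]_x (g x * box_bump k.+1%:R a b x) = 0.
  by rewrite g0//; exact: test_function_box_bump.
exact: cvg_cst_eq cv z.
Qed.

Lemma fundamental_lemma g : locally_integrable_rV g ->
  (forall phi, test_function phi -> \int[mu]_x (g x * phi x) = 0) ->
  {ae mu, forall x, g x = 0}.
Proof.
move=> ig g0; have mg := ig.1.
pose Q N : set 'rV[R]_n := open_box (\row_i - N.+1%:R) (\row_i N.+1%:R).
have mbox a b : measurable (open_box a b).
  exact: (measurable_rV_box (A := fun i => `]a 0 i, b 0 i[%classic)).
have mQ N : measurable (Q N) by exact: mbox.
suff Q0 N : {ae mu, forall x, Q N x -> g x = 0}.
  have : mu.-negligible (\bigcup_N (Q N `&` [set x | g x <> 0])).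
    apply: negligible_bigcup => N; have := Q0 N; apply: negligibleS.
    by move=> x [Qx gx] /(_ Qx).
  apply: negligibleS => x gx; exists (Num.truncn `|x|) => //; split => //.
  move=> i; rewrite !mxE -ltr_norml.
  by apply: le_lt_trans (rV_norm_coord x i) _; exact: truncnS_gt.
(* Localizing to the bounded box [Q N] makes [g] integrable, which lets the whole space belong to
   the Dynkin class [H]. *)
pose q x : R := \1_(Q N) x.
have mind A : measurable A -> measurable_fun setT (fun x => \1_A x * q x).
  by move=> mA; apply: measurable_funM; exact: measurable_indic.
have bnd A x : `|\1_A x * q x| <= 1.
  rewrite normrM mulr_ile1 ?normr_ge0// /q indicE ger0_norm//.
    by case: (x \in A).
  by case: (x \in Q N).
pose r : R := `|\row_(i < n) (- N.+1%:R : R)| + `|\row_(i < n) (N.+1%:R : R)|.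
have out A x : r < `|x| -> \1_A x * q x = 0.
  move=> rx; rewrite /q [X in _ * X]indicE memNset ?mulr0//.
  by move=> /open_box_norm; rewrite leNgt rx.
have int A : measurable A ->
    mu.-integrable setT (fun x => (g x * (\1_A x * q x))%:E).
  by move=> mA; apply: (integrable_mul ig (mind _ mA) (bnd A) (out A)).
pose H := [set A | measurable A /\ \int[mu]_x (g x * (\1_A x * q x)) = 0].
have HG : open_boxes `<=` H.
  move=> _ [a [b ->]]; split => //.
  rewrite -[RHS](Rintegral_box0 (\row_i Num.max (a 0 i) (- N.+1%:R))
    (\row_i Num.min (b 0 i) N.+1%:R) ig g0).
  apply: eq_Rintegral => x _; congr (_ * _); rewrite /q.
  rewrite -[LHS]/((\1_(open_box a b) \* \1_(Q N)) x) -indicI open_boxI.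
  congr (\1_(open_box _ _) x); apply/rowP => i; by rewrite !mxE.
have HL : lambda_system setT H.
  split => //.
  - split => //; rewrite -[RHS](Rintegral_box0 (\row_i - N.+1%:R)
      (\row_i N.+1%:R) ig g0).
    by apply: eq_Rintegral => x _; rewrite indicT mul1r.
  - move=> A B BA [mA A0] [mB B0]; split; first exact: measurableD.
    transitivity (\int[mu]_x (g x * (\1_A x * q x) - g x * (\1_B x * q x))).
      apply: eq_Rintegral => x _; rewrite -mulrBr -mulrBl; congr (_ * (_ * _)).
      rewrite !indicE in_setD; case: (boolP (x \in B)) => xB /=.
        by rewrite andbF (mem_set (BA _ (set_mem xB))) subrr.
      by rewrite andbT subr0.
    by rewrite RintegralB ?A0 ?B0 ?subrr//; exact: int.
  - move=> F ndF HF; have mF : measurable (\bigcup_k F k).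
      by apply: bigcup_measurable => k _; case: (HF k).
    split => //.
    have cv : \int[mu]_x (g x * (\1_(F k) x * q x)) @[k --> \oo]
        --> \int[mu]_x (g x * (\1_(\bigcup_k F k) x * q x)).
      apply: (cvg_Rintegral_mul (h_ := fun k x => \1_(F k) x * q x) (M := 1)
        (r := r)) => //.
      + by move=> k; apply: mind; case: (HF k).
      + by move=> k x; exact: out.
      + move=> x; apply: cvgM; last exact: cvg_cst.
        rewrite indicE; have [[k _ Fkx]|nF] := pselect ((\bigcup_k F k) x).
          rewrite mem_set; last by exists k.
          apply: cvg_near_cst; exists k => // m /= km; rewrite indicE mem_set//.
          by move: x Fkx; apply/subsetPset; exact: ndF.
        rewrite memNset//; apply: cvg_near_cst; apply: nearW => m.
        by rewrite indicE memNset// => Fm; apply: nF; exists m.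
    have z k : \int[mu]_x (g x * (\1_(F k) x * q x)) = 0 by case: (HF k).
    exact: cvg_cst_eq cv z.
have HM A : measurable A -> \int[mu]_x (g x * (\1_A x * q x)) = 0.
  move=> mA; suff : H A by case.
  apply: (lambda_system_subset setI_closed_open_boxes HL HG) => //.
  exact: measurable_open_boxes.
(* Subtracting the integral of [g] over the complement of [P] from that over [P] produces the
   integral of [|g|] on [Q N]. *)
pose P := [set x | 0 <= g x].
have mP : measurable P.
  have := mg measurableT `[0, +oo[%classic (measurable_itv _).
  by rewrite setTI; congr measurable; apply/seteqP; split => x /=;
    rewrite in_itv/= andbT.
have g1 : \int[mu]_x (`|g x| * q x) = 0.
  transitivity (\int[mu]_x (g x * (\1_P x * q x) - g x * (\1_(~` P) x * q x))).
    apply: eq_Rintegral => x _; rewrite -mulrBr -mulrBl mulrA; congr (_ * _).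
    rewrite !indicE in_setC; have [gx|gx] := leP 0 (g x).
      by rewrite mem_set// subr0 mulr1 ger0_norm.
    rewrite memNset ?sub0r ?mulrN1 ?ltr0_norm//.
    by rewrite /P /=; apply/negP; rewrite -ltNge.
  rewrite RintegralB ?HM ?subrr//; try exact: int.
  - exact: measurableC.
  - by apply: int; exact: measurableC.
have g2 : (\int[mu]_(x in Q N) `|(g x)%:E| = 0)%E.
  have iQ : mu.-integrable (Q N) (fun x => `|(g x)%:E|%E).
    apply: integrable_abse; have := int setT measurableT.
    move=> /(integrableS measurableT (mQ N) (@subsetT _ _)).
    apply: eq_integrable => // x /set_mem Qx.
    by rewrite indicT /q indicE mem_set// !mulr1.
  rewrite -[LHS]fineK ?integrable_fin_num//; congr (_%:E).
  rewrite -[RHS]g1 -[LHS]/(\int[mu]_(x in Q N) `|g x|) Rintegral_mkcond.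
  apply: eq_Rintegral => x _; rewrite patchE /q indicE.
  by case: ifP => _; rewrite ?mulr1 ?mulr0.
have mgE : measurable_fun (Q N) (EFin \o g).
  by apply: measurable_funTS; exact/measurable_EFinP.
move/(ae_eq_integral_abs mu (mQ N) mgE): g2.
by apply: filterS => x h /h [].
Qed.

Lemma locally_integrable_lin (c d : R) g h : locally_integrable_rV g ->
  locally_integrable_rV h -> locally_integrable_rV (fun x => c * g x + d * h x).
Proof.
move=> ig ih; split=> [|K cK].
  by apply: measurable_funD; apply: measurable_funM => //; [exact: ig.1|exact: ih.1].
have mK := compact_measurable_rV cK.
have := integrableD mK (integrableZl mK c (ig.2 K cK)) (integrableZl mK d (ih.2 K cK)).
by apply: eq_integrable.
Qed.

Lemma integrable_mul_test g phi : locally_integrable_rV g ->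
  test_function phi -> mu.-integrable setT (fun x => (g x * phi x)%:E).
Proof.
move=> ig tphi; have [M M0 phiM] := test_function_bounded tphi.
have [sphi [r phir]] := (test_functionP phi).1 tphi.
apply: integrable_mul ig _ phiM phir.
by apply: continuous_measurable_rV; exact: smooth_continuous.
Qed.

Lemma integrable_test phi : test_function phi ->
  mu.-integrable setT (fun x => (phi x)%:E).
Proof.
move=> tphi; have := integrable_mul_test (locally_integrable_cst 1) tphi.
by apply: eq_integrable => // x _; rewrite /= mul1r.
Qed.

Lemma Rintegral_lin (c d : R) g h phi : locally_integrable_rV g ->
  locally_integrable_rV h -> test_function phi ->
  \int[mu]_x ((c * g x + d * h x) * phi x) =
  c * \int[mu]_x (g x * phi x) + d * \int[mu]_x (h x * phi x).
Proof.
move=> ig ih tphi.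
have igp := integrable_mul_test ig tphi; have ihp := integrable_mul_test ih tphi.
rewrite -!RintegralZl// -RintegralD//; last 2 first.
- exact: (integrableZl measurableT c igp).
- exact: (integrableZl measurableT d ihp).
by apply: eq_Rintegral => x _; rewrite mulrDl !mulrA.
Qed.

Lemma is_weak_partial_lin i (c d : R) u v g h : locally_integrable_rV u ->
  locally_integrable_rV v -> is_weak_partial i u g -> is_weak_partial i v h ->
  is_weak_partial i (fun x => c * u x + d * v x) (fun x => c * g x + d * h x).
Proof.
move=> iu iv [ig gE] [ih hE]; split; first exact: locally_integrable_lin.
move=> phi tphi.
rewrite !Rintegral_lin// ?gE// ?hE//; last exact: test_function_partial.
by rewrite opprD !mulrN.
Qed.

Lemma weak_partial_unique i u g g' : is_weak_partial i u g ->
  is_weak_partial i u g' -> {ae mu, forall x, g x = g' x}.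
Proof.
move=> [ig gE] [ig' gE'].
have : {ae mu, forall x, 1 * g x + (-1) * g' x = 0}.
  apply: fundamental_lemma => [|phi tphi]; first exact: locally_integrable_lin.
  rewrite Rintegral_lin// mul1r mulN1r; apply/eqP.
  by rewrite subr_eq0 -eqr_opp -gE// gE'.
by apply: filterS => x /eqP; rewrite mul1r mulN1r subr_eq0 => /eqP.
Qed.

End fundamental_lemma.

(** * Reflections *)

Section involution.
Context {R : realType} {n : nat}.
Implicit Types (x : 'rV[R]_n) (u g : 'rV[R]_n -> R).
Local Notation mu := (@lebesgue_rV R n).
Variable M : 'M[R]_n.
Hypothesis MM : M *m M = 1%:M.
Local Notation s := (mulmx^~ M : 'rV[R]_n -> 'rV[R]_n).
Hypothesis mps : measure_preserving s.

Lemma mulmx_involutive : involutive s.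
Proof. by move=> x; rewrite -mulmxA MM mulmx1. Qed.

Lemma locally_integrable_involution g :
  locally_integrable_rV g -> locally_integrable_rV (g \o s).
Proof.
move=> ig; have mg := ig.1; split=> [|K cK].
  by apply: measurableT_comp => //; exact: mps.1.
have mK := compact_measurable_rV cK.
have mK' : measurable (s @^-1` K) by apply: measurable_rV_comp => //; exact: mps.1.
have cK' : compact (s @^-1` K).
  rewrite (_ : _ @^-1` _ = s @` K).
    by apply: continuous_compact => //; apply: continuous_subspaceT;
      exact: continuous_mulmx.
  apply/seteqP; split=> [x /= Kx|_ [x Kx <-]] /=.
    by exists (s x) => //; exact: mulmx_involutive.
  by rewrite mulmx_involutive.
have := ig.2 _ cK'; rewrite integrable_mkcond//.
move=> /(integrable_measure_preserving mps) h.
apply/(integrable_mkcond _ mK); move: h; congr integrable.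
apply/funext => x; rewrite /= !patchE.
congr (if _ then _ else _); apply/idP/idP => /set_mem h; apply/mem_set => //=.
  by move: h; rewrite /= mulmx_involutive.
by rewrite mulmx_involutive.
Qed.

Lemma locally_integrable_sum (I : Type) (r : seq I) (c : I -> R) G :
  (forall i, locally_integrable_rV (G i)) ->
  locally_integrable_rV (fun x : 'rV[R]_n => \sum_(i <- r) c i * G i x).
Proof.
move=> iG; elim: r => [|i r IHr].
  under eq_fun do rewrite big_nil.
  by apply: continuous_locally_integrable; exact: cst_continuous.
under eq_fun do rewrite big_cons -[X in _ + X]mul1r.
exact: locally_integrable_lin.
Qed.

Lemma Rintegral_lsum (I : Type) (r : seq I) (c : I -> R)
    (h : I -> 'rV[R]_n -> R) :
  (forall i, mu.-integrable setT (EFin \o h i)) ->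
  mu.-integrable setT (fun x => (\sum_(i <- r) c i * h i x)%:E) /\
  \int[mu]_x (\sum_(i <- r) c i * h i x) =
  \sum_(i <- r) c i * \int[mu]_x h i x.
Proof.
move=> ih; elim: r => [|i r [IHi IHr]].
  rewrite big_nil; split.
    rewrite (_ : (fun x => _) = cst 0%E); first exact: integrable0.
    by apply/funext => x; rewrite big_nil.
  by under eq_Rintegral do rewrite big_nil; rewrite /Rintegral integral0.
have ici : mu.-integrable setT (fun x => (c i * h i x)%:E).
  exact: (integrableZl measurableT (c i) (ih i)).
split.
  rewrite (_ : (fun x => _) = (fun x => (c i * h i x)%:E) \+
    (fun x => (\sum_(j <- r) c j * h j x)%:E))%E; first exact: integrableD.
  by apply/funext => x; rewrite big_cons EFinD.
under eq_Rintegral do rewrite big_cons.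
by rewrite RintegralD// big_cons IHr RintegralZl.
Qed.

(** The change of variables [x |-> s x] moves the reflection onto the test function, and [phi (s x)]
    is again a test function. *)
Lemma is_weak_partial_involution u (G : 'I_n -> 'rV[R]_n -> R) i :
  locally_integrable_rV u -> (forall j, is_weak_partial j u (G j)) ->
  is_weak_partial i (u \o s) (fun x => \sum_j M i j * G j (s x)).
Proof.
move=> iu uG; have iG j := (uG j).1.
split=> [|phi tphi].
  have iGs j : locally_integrable_rV (G j \o s).
    exact: locally_integrable_involution.
  exact: locally_integrable_sum iGs.
pose psi x := phi (s x).
have tpsi : test_function psi.
  have Mu : M \in unitmx by have [] := mulmx1_unit MM.
  have := test_function_affine_comp 0 Mu tphi.
  by congr test_function; apply/funext => x; rewrite addr0.
have psiE j x : partial j psi x = \sum_k M j k * partial k phi (s x).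
  have [sphi _] := tphi.
  have := is_derive_affine_comp M 0 j x sphi; rewrite addr0.
  rewrite (_ : (fun y => _) = psi); last by apply/funext => y; rewrite addr0.
  by case.
(* The chain rule gives the partial derivatives of [psi] in terms of those of [phi]; [M *m M = 1%:M]
   inverts this relation. *)
have phiE x : partial i phi (s x) = \sum_j M i j * partial j psi x.
  under eq_bigr do rewrite psiE mulr_sumr.
  rewrite exchange_big /= (bigD1 i)//= [X in _ + X]big1 ?addr0 => [|k ki].
    under eq_bigr do rewrite mulrA.
    rewrite -mulr_suml.
    have := congr1 (fun A : 'M[R]_n => A i i) MM; rewrite !mxE eqxx => ->.
    by rewrite mul1r.
  under eq_bigr do rewrite mulrA.
    rewrite -mulr_suml.
  have := congr1 (fun A : 'M[R]_n => A i k) MM.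
  by rewrite !mxE eq_sym (negbTE ki) => ->; rewrite mul0r.
have mphi := smooth_continuous tphi.1.
have mu_ := iu.1.
transitivity (\int[mu]_x (u x * partial i phi (s x))).
  rewrite -(Rintegral_measure_preserving mps (f := fun x => u x * partial i phi (s x))).
    by apply: eq_Rintegral => x _; rewrite mulmx_involutive.
  apply: measurable_funM => //; apply: (measurableT_comp (f := partial i phi)).
    apply: continuous_measurable_rV; apply: smooth_continuous.
    by apply: smooth_partial; exact: tphi.1.
  exact: mps.1.
transitivity (\sum_j M i j * \int[mu]_x (u x * partial j psi x)).
  have [_ <-] := Rintegral_lsum (index_enum _) (M i)
    (fun j => integrable_mul_test iu (test_function_partial j tpsi)).
  by apply: eq_Rintegral => x _; rewrite phiE mulr_sumr; apply: eq_bigr => j _;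
    rewrite mulrCA.
transitivity (- \sum_j M i j * \int[mu]_x (G j x * psi x)).
  by rewrite -sumrN; apply: eq_bigr => j _; rewrite (uG j).2// mulrN.
have [_ <-] := Rintegral_lsum (index_enum _) (M i)
  (fun j => integrable_mul_test (iG j) tpsi).
congr (- _).
rewrite -(Rintegral_measure_preserving mps
  (f := fun x => \sum_j M i j * (G j x * psi x))).
  apply: eq_Rintegral => x _; rewrite /psi mulmx_involutive mulr_suml.
  by apply: eq_bigr => j _; rewrite mulrA.
apply: measurable_sum => j; apply: measurable_funM => //.
apply: measurable_funM; first exact: (iG j).1.
apply: continuous_measurable_rV; apply: smooth_continuous; exact: tpsi.1.
Qed.

End involution.

Section reflection.
Context {R : realType} {n : nat}.
Implicit Types x v : 'rV[R]_n.

Definition dotp x v : R := \sum_i x 0 i * v 0 i.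

(** The Householder matrix, acting on row vectors from the right. *)
Definition refl v : 'M[R]_n := 1%:M - (2 / dotp v v) *: (v^T *m v).

Lemma dotp_gt0 v : v != 0 -> 0 < dotp v v.
Proof.
move=> v0; rewrite lt_neqAle eq_sym; apply/andP; split; last first.
  by apply: sumr_ge0 => i _; rewrite -expr2 sqr_ge0.
apply: contra v0 => /eqP h; apply/eqP/rowP => i; rewrite mxE.
have := psumr_eq0P (F := fun i => v 0 i * v 0 i) (P := xpredT) _ h.
move=> /(_ _ i erefl) /eqP; rewrite mulf_eq0 orbb => h0; apply/eqP/h0.
by move=> j _; rewrite -expr2 sqr_ge0.
Qed.

Lemma dotpC x v : dotp x v = dotp v x.
Proof. by apply: eq_bigr => i _; rewrite mulrC. Qed.

Lemma dotpBZl x v (a : R) y : dotp (x - a *: v) y = dotp x y - a * dotp v y.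
Proof.
rewrite /dotp mulr_sumr -sumrB; apply: eq_bigr => i _.
by rewrite !mxE mulrBl mulrA.
Qed.

Lemma reflE v x : x *m refl v = x - (2 * dotp x v / dotp v v) *: v.
Proof.
rewrite mulmxBr mulmx1 -scalemxAr mulmxA; congr (_ - _).
rewrite [x *m v^T]mx11_scalar mul_scalar_mx scalerA; congr (_ *: _).
rewrite mxE (_ : \sum_j _ = dotp x v); first by ring.
by apply: eq_bigr => i _; rewrite mxE.
Qed.

Lemma dotp_refl_normal v x : v != 0 -> dotp (x *m refl v) v = - dotp x v.
Proof.
by move=> v0; rewrite reflE dotpBZl; field; rewrite gt_eqF// dotp_gt0.
Qed.

Lemma dotp_refl v x y : v != 0 -> dotp (x *m refl v) (y *m refl v) = dotp x y.
Proof.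
move=> v0; rewrite [y *m _]reflE dotpC dotpBZl (dotpC v (x *m refl v)).
rewrite dotp_refl_normal// (dotpC y (x *m refl v)) reflE dotpBZl (dotpC v y).
by field; rewrite gt_eqF// dotp_gt0.
Qed.

Lemma refl_fixed v x : dotp x v = 0 -> x *m refl v = x.
Proof. by move=> xv; rewrite reflE xv mulr0 mul0r scale0r subr0. Qed.

Lemma refl_involutive v : v != 0 -> refl v *m refl v = 1%:M.
Proof.
move=> v0; apply/row_matrixP => k; rewrite !rowE mulmxA mulmx1.
rewrite [_ *m _ *m _]reflE dotp_refl_normal// reflE mulrN mulNr scaleNr opprK.
by rewrite subrK.
Qed.

Lemma refl_sym v i j : refl v i j = refl v j i.
Proof. by rewrite !mxE eq_sym !big_ord1 !mxE mulrC [v 0 i * _]mulrC mulrC. Qed.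

Lemma enorm_refl v x : v != 0 -> enorm (x *m refl v) = enorm x.
Proof.
move=> v0; have := dotp_refl x x v0; rewrite /dotp /enorm => E.
by congr Num.sqrt; under eq_bigr do rewrite expr2; rewrite E.
Qed.

End reflection.

(** The shear by [- c] carries [v] onto the first axis, [c] being the tail of [v] divided by
    [v 0 ord0]. In sheared coordinates the reflection fixes the tail [y] and sends the head [x0] to
    [- x0 + \sum_j m 0 j * y j], which is [flip_head m]. *)
Lemma measure_preserving_refl (R : realType) n (v : 'rV[R]_n.+1) :
  v 0 ord0 != 0 -> measure_preserving (mulmx^~ (refl v)).
Proof.
move=> v0; have vn0 : v != 0 by apply: contra v0 => /eqP ->; rewrite mxE.
have d0 := dotp_gt0 vn0.
pose c : 'rV[R]_n := \row_j (v 0 (lift ord0 j) / v 0 ord0).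
pose m : 'rV[R]_n := \row_j (- (2 * v 0 ord0 / dotp v v) * v 0 (lift ord0 j)).
rewrite (_ : mulmx^~ _ = shear_tail c \o (flip_head m \o shear_tail (- c))).
  apply: measure_preserving_comp; first exact: measure_preserving_shear_tail.
  apply: measure_preserving_comp; last exact: measure_preserving_shear_tail.
  exact: measure_preserving_flip_head.
apply/funext => x; rewrite reflE.
pose y j := x 0 (lift ord0 j) - x 0 ord0 * c 0 j.
pose S := \sum_j y j * v 0 (lift ord0 j).
have xv : dotp x v = x 0 ord0 * dotp v v / v 0 ord0 + S.
  rewrite /dotp big_ord_recl [\sum_i v 0 i * _]big_ord_recl.
  have -> : S = \sum_j (x 0 (lift ord0 j) * v 0 (lift ord0 j) -
      x 0 ord0 / v 0 ord0 * (v 0 (lift ord0 j) * v 0 (lift ord0 j))).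
    by apply: eq_bigr => j _; rewrite /y /c mxE; ring.
  by rewrite sumrB -mulr_sumr; field.
have mS : \sum_j m 0 j * y j = - (2 * v 0 ord0 / dotp v v) * S.
  by rewrite mulr_sumr; apply: eq_bigr => j _; rewrite /m mxE; ring.
pose a := - x 0 ord0 + \sum_j m 0 j * y j.
have E0 : flip_head m (shear_tail (- c) x) 0 ord0 = a.
  rewrite /flip_head mxE unlift_none /= /shear_tail mxE unlift_none /= addr0.
  congr (_ + _); apply: eq_bigr => j _; rewrite !mxE liftK/= !mxE /y /c !mxE.
  by congr (_ * _); ring.
have Ej j : flip_head m (shear_tail (- c) x) 0 (lift ord0 j) = y j.
  rewrite /flip_head mxE liftK /= /shear_tail !mxE liftK /= !mxE /y /c !mxE.
  by ring.
have d0' : dotp v v != 0 by rewrite gt_eqF.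
apply/rowP => i; rewrite [RHS]mxE E0 /a mS; case: (unliftP ord0 i) => [j|] ->.
  by rewrite Ej /= !mxE xv /y /c !mxE; field; rewrite v0 d0'.
by rewrite E0 /a mS !mxE xv /=; field; rewrite v0 d0'.
Qed.

(** * Mollification *)

Section mollification.
Context {R : realType} {n : nat}.
Implicit Types (x y : 'rV[R]_n) (u g psi eta : 'rV[R]_n -> R) (d : R).
Local Notation mu := (@lebesgue_rV R n).

(** Evenness makes averaging against [eta] self-adjoint, which [Fubini_moll] relies on. *)
Definition mollifier d eta := [/\ test_function eta, forall x, 0 <= eta x,
  forall x, eta (- x) = eta x, forall x, d < `|x| -> eta x = 0 &
  \int[mu]_x eta x = 1].

Definition moll eta g x : R := \int[mu]_y (g y * eta (y - x)).

(** If the integral vanished, the bump would be zero almost everywhere and the box would be null,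
    against its positive volume. *)
Lemma Rintegral_box_bump_gt0 (k : R) (a b : 'rV[R]_n) : 0 < k ->
  (forall i, a 0 i < b 0 i) -> 0 < \int[mu]_x box_bump k a b x.
Proof.
move=> k0 ab; have b0 x : 0 <= box_bump k a b x := box_bump_ge0 k a b x.
rewrite lt_neqAle Rintegral_ge0 ?andbT// eq_sym; apply/eqP => i0.
have mB : measurable (open_box a b).
  exact: (measurable_rV_box (A := fun i => `]a 0 i, b 0 i[%classic)).
have tb := test_function_box_bump a b k0.
have mb := continuous_measurable_rV (smooth_continuous tb.1).
have ib := integrable_test tb.
have E0 : (\int[mu]_x `|(box_bump k a b x)%:E| = 0)%E.
  under eq_integral do rewrite gee0_abs ?lee_fin//.
  by rewrite -[LHS]fineK ?integrable_fin_num//; congr (_%:E).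
have /(ae_eq_integral_abs mu measurableT)/= := E0.
move=> /(_ (measurable_int mu ib)) [N [mN N0 NP]].
have BN : open_box a b `<=` N.
  move=> x abx; apply: NP => /= /(_ Logic.I) [] bx.
  by have := box_bump_gt0 k0 abx; rewrite bx ltxx.
have : mu (open_box a b) = 0%E by exact: (subset_measure0 mB mN BN).
have -> : mu (open_box a b) = (\prod_(i < n) (b 0 i - a 0 i))%:E.
  transitivity (\prod_(i < n) @lebesgue_measure R `]a ord0 i, b ord0 i[%classic)%E.
    exact: (lebesgue_rV_box (A := fun i => `]a 0 i, b 0 i[%classic)).
  rewrite -prodEFin; apply: eq_bigr => i _.
  by rewrite lebesgue_measure_itv/= lte_fin ab.
case=> /eqP; apply/negP; rewrite gt_eqF//; apply: prodr_gt0 => i _.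
by rewrite subr_gt0.
Qed.

Lemma exists_mollifier d : 0 < d -> exists eta, mollifier d eta.
Proof.
move=> d0; pose b : 'rV[R]_n := const_mx d; pose a : 'rV[R]_n := const_mx (- d).
pose c := \int[mu]_x box_bump 1 a b x.
have c0 : 0 < c.
  by apply: Rintegral_box_bump_gt0 => // i; rewrite !mxE; rewrite gtrN.
have tb := test_function_box_bump a b (@ltr01 R).
have ib := integrable_test tb.
exists (fun x => c^-1 * box_bump 1 a b x); split.
- by apply: test_functionMl => //; exact: smooth_cst.
- by move=> x; rewrite mulr_ge0 ?box_bump_ge0// invr_ge0 ltW.
- move=> x; congr (_ * _); apply: eq_bigr => i _; rewrite !mxE mulrC.
  by congr (flat 0 _ * flat 0 _); ring.
- move=> x dx; rewrite box_bump_eq0 ?mulr0// => abx; move: dx; apply/negP.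
  rewrite -leNgt; apply/rV_norm_leP => [|i]; first exact: ltW.
  by have := abx i; rewrite !mxE -ltr_norml => /ltW.
- by rewrite RintegralZl// mulVf// gt_eqF.
Qed.

Section fixed_mollifier.
Variables (d : R) (eta : 'rV[R]_n -> R).
Hypothesis etaP : mollifier d eta.

Let teta : test_function eta. Proof. by case: etaP. Qed.

Lemma moll_test x : test_function (fun y => eta (y - x)).
Proof.
have := test_function_affine_comp (- x) (unitmx1 R n) teta.
by congr test_function; apply/funext => y; rewrite mulmx1.
Qed.

Lemma moll_kernel_int x : \int[mu]_y eta (y - x) = 1.
Proof.
rewrite (Rintegral_measure_preserving (measure_preserving_translation (- x))).
  by case: etaP.
by apply: continuous_measurable_rV; apply: smooth_continuous; exact: teta.1.
Qed.

(** [moll eta g x] is a weighted mean of [g] over the ball of radius [d]. With [l] a value of [g]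
    this yields convergence at points of continuity; with [l = 0] it yields bounds. *)
Lemma moll_near g x l e : locally_integrable_rV g ->
  (forall y, `|y - x| <= d -> `|g y - l| <= e) -> `|moll eta g x - l| <= e.
Proof.
move=> ig gl; have [_ eta0 _ etad _] := etaP.
have tx := moll_test x.
have E (c : R) : c = \int[mu]_y (c * eta (y - x)).
  rewrite RintegralZl ?moll_kernel_int ?mulr1//.
  exact: integrable_test.
have -> : moll eta g x - l = \int[mu]_y ((1 * g y + (-1) * l) * eta (y - x)).
  by rewrite (Rintegral_lin 1 (-1) ig (locally_integrable_cst l) tx) -(E l) mul1r mulN1r.
have ilg : locally_integrable_rV (fun y => 1 * g y + (-1) * l).
  by apply: locally_integrable_lin => //; exact: locally_integrable_cst.
have igx := integrable_mul_test ilg tx.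
apply: le_trans (le_normr_Rintegral measurableT igx) _.
rewrite [leRHS]E; apply: le_Rintegral => //.
- exact: integrable_norm igx.
- exact: integrable_mul_test (locally_integrable_cst e) tx.
move=> y _; have [yx|yx] := leP `|y - x| d.
  by rewrite normrM (ger0_norm (eta0 _)) ler_wpM2r// mul1r mulN1r gl.
by rewrite etad// !mulr0 normr0.
Qed.

Lemma moll_outside r psi x : (forall y, r < `|y| -> psi y = 0) ->
  r + d < `|x| -> moll eta psi x = 0.
Proof.
move=> psir rx; have [_ _ _ etad _] := etaP.
rewrite /moll (_ : (fun y => _) = cst 0) ?Rintegral_cst//; last first.
  apply/funext => y /=; have [yr|yr] := leP `|y| r; last by rewrite psir// mul0r.
  rewrite etad ?mulr0//; have := ler_normB y (y - x).
  rewrite opprB addrCA subrr addr0 => h.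
  by rewrite -(ltrD2l `|y|); apply: lt_le_trans h; apply: le_lt_trans rx; rewrite lerD2r.
by rewrite mul0r.
Qed.

Lemma continuous_moll g : locally_integrable_rV g -> continuous (moll eta g).
Proof.
(* Dominated convergence is sequential, so a failure of continuity is turned into a sequence [z]
   tending to [x]. *)
move=> ig x; apply/continuous_atP => e e0; apply: contrapT => nd.
have /choice[z zP] : forall k : nat, exists y,
    `|x - y| < k.+1%:R^-1 /\ e < `|moll eta g x - moll eta g y|.
  move=> k; apply: contrapT => nk; apply: nd.
  exists k.+1%:R^-1; first by rewrite invr_gt0.
  move=> y xy; rewrite leNgt; apply/negP => h; apply: nk; by exists y.
have zx y : eta (y - z k) @[k --> \oo] --> eta (y - x).
  apply/cvgrPdist_le => s s0.
  have ceta := smooth_continuous teta.1.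
  have [t t0 tP] := (continuous_atP _ _).1 (ceta (y - x)) s s0.
  have [N _ NP] := near_infty_natSinv_lt (PosNum t0).
  exists N => // k /= Nk; apply: tP.
  rewrite opprB addrC addrA subrK -normrN opprB.
  by apply: lt_trans (zP k).1 _; exact: NP.
have [M M0 etaM] := test_function_bounded teta.
have [_ _ _ etad _] := etaP.
have cv : moll eta g (z k) @[k --> \oo] --> moll eta g x.
  apply: (cvg_Rintegral_mul (h_ := fun k y => eta (y - z k)) (M := M)
    (r := `|x| + 1 + d)) => //.
  - move=> k; apply: continuous_measurable_rV; apply: smooth_continuous.
    exact: (moll_test (z k)).1.
  - move=> k y xy; apply: etad.
    have zk1 : `|z k| <= `|x| + 1.
      rewrite -[z k](subrK x) addrC; apply: le_trans (ler_normD _ _) _.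
      rewrite lerD2l -normrN opprB; apply: ltW; apply: lt_le_trans (zP k).1 _.
      by rewrite invf_le1// ler1n.
    rewrite -(ltrD2l `|z k|); apply: (@le_lt_trans _ _ (`|x| + 1 + d)).
      by rewrite lerD2r.
    by apply: lt_le_trans xy _; rewrite -{1}[y](subrK (z k)) addrC ler_normD.
move/cvgrPdist_le: cv => /(_ e e0)[N _ /(_ N (leqnn N))].
by rewrite leNgt (zP N).2.
Qed.

(** The kernel [eta (y - x)] is symmetric in its two points, so Fubini moves the mollification from
    [g] to [psi]. Integrability on the product holds because a nonzero integrand has [x] in the
    support of [psi], hence [y] in a slightly larger cube, where [g] is integrable. *)
Lemma Fubini_moll g psi M r : locally_integrable_rV g ->
  measurable_fun setT psi -> (forall x, `|psi x| <= M) ->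
  (forall x, r < `|x| -> psi x = 0) ->
  \int[mu]_x (moll eta g x * psi x) = \int[mu]_x (g x * moll eta psi x).
Proof.
move=> ig mpsi psiM psir.
have [M' M'0 etaM'] := test_function_bounded teta.
have [_ _ etaN etad _] := etaP.
have ceta := smooth_continuous teta.1.
have meta := continuous_measurable_rV ceta.
pose f (z : 'rV[R]_n * 'rV[R]_n) := ((g z.2 * eta (z.2 - z.1)) * psi z.1)%:E.
have mg := ig.1.
have mB : measurable_fun setT (fun z : 'rV[R]_n * 'rV[R]_n => z.2 - z.1).
  apply: measurable_fun_rVP => i.
  rewrite (_ : _ \o _ = fun z : 'rV[R]_n * 'rV[R]_n => z.2 0 i - z.1 0 i).
    apply: measurable_funB.
      by apply: (measurableT_comp (f := fun x : 'rV[R]_n => x 0 i)) => //;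
        exact: measurable_rV_coordE.
    by apply: (measurableT_comp (f := fun x : 'rV[R]_n => x 0 i)) => //;
      exact: measurable_rV_coordE.
  by apply/funext => z; rewrite /rV_coord /= !mxE.
have mf : measurable_fun setT f.
  apply/measurable_EFinP; apply: measurable_funM; last exact: measurableT_comp.
  by apply: measurable_funM; exact: measurableT_comp.
have ipsi := integrable_bounded_support mpsi psiM psir.
have imaj := integrable_majorant M' (`|r| + `|d|) ig.
pose G y := M' * `|g y| * \1_(cube (`|r| + `|d|)) y.
have fG x y : `|(g y * eta (y - x)) * psi x| <= `|psi x| * G y.
  have [xr|xr] := leP `|x| r; last by rewrite psir// mulr0 !normr0 mul0r.
  rewrite normrM mulrC ler_wpM2l//.
  apply: (@mul_majorant _ _ g (fun y => eta (y - x))) => [z|z rz]; first exact: etaM'.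
  apply: etad; rewrite -(ltrD2l `|x|).
  apply: (@le_lt_trans _ _ (`|r| + `|d|)).
    by apply: lerD; [apply: le_trans xr (ler_norm _)|exact: ler_norm].
  by apply: lt_le_trans rz _; rewrite -{1}[z](subrK x) addrC ler_normD.
have if_ : (mu \x mu)%E.-integrable setT f.
  apply: (integrable12ltyP mu mu mf).2.
  have G0 y : 0 <= G y by rewrite mulr_ge0 ?mulr_ge0// indicE.
  have mG : measurable_fun setT (fun y => (G y)%:E) := measurable_int mu imaj.
  have Gfin : (\int[mu]_y (G y)%:E < +oo)%E.
    have /integrableP[_] := imaj; congr (_ < _)%E.
    by apply: eq_integral => y _; rewrite gee0_abs// lee_fin; exact: G0.
  apply: (@le_lt_trans _ _ (\int[mu]_x (`|psi x|%:E * \int[mu]_y (G y)%:E))%E).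
    apply: ge0_le_integral => //.
    - by move=> x _; exact: integral_ge0.
    - apply: (measurable_fun_fubini_tonelli_F (abse \o f)) => [|z].
        exact: measurableT_comp.
      exact: abse_ge0.
    - apply: emeasurable_funM => //; apply/measurable_EFinP.
      exact: measurableT_comp.
    - move=> x _; rewrite -ge0_integralZl//; last by move=> y _; rewrite lee_fin.
      apply: ge0_le_integral => //.
      + apply: measurableT_comp => //.
        by apply: (measurableT_comp mf); exact: measurable_pair1.
      + by apply: emeasurable_funM.
      + by move=> y _; rewrite -EFinM lee_fin /f/=; exact: fG.
  rewrite ge0_integralZr//; last 2 first.
  - by apply/measurable_EFinP; exact: measurableT_comp.
  - by apply: integral_ge0 => y _; rewrite lee_fin.
  rewrite lte_mul_pinfty//.
  - exact: integral_ge0.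
  - rewrite ge0_fin_numE; last exact: integral_ge0.
    by have /integrableP[] := ipsi.
have ilpsi : locally_integrable_rV psi.
  split=> // K cK; have mK := compact_measurable_rV cK.
  by apply: (integrableS measurableT mK) ipsi.
have Fu := Fubini if_.
have inner1 x : (\int[mu]_y f (x, y))%E = (moll eta g x * psi x)%:E.
  rewrite /f /= /moll -RintegralZr//; last first.
    exact: (integrable_mul_test ig (moll_test x)).
  rewrite fineK//; apply: integrable_fin_num => //.
  exact: (integrableZr measurableT (psi x) (integrable_mul_test ig (moll_test x))).
have inner2 y : (\int[mu]_x f (x, y))%E = (g y * moll eta psi y)%:E.
  have i2 := integrable_mul_test ilpsi (moll_test y).
  rewrite /moll -RintegralZl//.
  rewrite /Rintegral fineK; last first.
    apply: integrable_fin_num => //.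
    exact: (integrableZl measurableT (g y) i2).
  apply: eq_integral => x _; rewrite /f/= -opprB etaN; congr (_%:E); ring.
rewrite /Rintegral; congr fine.
under eq_integral do rewrite -inner1.
by rewrite Fu; apply: eq_integral => y _.
Qed.

End fixed_mollifier.
End mollification.

(** * The weak chain rule *)

Section weak_chain_rule.
Context {R : realType} {n : nat}.
Implicit Types (x y : 'rV[R]_n) (u g psi eta phi : 'rV[R]_n -> R) (d : R).
Local Notation mu := (@lebesgue_rV R n).
Local Notation e_ i := (delta_mx 0 i : 'rV[R]_n).

Lemma delta_mx_norm i : `|e_ i| <= 1.
Proof.
by apply/rV_norm_leP => // j; rewrite mxE; case: (_ && _); rewrite ?normr1 ?normr0.
Qed.

Lemma partial_translation i eta x y :
  partial i (fun z => eta (z - x)) y = partial i eta (y - x).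
Proof.
rewrite /partial /derive; set F := (F in F @ 0^'); set G := (G in _ = lim (G @ _)).
by have -> : F = G by apply/funext => h; rewrite /F /G /= addrA.
Qed.

(** Differentiation under the integral falls on the translate of [eta], with a minus sign. That
    translate is a test function, so the definition of the weak derivative transfers the derivative
    to [u] with a second minus sign. *)
Lemma is_derive_moll d eta u g i x : mollifier d eta ->
  locally_integrable_rV u -> is_weak_partial i u g ->
  is_derive x (e_ i) (moll eta u) (moll eta g x).
Proof.
move=> etaP iu [ig gE]; have [teta _ _ etad _] := etaP.
pose f (t : R) y := u y * eta (y - (t *: e_ i + x)).
have tf t : test_function (fun y => eta (y - (t *: e_ i + x))).
  exact: moll_test etaP _.
have df (t : R) y : is_derive t 1 (f ^~ y) (- (u y * partial i eta (y - (t *: e_ i + x)))).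
  pose k (s : R) := eta (s *: (- e_ i) + (y - x)).
  have dk : is_derive t 1 k (- partial i eta (y - (t *: e_ i + x))).
    apply: is_derive_path.
    have -> : t *: - e_ i + (y - x) = y - (t *: e_ i + x).
      by rewrite scalerN addrCA opprD.
    have := is_derive_dirZ (-1) (smooth_is_derive i (y - (t *: e_ i + x)) teta.1).
    by rewrite scaleN1r mulN1r.
  have := is_derive_mul (is_derive_cst (u y) t 1) dk.
  rewrite mulr0 addr0 mulrN.
  congr is_derive; apply/funext => s; rewrite /f /k; congr (_ * eta _).
  by rewrite scalerN addrCA opprD.
have [M M0 etaM] := test_function_bounded (test_function_partial i teta).
(* Only shifts [t] in []-1, 1[] occur, and the direction has norm at most [1], so all translated
   supports lie in the cube of radius [|x| + 1 + d]. *)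
pose G y := M * `|u y| * \1_(cube (`|x| + 1 + d)) y.
have dfE (t : R) y : partial1of2 f t y = - (u y * partial i eta (y - (t *: e_ i + x))).
  by rewrite partial1of2E; case: (df t y).
have := @cvg_differentiation_under_integral R _ _ mu f setT measurableT 0 (-1) 1
  _ _ _ G _ (integrable_majorant M (`|x| + 1 + d) iu).
have -> : (\int[mu]_y partial1of2 f 0 y) = moll eta g x.
  under eq_Rintegral do rewrite dfE scale0r add0r -partial_translation.
  rewrite /moll -[RHS]opprK -gE; last exact: moll_test etaP x.
  have iup : mu.-integrable setT
      (fun y => (u y * partial i (fun z => eta (z - x)) y)%:E).
    by apply: integrable_mul_test => //; apply/test_function_partial/moll_test/etaP.
  rewrite -mulN1r -RintegralZl//.
  by apply: eq_Rintegral => y _; rewrite mulN1r.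
move=> H; apply/is_derive_path0.
have {}H : (fun h : R => h^-1 *: (((fun t : R => moll eta u (t *: e_ i + x))
    \o shift 0) (h *: 1) - moll eta u (0 *: e_ i + x))) @ 0^' --> moll eta g x.
  apply: cvg_trans (H _ _ _ _ _).
  - by apply: near_eq_cvg; apply: nearW => h /=; rewrite [h *: 1]mulr1.
  - by rewrite /= in_itv/= ltrN10 ltr01.
  - by move=> t _; exact: integrable_mul_test iu (tf t).
  - by move=> t y _ _; case: (df t y).
  - by move=> y; rewrite mulr_ge0 ?mulr_ge0// indicE.
  move=> t y; rewrite /= in_itv/= => t1 _; rewrite dfE normrN.
  apply: (@mul_majorant _ _ u (fun y => partial i eta (y - (t *: e_ i + x)))).
    by move=> z; exact: etaM.
  move=> z zx; apply: (partial_outside _ etad).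
  have tx : `|t *: e_ i + x| <= `|x| + 1.
    rewrite addrC; apply: le_trans (ler_normD _ _) _; rewrite lerD2l normrZ.
    rewrite mulr_ile1//; last exact: delta_mx_norm.
    by rewrite ler_norml; case/andP: t1 => /ltW -> /ltW ->.
  rewrite -(ltrD2l `|t *: e_ i + x|).
  apply: (@le_lt_trans _ _ (`|x| + 1 + d)); first by rewrite lerD2r.
  apply: lt_le_trans zx _.
  by rewrite -{1}[z](subrK (t *: e_ i + x)) addrC ler_normD.
by split; [apply: cvgP H|apply: cvg_lim H].
Qed.

(** By translation invariance every difference quotient of [psi] has integral zero. The mean value
    theorem bounds the quotients by [M], so the limit may be taken under the integral. *)
Lemma Rintegral_derive0 psi (dpsi : 'rV[R]_n -> R) M r i : continuous psi ->
  (forall x, is_derive x (e_ i) psi (dpsi x)) -> (forall x, `|dpsi x| <= M) ->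
  (forall x, r < `|x| -> psi x = 0) -> \int[mu]_x dpsi x = 0.
Proof.
move=> cpsi dE dM psir.
pose h (k : nat) : R := k.+1%:R^-1.
have h0 k : 0 < h k by rewrite invr_gt0.
have h1 k : h k <= 1 by rewrite invf_le1// ler1n.
pose f k x := (h k)^-1 * (psi (x + h k *: e_ i) - psi x).
have mpsi := continuous_measurable_rV cpsi.
have ctr k : continuous (fun x => psi (x + h k *: e_ i)).
  move=> x; apply/continuous_atP => e e0.
  have [s s0 sP] := (continuous_atP _ _).1 (cpsi (x + h k *: e_ i)) e e0.
  by exists s => // y /= xy; apply: sP; rewrite opprD addrACA subrr addr0.
have mtr k := continuous_measurable_rV (ctr k).
have [W W0 psiW] := continuous_bounded_cube `|r| cpsi.
have psiB x : `|psi x| <= W.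
  have [xr|xr] := leP `|x| r; first exact: psiW (le_trans xr (ler_norm r)).
  by rewrite psir// normr0.
have ipsi := integrable_bounded_support mpsi psiB psir.
have M0 : 0 <= M by apply: le_trans (dM 0).
have fr k x : r + 1 < `|x| -> f k x = 0.
  move=> xr; rewrite /f !psir ?subrr ?mulr0//.
    by apply: lt_trans xr; rewrite ltrDl.
  rewrite -(ltrD2r 1); apply: lt_le_trans xr _.
  rewrite -{1}[x](addrK (h k *: e_ i)); apply: le_trans (ler_normB _ _) _.
  rewrite lerD2l normrZ gtr0_norm// mulr_ile1//; first exact: ltW.
  exact: delta_mx_norm.
have fM k x : `|f k x| <= M.
  have [c _] := MVT_path x (h k) dE; rewrite /f (addrC x) => ->.
  by rewrite mulKf ?gt_eqF.
have cv : \int[mu]_x f k x @[k --> \oo] --> \int[mu]_x dpsi x.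
  apply: (cvg_Rintegral_bounded _ fM fr) => [k|x]; first by apply: measurable_funM => //; exact: measurable_funB.
  have [df <-] := dE x.
  have hn0 k : h k != 0 by rewrite gt_eqF.
  have := (cvgr_dnbhsP _ _ _).1 df h (conj hn0 (cvg_harmonic)).
  by under eq_fun do rewrite /= (addrC (_ *: _)).
apply: cvg_cst_eq cv _ => k.
have itr := integrable_measure_preserving
  (measure_preserving_translation (h k *: e_ i)) ipsi.
rewrite RintegralZl// ?RintegralB//; last exact: (integrableB measurableT itr ipsi).
by rewrite (Rintegral_measure_preserving (measure_preserving_translation _))//
  subrr mulr0.
Qed.

Lemma exists_mollifiers : exists eta : nat -> 'rV[R]_n -> R,
  forall m, mollifier m.+1%:R^-1 (eta m).
Proof.
have /choice[eta etaP] : forall m : nat, exists e : 'rV[R]_n -> R,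
  mollifier m.+1%:R^-1 e by move=> m; apply: exists_mollifier; rewrite invr_gt0.
by exists eta.
Qed.

Lemma moll_chain d eta (Q dQ : R -> R) u g i phi : mollifier d eta ->
  continuous u -> is_weak_partial i u g ->
  (forall t : R, is_derive t 1 Q (dQ t)) -> continuous dQ -> test_function phi ->
  \int[mu]_x (Q (moll eta u x) * partial i phi x) =
  - \int[mu]_x (moll eta g x * (dQ (moll eta u x) * phi x)).
Proof.
move=> etaP cu ug QE cdQ tphi; have iu := continuous_locally_integrable cu.
have [sphi [r phir]] := (test_functionP phi).1 tphi.
have cQ : continuous Q.
  by move=> t; apply: differentiable_continuous; apply/derivable1_diffP; case: (QE t).
have cw : continuous (moll eta u) by exact: continuous_moll etaP _ iu.
have cg : continuous (moll eta g) by exact: continuous_moll etaP _ ug.1.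
have cQw : continuous (Q \o moll eta u).
  by move=> x; apply: continuous_comp; [exact: cw|exact: cQ].
have cdQw : continuous (dQ \o moll eta u).
  by move=> x; apply: continuous_comp; [exact: cw|exact: cdQ].
have cphi := smooth_continuous sphi.
have cdphi := smooth_continuous (smooth_partial i sphi).
(* [A + B] is the derivative in direction [i] of [Q (moll eta u x) * phi x], so its integral
   vanishes: this is the integration by parts. *)
pose A x := Q (moll eta u x) * partial i phi x.
pose B x := (dQ (moll eta u x) * moll eta g x) * phi x.
have cB0 : continuous (fun x => dQ (moll eta u x) * moll eta g x).
  by move=> x; apply: continuousM; [exact: cdQw|exact: cg].
have cD : continuous (fun x => A x + B x).
  move=> x; apply: continuousD.
    by apply: continuousM; [exact: cQw|exact: cdphi].
  by apply: continuousM; [exact: cB0|exact: cphi].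
have D0 x : r < `|x| -> A x + B x = 0.
  move=> rx; rewrite /A /B phir// mulr0 addr0 (partial_outside _ phir)//.
  by rewrite mulr0.
have [M M0 DM] := continuous_bounded_cube `|r| cD.
have DB x : `|A x + B x| <= M.
  have [xr|xr] := leP `|x| r; first exact: DM (le_trans xr (ler_norm r)).
  by rewrite D0// normr0.
have iA : mu.-integrable setT (fun x => (A x)%:E).
  apply: (integrable_mul_test (continuous_locally_integrable cQw)).
  exact: test_function_partial.
have iB : mu.-integrable setT (fun x => (B x)%:E).
  exact: (integrable_mul_test (continuous_locally_integrable cB0) tphi).
have : \int[mu]_x (A x + B x) = 0.
  apply: (Rintegral_derive0 (psi := fun x => Q (moll eta u x) * phi x) (i := i)
    _ _ DB (r := r)).
  - by move=> x; apply: continuousM; [exact: cQw|exact: cphi].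
  - move=> x; rewrite /A /B [X in _ + X]mulrC.
    apply: is_derive_mul; last exact: smooth_is_derive.
    apply: (is_derive_comp (F := Q) (f := moll eta u)).
    exact: is_derive_moll etaP iu ug.
  - by move=> x rx; rewrite phir// mulr0.
rewrite RintegralD// => /eqP; rewrite addr_eq0 => /eqP ->; congr (- _).
by apply: eq_Rintegral => x _; rewrite /B mulrCA mulrA.
Qed.

(** Pointwise convergence of [moll eta g] to the merely locally integrable [g] is avoided.
    [Fubini_moll] moves the mollifier onto [dQ (w m x) * phi x], whose mollification converges
    pointwise by continuity, while [g] stays fixed and dominates. *)
Lemma weak_chain (Q dQ : R -> R) (C : R) u g i phi :
  continuous u -> is_weak_partial i u g ->
  (forall t : R, is_derive t 1 Q (dQ t)) -> continuous dQ ->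
  (forall t, `|dQ t| <= C) -> test_function phi ->
  \int[mu]_x (Q (u x) * partial i phi x) =
  - \int[mu]_x (g x * (dQ (u x) * phi x)).
Proof.
move=> cu ug QE cdQ dQC tphi; have iu := continuous_locally_integrable cu.
have C0 : 0 <= C by apply: le_trans (dQC 0).
have [sphi [r phir]] := (test_functionP phi).1 tphi.
have cphi := smooth_continuous sphi.
have [eta etaP] := exists_mollifiers.
pose d (m : nat) : R := m.+1%:R^-1.
have d1 m : d m <= 1 by rewrite invf_le1// ler1n.
pose w m := moll (eta m) u.
have cw m : continuous (w m) by exact: continuous_moll (etaP m) _ iu.
have cQ : continuous Q.
  by move=> t; apply: differentiable_continuous; apply/derivable1_diffP; case: (QE t).
have small (e : R) : 0 < e -> exists N, forall m, (N <= m)%N -> d m < e.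
  move=> e0; have [N _ NP] := near_infty_natSinv_lt (PosNum e0).
  by exists N => m Nm; exact: NP.
have wu y e : 0 < e -> exists N, forall m, (N <= m)%N ->
    forall x, `|x - y| <= d m -> `|w m x - u y| <= e.
  move=> e0; have [s s0 sP] := (continuous_atP _ _).1 (cu y) e e0.
  have [|N NP] := small (s / 2); first by rewrite divr_gt0.
  exists N => m Nm x xy; apply: (moll_near (etaP m) iu) => z zx.
  rewrite distrC; apply: sP.
  have -> : y - z = (x - z) - (x - y) by rewrite opprB [RHS]addrC addrA subrK.
  apply: le_lt_trans (ler_normB _ _) _.
  rewrite [s]splitr; apply: (@le_lt_trans _ _ (d m + d m)).
    by rewrite distrC lerD.
  by apply: ltrD; exact: NP.
have [U U0 uU] := continuous_bounded_cube (`|r| + 1) cu.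
have wU m x : `|x| <= r -> `|w m x| <= U.
  move=> xr; rewrite -[w m x]subr0; apply: (moll_near (etaP m) iu) => y yx.
  rewrite subr0; apply: uU; rewrite -[y](subrK x) addrC.
  apply: le_trans (ler_normD _ _) _; apply: lerD.
    exact: le_trans xr (ler_norm r).
  exact: le_trans yx (d1 m).
have [W W0 QW] : exists2 W, 0 <= W & forall t, `|t| <= U -> `|Q t| <= W.
  have : compact (Q @` `[- U, U]).
    by apply: continuous_compact; [exact: continuous_subspaceT|exact: segment_compact].
  move=> /compact_bounded[W [_ h]]; exists (`|W| + 1); first by rewrite addr_ge0.
  move=> t tU; apply: (h (`|W| + 1)); first by rewrite ltr_pwDr// ler_norm.
  by exists t => //=; rewrite in_itv/= -ler_norml.
have [P P0 dphiP] := test_function_bounded (test_function_partial i tphi).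
have [F F0 phiF] := test_function_bounded tphi.
have dphir x : r < `|x| -> partial i phi x = 0 := partial_outside i phir.
have mdphi := continuous_measurable_rV (smooth_continuous (smooth_partial i sphi)).
have lhs : \int[mu]_x (Q (w m x) * partial i phi x) @[m --> \oo]
    --> \int[mu]_x (Q (u x) * partial i phi x).
  apply: (cvg_Rintegral_bounded (M := W * P) (r := r)) => [m|m x|m x rx|x].
  - apply: measurable_funM => //; apply: (continuous_measurable_rV (f := Q \o w m)).
    by move=> x; apply: continuous_comp; [exact: cw|exact: cQ].
  - have [xr|xr] := leP `|x| r; last by rewrite dphir// mulr0 normr0 mulr_ge0.
    by rewrite normrM ler_pM// QW// wU.
  - by rewrite dphir// mulr0.
  - apply: cvgM; last exact: cvg_cst.
    apply: (cvg_comp (fun m => w m x) Q); last exact: cQ.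
    apply/cvgrPdist_le => e e0; have [N NP] := wu x e e0.
    exists N => // m /= Nm; rewrite distrC; apply: (NP m Nm).
    by rewrite subrr normr0 invr_ge0.
pose J m := moll (eta m) (fun x => dQ (w m x) * phi x).
have mF m : continuous (fun x => dQ (w m x) * phi x).
  move=> x; apply: continuousM; last exact: cphi.
  by apply: continuous_comp; [exact: cw|exact: cdQ].
have Fr m x : r < `|x| -> dQ (w m x) * phi x = 0.
  by move=> rx; rewrite phir// mulr0.
have FB m x : `|dQ (w m x) * phi x| <= C * F by rewrite normrM ler_pM.
have step m : \int[mu]_x (Q (w m x) * partial i phi x) =
    - \int[mu]_x (g x * J m x).
  rewrite (moll_chain (etaP m) cu ug QE cdQ tphi); congr (- _).
  apply: (Fubini_moll (etaP m) ug.1 _ (FB m) (Fr m)).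
  exact: continuous_measurable_rV.
have rhs : \int[mu]_x (g x * J m x) @[m --> \oo]
    --> \int[mu]_x (g x * (dQ (u x) * phi x)).
  have il m := continuous_locally_integrable (mF m).
  apply: (cvg_Rintegral_mul (M := C * F) (r := r + 1) ug.1) => [m|m x|m x rx|y].
  - by apply: continuous_measurable_rV; exact: continuous_moll (etaP m) _ (il m).
  - rewrite -[J m x]subr0; apply: (moll_near (etaP m) (il m)) => y _.
    by rewrite subr0 FB.
  - apply: (moll_outside (etaP m) (Fr m)); apply: le_lt_trans rx.
    by rewrite lerD2l; exact: d1.
  apply/cvgrPdist_le => e e0.
  (* The error splits into a variation of [phi], weighted by at most [C], and a variation of [dQ],
     weighted by [|phi y|]. Each gets half of [e], and the added [1] keeps the denominators
     positive. *)
  have e1 : 0 < e / (2 * (C + 1)) by rewrite divr_gt0// mulr_gt0// ltr_pwDr.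
  have e2 : 0 < e / (2 * (`|phi y| + 1)) by rewrite divr_gt0// mulr_gt0// ltr_pwDr.
  have [s1 s10 phis] := (continuous_atP _ _).1 (cphi y) _ e1.
  have [s2 s20 dQs] := (continuous_atP _ _).1 (cdQ (u y)) _ e2.
  have [|N1 N1P] := wu y (s2 / 2); first by rewrite divr_gt0.
  have [N2 N2P] := small s1 s10.
  exists (maxn N1 N2) => // m /=; rewrite geq_max => /andP[Nm1 Nm2].
  rewrite distrC; apply: (moll_near (etaP m) (il m)) => x xy.
  have -> : dQ (w m x) * phi x - dQ (u y) * phi y =
    - (dQ (w m x) * (phi y - phi x)) - (dQ (u y) - dQ (w m x)) * phi y by ring.
  apply: le_trans (ler_normB _ _) _; rewrite normrN !normrM.
  have h1 : `|phi y - phi x| <= e / (2 * (C + 1)).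
    by apply: phis; rewrite distrC; apply: le_lt_trans xy (N2P m Nm2).
  have h2 : `|dQ (u y) - dQ (w m x)| <= e / (2 * (`|phi y| + 1)).
    apply: dQs; rewrite distrC; apply: le_lt_trans (N1P m Nm1 x xy) _.
    by rewrite ltr_pdivrMr// mulr_natr mulr2n ltrDr.
  have -> : e = (C + 1) * (e / (2 * (C + 1))) +
      e / (2 * (`|phi y| + 1)) * (`|phi y| + 1).
    have ? : C + 1 != 0 by rewrite gt_eqF// ltr_pwDr.
    have ? : `|phi y| + 1 != 0 by rewrite gt_eqF// ltr_pwDr.
    by field; apply/andP.
  apply: lerD; apply: ler_pM => //.
  - by apply: le_trans (dQC _) _; rewrite lerDl.
  - by rewrite lerDl.
apply/eqP; rewrite -addr_eq0; apply/eqP.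
apply: cvg_cst_eq (cvgD lhs rhs) _ => m.
by rewrite -[LHS]/(\int[mu]_x _ + \int[mu]_x _) step addNr.
Qed.

End weak_chain_rule.

(** * Positive part over a half-space *)

Section smooth_positive_part.
Context {R : realType}.
Implicit Types (s t : R) (k m : nat).

Lemma flat0_ge s : 0 < s -> 1 - s^-1 <= flat 0 s.
Proof. by move=> s0; rewrite /flat s0 mul1r; exact: expR_ge1Dx. Qed.

(** For [s > 0] the derivative is [(1 + 1 / s) * exp (- 1 / s)]. It lies between [0] and [1] because
    [1 + y <= exp y], and it tends to [1] at infinity, so [q] rescales to the positive part. *)
Let q s := s * flat 0 s.
Let dq s := flat 0 s + s * flat 2 s.

Let is_derive_q s : is_derive s 1 q (dq s).
Proof.
have := is_derive_mul (is_derive_id s 1) (is_derive_flat 0 s).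
by rewrite mul0r subr0 mulr1 addrC.
Qed.

Let dq_bound s : 0 <= dq s <= 1.
Proof.
rewrite /dq; have [s0|s0] := leP s 0.
  by rewrite !flat_eq0// mulr0 addr0 lexx ler01.
apply/andP; split; first by rewrite addr_ge0 ?mulr_ge0 ?flat_ge0// ltW.
rewrite /flat s0 mul1r.
rewrite mulrA expr2 mulrA mulfV ?gt_eqF// mul1r -{1}[expR _]mul1r -mulrDl.
by rewrite expRN ler_pdivrMr ?expR_gt0// mul1r expR_ge1Dx.
Qed.

Let continuous_dq : continuous dq.
Proof.
move=> s; apply: continuousD; first exact: continuous_flat.
by apply: continuousM; [exact: cvg_id|exact: continuous_flat].
Qed.

(* Smooth approximations of the positive part, vanishing below [k.+1^-1]. *)
Definition pospart k t : R := k.+1%:R^-1 * q (k.+1%:R * t - 1).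
Definition dpospart k t : R := dq (k.+1%:R * t - 1).

Lemma is_derive_pospart k t : is_derive t 1 (pospart k) (dpospart k t).
Proof.
have d1 : is_derive t 1 (fun t => k.+1%:R * t - 1) k.+1%:R.
  have := is_derive_affine1 k.+1%:R (-1) t.
  by under eq_fun do rewrite mulrC.
have := is_derive_mul (is_derive_cst (k.+1%:R^-1 : R) t 1)
  (is_derive1_comp (is_derive_q _) d1).
by rewrite mulr0 addr0 mulrCA mulVf// mulr1.
Qed.

Lemma continuous_dpospart k : continuous (dpospart k).
Proof.
move=> t; apply: (continuous_comp (f := fun t => k.+1%:R * t - 1)).
  apply: continuousB; last exact: cst_continuous.
  by apply: continuousM; [exact: cst_continuous|exact: cvg_id].
exact: continuous_dq.
Qed.

Lemma dpospart_norm_le1 k t : `|dpospart k t| <= 1.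
Proof. by have /andP[h1 h2] := dq_bound (k.+1%:R * t - 1); rewrite ger0_norm. Qed.

Lemma pospart_eq0 k t : t <= k.+1%:R^-1 -> pospart k t = 0.
Proof.
move=> tk; rewrite /pospart /q flat_eq0 ?mulr0// subr_le0.
by rewrite -ler_pdivlMl// mulr1.
Qed.

Lemma dpospart_eq0 k t : t <= 0 -> dpospart k t = 0.
Proof.
move=> t0; rewrite /dpospart /dq !flat_eq0 ?mulr0 ?addr0//;
  by rewrite subr_le0; apply: le_trans (ler01); rewrite mulr_ge0_le0.
Qed.

Lemma pospartE k t : pospart k t = (t - k.+1%:R^-1) * flat 0 (k.+1%:R * t - 1).
Proof.
rewrite /pospart /q mulrA; congr (_ * _).
by rewrite mulrBr mulr1 mulrA mulVf ?mul1r.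
Qed.

Lemma pospart_norm_le k t : `|pospart k t| <= `|t|.
Proof.
have [tk|tk] := leP t k.+1%:R^-1; first by rewrite pospart_eq0// normr0.
have t0 : 0 < t by apply: lt_trans tk; rewrite invr_gt0.
rewrite pospartE normrM -[leRHS]mulr1 ler_pM//.
  by rewrite (gtr0_norm t0) gtr0_norm ?subr_gt0// gerBl invr_ge0.
by rewrite ger0_norm ?flat_ge0// flat0_le1.
Qed.

Let large t (e : R) : 0 < t -> 0 < e ->
  exists N, forall k, (N <= k)%N -> 0 < k.+1%:R * t - 1 /\ (k.+1%:R * t - 1)^-1 <= e.
Proof.
move=> t0 e0; exists (Num.truncn ((e^-1 + 1) / t)) => k Nk.
have h : e^-1 + 1 <= k.+1%:R * t.
  rewrite -ler_pdivrMr//; apply: ltW; apply: lt_le_trans (truncnS_gt _) _.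
  by rewrite ler_nat ltnS.
have h1 : e^-1 <= k.+1%:R * t - 1 by rewrite lerBrDr.
have p : 0 < k.+1%:R * t - 1 by apply: lt_le_trans h1; rewrite invr_gt0.
by split=> //; rewrite -[leRHS]invrK lef_pV2 ?posrE ?invr_gt0.
Qed.

Lemma cvg_flat0_large t : 0 < t ->
  flat 0 (k.+1%:R * t - 1) @[k --> \oo] --> (1 : R).
Proof.
move=> t0; apply/cvgrPdist_le => e e0; have [N NP] := large t0 e0.
exists N => // k /= /NP[p ke]; rewrite ger0_norm ?subr_ge0 ?flat0_le1//.
rewrite lerBlDr -lerBlDl; apply: le_trans (flat0_ge p).
by rewrite lerB.
Qed.

Lemma cvg_pospart t : pospart k t @[k --> \oo] --> Num.max t 0.
Proof.
have [t0|t0] := leP t 0.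
  rewrite (_ : (fun k => _) = cst 0); first exact: cvg_cst.
  by apply/funext => k; rewrite pospart_eq0//; apply: le_trans t0 _; rewrite invr_ge0.
under eq_fun do rewrite pospartE.
have h : (t - k.+1%:R^-1) * flat 0 (k.+1%:R * t - 1) @[k --> \oo] --> (t - 0) * 1.
  apply: cvgM; last exact: cvg_flat0_large.
  by apply: cvgB; [exact: cvg_cst|exact: cvg_harmonic].
by move: h; rewrite subr0 mulr1.
Qed.

Lemma cvg_dpospart t : dpospart k t @[k --> \oo] --> ((0 < t)%R%:R : R).
Proof.
have [t0|t0] := leP t 0.
  rewrite (_ : (fun k => _) = cst 0); first exact: cvg_cst.
  by apply/funext => k; rewrite dpospart_eq0.
apply/cvgrPdist_le => e e0; have [N NP] := large t0 e0.
exists N => // k /= /NP[p ke].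
have /andP[h0 h1] := dq_bound (k.+1%:R * t - 1).
rewrite ger0_norm ?subr_ge0// lerBlDr -lerBlDl.
apply: (@le_trans _ _ (flat 0 (k.+1%:R * t - 1))).
  by apply: le_trans (flat0_ge p); rewrite lerB.
by rewrite lerDl mulr_ge0 ?flat_ge0// ltW.
Qed.

End smooth_positive_part.

(** * Cutting a function off at a hyperplane on which it vanishes *)

Section half_space_cut.
Context {R : realType} {n : nat}.
Implicit Types (x y v : 'rV[R]_n) (u g phi : 'rV[R]_n -> R).
Local Notation mu := (@lebesgue_rV R n).

Lemma smooth_dotp v : smooth (dotp^~ v).
Proof.
apply: smooth_sum => i.
by apply: smoothM; [exact: smooth_coord|exact: smooth_cst].
Qed.

Lemma dotp_delta v i : dotp (delta_mx 0 i) v = v 0 i.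
Proof.
rewrite /dotp (bigD1 i)//= !mxE !eqxx mul1r big1 ?addr0// => j ji.
by rewrite mxE (negbTE ji) andbF mul0r.
Qed.

Lemma is_derive_dotp v x i : is_derive x (delta_mx 0 i) (dotp^~ v) (v 0 i).
Proof.
apply/is_derive_path0.
rewrite (_ : (fun t => _) = (fun t : R => t * v 0 i + dotp x v)); last first.
  apply/funext => t; rewrite addrC -[t]opprK scaleNr dotpBZl mulNr opprK addrC.
  by rewrite opprK; congr (_ * _ + _); exact: dotp_delta.
exact: is_derive_affine1.
Qed.

Definition half_pospart v u x : R := (0 < dotp x v)%R%:R * Num.max (u x) 0.

(** Off the hyperplane the indicator is locally constant; on it, smallness of [u] nearby controls
    the cut function whatever the indicator does. *)
Lemma continuous_half_pospart v u : continuous u ->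
  (forall x, dotp x v = 0 -> u x = 0) -> continuous (half_pospart v u).
Proof.
move=> cu u0 x; have cr := smooth_continuous (smooth_dotp v).
have maxB (a b : R) : `|Num.max a 0 - Num.max b 0| <= `|a - b|.
  rewrite ler_norml; have := ler_norm (a - b); have := ler_norm (b - a).
  rewrite (distrC b); have [a0|a0] := leP a 0; have [b0|b0] := leP b 0;
    move=> h1 h2; apply/andP; split; lra.
apply/continuous_atP => e e0.
have [s s0 sP] := (continuous_atP _ _).1 (cu x) e e0.
have near_sign : dotp x v != 0 ->
    exists2 t, 0 < t & forall y, `|x - y| < t -> (0 < dotp y v) = (0 < dotp x v).
  move=> r0; have r2 : 0 < `|dotp x v| / 2 by rewrite divr_gt0// normr_gt0.
  have [t t0 tP] := (continuous_atP _ _).1 (cr x) _ r2.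
  exists t => // y /tP; rewrite ler_norml => /andP[h1 h2].
  have [r1|r1|r1] := ltgtP (dotp x v) 0; last by rewrite r1 eqxx in r0.
    by move: h1 h2; rewrite ltr0_norm// => h1 h2; apply/negbTE; rewrite -leNgt; lra.
  by move: h1 h2; rewrite gtr0_norm// => h1 h2; lra.
have [r0|/near_sign[t t0 tP]] := eqVneq (dotp x v) 0.
  exists s => // y /sP h; rewrite /half_pospart r0 ltxx mul0r sub0r normrN.
  rewrite u0// sub0r normrN in h.
  case: (_ < _); last by rewrite mul0r normr0 ltW.
  rewrite mul1r; apply: le_trans h.
  by have := maxB (u y) 0; rewrite maxxx !subr0.
exists (Num.min s t); first by rewrite lt_min s0.
move=> y; rewrite lt_min => /andP[/sP h /tP xy].
rewrite /half_pospart xy -mulrBr; case: (_ < _); last first.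
  by rewrite mul0r normr0 ltW.
by rewrite mul1r; apply: le_trans h; exact: maxB.
Qed.

Let chi v m x := flat 0 (m.+1%:R * dotp x v).

Let smooth_chi v m : smooth (chi v m).
Proof.
apply: smooth_flat; apply: smoothM; first exact: smooth_cst.
exact: smooth_dotp.
Qed.

Let chi_norm_le1 v m x : `|chi v m x| <= 1.
Proof. by rewrite ger0_norm ?flat_ge0// flat0_le1. Qed.

Let cvg_chi v x : chi v m x @[m --> \oo] --> ((0 < dotp x v)%R%:R : R).
Proof.
have [r0|r0] := leP (dotp x v) 0; last exact: cvg_flat0.
rewrite (_ : (fun m => _) = cst 0); first exact: cvg_cst.
by apply/funext => m; rewrite /chi flat_eq0// mulr_ge0_le0.
Qed.

Let partial_chi v m i x :
  partial i (chi v m) x = flat 2 (m.+1%:R * dotp x v) * (m.+1%:R * v 0 i).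
Proof.
have dr := is_derive_mul (is_derive_cst (m.+1%:R : R) x _) (is_derive_dotp v x i).
rewrite mulr0 addr0 in dr.
have := is_derive_comp (F := flat 0) (f := fun y => m.+1%:R * dotp y v)
  (is_derive_flat 0 (m.+1%:R * dotp x v)) dr.
by rewrite mul0r subr0 => -[].
Qed.

(** The factor [m.+1] produced by the chain rule is beaten by [flat 2 s <= s ^- 2] at
    [s = m.+1%:R * dotp x v]: away from the hyperplane the gradient of the cutoff is [O(1/m)]. *)
Let partial_chi_le v m i x : 0 < dotp x v ->
  `|partial i (chi v m) x| <= `|v 0 i| * (dotp x v)^-1 ^+ 2 * m.+1%:R^-1.
Proof.
move=> r0; have m0 : 0 < m.+1%:R :> R by [].
have s0 : 0 < m.+1%:R * dotp x v by rewrite mulr_gt0.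
rewrite partial_chi !normrM (ger0_norm (flat_ge0 _ _)) (gtr0_norm m0).
have h : flat 2 (m.+1%:R * dotp x v) <= (m.+1%:R * dotp x v)^-1 ^+ 2.
  rewrite /flat s0; apply: ler_piMr; first by rewrite exprn_ge0// invr_ge0 ltW.
  by rewrite expR_le1 oppr_le0 invr_ge0 ltW.
apply: (@le_trans _ _ ((m.+1%:R * dotp x v)^-1 ^+ 2 * (m.+1%:R * `|v 0 i|))).
  by rewrite ler_wpM2r// mulr_ge0.
rewrite le_eqVlt; apply/orP; left; apply/eqP.
by field; rewrite !gt_eqF.
Qed.

(** The points of the cube with [e <= u x] and [0 <= dotp x v] form a compact set. The minimum of
    [dotp x v] over it is positive since [u] vanishes on the hyperplane; if the set is empty,
    [d = 1] serves. *)
Let away_from_hyperplane v u r (e : R) : continuous u ->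
  (forall x, dotp x v = 0 -> u x = 0) -> 0 < e ->
  exists2 d, 0 < d & forall x, `|x| <= r -> e <= u x -> 0 < dotp x v ->
    d <= dotp x v.
Proof.
move=> cu u0 e0; have cr := smooth_continuous (smooth_dotp v).
pose K : set 'rV[R]_n := [set x | `|x| <= r] `&` ([set x | e <= u x] `&`
  [set x | 0 <= dotp x v]).
have cK : compact K.
  apply: (subclosed_compact _ (@compact_cube R n r)); last by move=> x [].
  apply: closedI; first by apply: compact_closed; [exact: norm_hausdorff|exact: compact_cube].
  apply: closedI.
    apply: (closed_comp (f := u) (D := [set t | e <= t])); last exact: closed_ge.
    by move=> x _; exact: cu.
  apply: (closed_comp (f := dotp^~ v) (D := [set t | 0 <= t])); last exact: closed_ge.
  by move=> x _; exact: cr.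
have [K0|/set0P Kn0] := eqVneq K set0.
  exists 1 => // x xr ux xv; have : K x by split => //; split => //; exact: ltW.
  by rewrite K0.
have [c /set_mem[cr' [cu' cv]] cP] := EVT_min_rV Kn0 cK (continuous_subspaceT cr).
have cv0 : 0 < dotp c v.
  rewrite lt_neqAle cv andbT eq_sym; apply/eqP => /u0 uc.
  by move: cu'; rewrite /= uc leNgt e0.
exists (dotp c v) => // x xr ux xv; apply: cP; apply/mem_set.
by split => //; split => //; exact: ltW.
Qed.

(** [weak_chain] is applied to the test functions [chi v m x * phi x] and [m] goes to infinity. The
    dangerous term carries the gradient of [chi v m], unbounded near the hyperplane. There
    [pospart k (u x)] vanishes, thanks to its dead zone [u x <= k.+1%:R^-1]; elsewhere in the
    half-space and the support, [away_from_hyperplane] makes this gradient small. *)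
Let half_pospart_chain k v u g i phi : continuous u ->
  (forall x, dotp x v = 0 -> u x = 0) -> is_weak_partial i u g ->
  test_function phi ->
  \int[mu]_x (pospart k (u x) * ((0 < dotp x v)%R%:R * partial i phi x)) =
  - \int[mu]_x (g x * (dpospart k (u x) * ((0 < dotp x v)%R%:R * phi x))).
Proof.
move=> cu u0 ug tphi; have [sphi [r phir]] := (test_functionP phi).1 tphi.
have cphi := smooth_continuous sphi.
have cdphi := smooth_continuous (smooth_partial i sphi).
have cQ : continuous (pospart (R := R) k).
  move=> t; apply: differentiable_continuous; apply/derivable1_diffP.
  by case: (is_derive_pospart k t).
have cQu : continuous (pospart k \o u).
  by move=> x; apply: continuous_comp; [exact: cu|exact: cQ].
have cdQu : continuous (dpospart k \o u).
  by move=> x; apply: continuous_comp; [exact: cu|exact: continuous_dpospart].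
have tchi m : test_function (fun x => chi v m x * phi x) by exact: test_functionMl.
have [P P0 dphiP] := test_function_bounded (test_function_partial i tphi).
have [F F0 phiF] := test_function_bounded tphi.
have [U U0 QU] := continuous_bounded_cube r cQu.
have dphir x : r < `|x| -> partial i phi x = 0 := partial_outside i phir.
have [|d d0 dP] := @away_from_hyperplane v u r k.+1%:R^-1 cu u0.
  by rewrite invr_gt0.
pose L := \int[mu]_x (pospart k (u x) * ((0 < dotp x v)%R%:R * partial i phi x)).
have lhs : \int[mu]_x (pospart k (u x) * partial i (fun y => chi v m y * phi y) x)
    @[m --> \oo] --> L.
  (* The first summand bounds the term with the derivative of [phi], the second the term with the
     derivative of the cutoff, at points with [d <= dotp x v]. *)
  apply: (cvg_Rintegral_bounded (M := U * P + U * (F * (`|v 0 i| * d^-1 ^+ 2)))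
    (r := r)) => [m|m x|m x rx|x].
  - apply: measurable_funM; apply: continuous_measurable_rV; first exact: cQu.
    by apply: smooth_continuous; apply: smooth_partial; exact: (tchi m).1.
  - have B0 : 0 <= `|v 0 i| * d^-1 ^+ 2 by rewrite mulr_ge0// exprn_ge0// invr_ge0 ltW.
    have [xr|xr] := leP `|x| r; last first.
      rewrite (partial_outside (r := r))// ?mulr0 ?normr0; last first.
        by move=> y ry; rewrite phir// mulr0.
      by apply: addr_ge0; [exact: mulr_ge0|apply: mulr_ge0 => //; exact: mulr_ge0].
    rewrite partialM// mulrDr; apply: le_trans (ler_normD _ _) _; apply: lerD.
      rewrite normrM (normrM (chi v m x)) -[P]mul1r; apply: ler_pM => //; first exact: QU.
      exact: ler_pM.
    rewrite normrM (normrM (phi x)); have [ux|ux] := leP (u x) k.+1%:R^-1.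
      by rewrite pospart_eq0// normr0 mul0r; apply: mulr_ge0 => //; exact: mulr_ge0.
    apply: ler_pM => //; first exact: QU.
    apply: ler_pM => //; have [xv|xv] := leP (dotp x v) 0.
      by rewrite partial_chi flat_eq0 ?mul0r ?normr0// mulr_ge0_le0.
    apply: le_trans (partial_chi_le m i xv) _.
    rewrite -[leRHS]mulr1; apply: ler_pM => //.
    + by rewrite mulr_ge0// exprn_ge0// invr_ge0 ltW.
    + rewrite ler_wpM2l//; apply: lerXn2r; rewrite ?nnegrE ?invr_ge0; try exact: ltW.
      by rewrite lef_pV2 ?posrE//; apply: dP => //; exact: ltW.
    + by rewrite invf_le1// ler1n.
  - rewrite (partial_outside (r := r))// ?mulr0//.
    by move=> y ry; rewrite phir// mulr0.
  under eq_fun do rewrite partialM//.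
  apply: cvgM; first exact: cvg_cst.
  rewrite -[X in _ --> X]addr0; apply: cvgD.
    by apply: cvgM; [exact: cvg_chi|exact: cvg_cst].
  rewrite -[X in _ --> X](mulr0 (phi x)); apply: cvgM; first exact: cvg_cst.
  have [xv|xv] := leP (dotp x v) 0.
    rewrite (_ : (fun m => _) = cst 0); first exact: cvg_cst.
    by apply/funext => m; rewrite partial_chi flat_eq0 ?mul0r// mulr_ge0_le0.
  apply/norm_cvg0P; apply: (@squeeze_cvgr _ _ _ _ (cst 0)
    (fun m => `|v 0 i| * (dotp x v)^-1 ^+ 2 * m.+1%:R^-1)).
  - by apply: nearW => m; rewrite normr_ge0 partial_chi_le.
  - exact: cvg_cst.
  - rewrite -[X in _ --> X](mulr0 (`|v 0 i| * (dotp x v)^-1 ^+ 2)).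
    by apply: cvgM; [exact: cvg_cst|exact: cvg_harmonic].
have rhs : \int[mu]_x (g x * (dpospart k (u x) * (chi v m x * phi x)))
    @[m --> \oo] --> \int[mu]_x
      (g x * (dpospart k (u x) * ((0 < dotp x v)%R%:R * phi x))).
  apply: (cvg_Rintegral_mul (M := F) (r := r) ug.1) => [m|m x|m x rx|x].
  - apply: measurable_funM; apply: continuous_measurable_rV; first exact: cdQu.
    by apply: smooth_continuous; exact: (tchi m).1.
  - rewrite normrM (normrM (chi v m x)) -[F]mul1r; apply: ler_pM => //.
      exact: dpospart_norm_le1.
    by rewrite -[F]mul1r; apply: ler_pM.
  - by rewrite phir// !mulr0.
  - apply: cvgM; first exact: cvg_cst.
    by apply: cvgM; [exact: cvg_chi|exact: cvg_cst].
apply/eqP; rewrite -addr_eq0; apply/eqP.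
apply: cvg_cst_eq (cvgD lhs rhs) _ => m.
rewrite -[LHS]/(\int[mu]_x _ + \int[mu]_x _).
rewrite (weak_chain cu ug (is_derive_pospart k) (@continuous_dpospart _ k)
  (dpospart_norm_le1 k) (tchi m)).
by rewrite addNr.
Qed.

Lemma measurable_fun_pred (b : pred 'rV[R]_n) :
  measurable [set x | b x] -> measurable_fun setT (fun x => (b x)%:R : R).
Proof.
move=> mb; have := @measurable_indic _ _ R setT _ mb.
congr measurable_fun; apply/funext => x.
rewrite indicE (_ : (x \in _) = b x)//.
by apply/idP/idP => [/set_mem|h]//; exact/mem_set.
Qed.

Lemma measurable_gt0 u : continuous u -> measurable [set x | 0 < u x].
Proof.
move=> cu; apply: open_measurable_rV.
apply: (open_comp (f := u) (D := [set t | 0 < t])); last exact: open_gt.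
by move=> x _; exact: cu.
Qed.

Lemma measurable_half_pos v u : continuous u ->
  measurable [set x | (0 < dotp x v) && (0 < u x)].
Proof.
move=> cu; have cr := smooth_continuous (smooth_dotp v).
rewrite (_ : [set x | _] = [set x | 0 < dotp x v] `&` [set x | 0 < u x]).
  by apply: measurableI; exact: measurable_gt0.
by apply/seteqP; split => x /= => [/andP|] // [-> ->].
Qed.

(** The smoothing of the positive part is removed only after that of the indicator, since the margin
    [d] used for the latter depends on [k]. *)
Lemma is_weak_partial_half_pospart v u g i : continuous u ->
  (forall x, dotp x v = 0 -> u x = 0) -> is_weak_partial i u g ->
  is_weak_partial i (half_pospart v u)
    (fun x => ((0 < dotp x v) && (0 < u x))%R%:R * g x).
Proof.
move=> cu u0 ug; have [ig _] := ug; have mg := ig.1.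
have mind : measurable_fun setT
    (fun x => ((0 < dotp x v) && (0 < u x))%R%:R : R).
  apply: (measurable_fun_pred (b := fun x => (0 < dotp x v) && (0 < u x))).
  exact: measurable_half_pos.
split.
  split=> [|K cK]; first exact: measurable_funM.
  have mK := compact_measurable_rV cK.
  apply: (le_integrable mK _ _ (ig.2 K cK)).
    by apply: measurable_funTS; apply/measurable_EFinP; exact: measurable_funM.
  move=> x _; rewrite /= lee_fin normrM; case: (_ && _).
    by rewrite normr1 mul1r.
  by rewrite normr0 mul0r.
move=> phi tphi; have [sphi [r phir]] := (test_functionP phi).1 tphi.
have cphi := smooth_continuous sphi.
have cdphi := smooth_continuous (smooth_partial i sphi).
have [P P0 dphiP] := test_function_bounded (test_function_partial i tphi).
have [F F0 phiF] := test_function_bounded tphi.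
have [U U0 uU] := continuous_bounded_cube r cu.
have dphir x : r < `|x| -> partial i phi x = 0 := partial_outside i phir.
have mH : measurable_fun setT (fun x => (0 < dotp x v)%R%:R : R).
  apply: (measurable_fun_pred (b := fun x => 0 < dotp x v)).
  by apply: measurable_gt0; apply: smooth_continuous; exact: smooth_dotp.
have H1 x : `|(0 < dotp x v)%R%:R : R| <= 1 by case: (_ < _); rewrite ?normr1 ?normr0.
have lhs : \int[mu]_x (pospart k (u x) * ((0 < dotp x v)%R%:R * partial i phi x))
    @[k --> \oo] --> \int[mu]_x (half_pospart v u x * partial i phi x).
  apply: (cvg_Rintegral_bounded (M := U * P) (r := r)) => [k|k x|k x rx|x].
  - apply: measurable_funM.
      apply: (continuous_measurable_rV (f := pospart k \o u)) => x.
      apply: continuous_comp; first exact: cu.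
      apply: differentiable_continuous; apply/derivable1_diffP.
      by case: (is_derive_pospart k (u x)).
    by apply: measurable_funM => //; exact: continuous_measurable_rV.
  - have [xr|xr] := leP `|x| r; last first.
      by rewrite dphir// !mulr0 normr0; exact: mulr_ge0.
    rewrite normrM; apply: ler_pM => //.
      exact: le_trans (pospart_norm_le k (u x)) (uU x xr).
    by rewrite normrM -[P]mul1r; apply: ler_pM.
  - by rewrite dphir// !mulr0.
  - rewrite /half_pospart (mulrC _ (Num.max _ _)) -mulrA.
    by apply: cvgM; [exact: cvg_pospart|exact: cvg_cst].
have rhs : \int[mu]_x (g x * (dpospart k (u x) * ((0 < dotp x v)%R%:R * phi x)))
    @[k --> \oo] --> \int[mu]_x
      (((0 < dotp x v) && (0 < u x))%R%:R * g x * phi x).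
  rewrite (_ : (fun x => _ * g x * phi x) =
    fun x => g x * ((0 < u x)%R%:R * ((0 < dotp x v)%R%:R * phi x))); last first.
    by apply/funext => x; rewrite -mulnb natrM; ring.
  apply: (cvg_Rintegral_mul (M := F) (r := r) ig) => [k|k x|k x rx|x].
  - apply: measurable_funM.
      apply: (continuous_measurable_rV (f := dpospart k \o u)) => x.
      by apply: continuous_comp; [exact: cu|exact: continuous_dpospart].
    by apply: measurable_funM => //; exact: continuous_measurable_rV.
  - rewrite normrM -[F]mul1r; apply: ler_pM => //; first exact: dpospart_norm_le1.
    by rewrite normrM -[F]mul1r; apply: ler_pM.
  - by rewrite phir// !mulr0.
  - by apply: cvgM; [exact: cvg_dpospart|exact: cvg_cst].
apply/eqP; rewrite -addr_eq0; apply/eqP.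
apply: cvg_cst_eq (cvgD lhs rhs) _ => k.
rewrite -[LHS]/(\int[mu]_x _ + \int[mu]_x _).
by rewrite (half_pospart_chain k cu u0 ug tphi) addNr.
Qed.

End half_space_cut.

(** * Clarkson's inequality and the energy *)

Section energy.
Context {R : realType} {n : nat}.
Implicit Types (a b x : 'rV[R]_n) (z : 'rV[R]_n -> R) (G : 'rV[R]_n -> 'rV[R]_n).
Local Notation mu := (@lebesgue_rV R n).

(** Each power [y ^ q] is split as [y * y ^ (q - 1)], and the second factor is increased to
    [(s + t) ^ (q - 1)]. *)
Lemma powR_superadditive (q s t : R) : 1 <= q -> 0 <= s -> 0 <= t ->
  s `^ q + t `^ q <= (s + t) `^ q.
Proof.
move=> q1 s0 t0; have q0 : 0 < q by apply: lt_le_trans q1.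
have st0 := addr_ge0 s0 t0.
rewrite -(mulr_powRB1 s0 q0) -(mulr_powRB1 t0 q0) -(mulr_powRB1 st0 q0) mulrDl.
have h y : 0 <= y -> y <= s + t -> y * y `^ (q - 1) <= y * (s + t) `^ (q - 1).
  by move=> y0 yst; rewrite ler_wpM2l// ge0_ler_powR ?nnegrE// subr_ge0.
by apply: lerD; apply: h => //; rewrite ?lerDl ?lerDr.
Qed.

Lemma powR_midpoint (q s t : R) : 1 <= q -> 0 <= s -> 0 <= t ->
  (2^-1 * (s + t)) `^ q <= 2^-1 * (s `^ q + t `^ q).
Proof.
move=> q1 s0 t0.
have h0 : 0 <= 2^-1 :> R by [].
have h1 : 2^-1 <= 1 :> R by rewrite invf_le1// ler1n.
have := convex_powR q1 (Itv01 h0 h1) (x := s) (y := t).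
rewrite !inE/= !in_itv/= !andbT => /(_ s0 t0) h.
have {h} : (2^-1 * s + (1 - 2^-1) * t) `^ q <=
  2^-1 * s `^ q + (1 - 2^-1) * t `^ q := h.
have -> : 1 - 2^-1 = 2^-1 :> R by field.
by rewrite !mulrDr.
Qed.

Definition sqnorm x : R := \sum_i x 0 i ^+ 2.

Lemma sqnorm_ge0 x : 0 <= sqnorm x.
Proof. by apply: sumr_ge0 => i _; rewrite sqr_ge0. Qed.

Lemma enorm_powR x (p : R) : enorm x `^ p = sqnorm x `^ (p / 2).
Proof. by rewrite /enorm -powR12_sqrt ?sqnorm_ge0// -powRrM mulrC. Qed.

(* Clarkson's inequality, from the parallelogram identity, superadditivity and
   convexity of [t |-> t `^ (p / 2)]. *)
Lemma clarkson (p : R) a b : 2 <= p ->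
  enorm (a + 2^-1 *: b) `^ p + enorm (2^-1 *: b) `^ p <=
  2^-1 * (enorm a `^ p + enorm (a + b) `^ p).
Proof.
move=> p2; rewrite !enorm_powR; have q1 : 1 <= p / 2 by rewrite ler_pdivlMr// mul1r.
apply: le_trans (powR_superadditive q1 (sqnorm_ge0 _) (sqnorm_ge0 _)) _.
have -> : sqnorm (a + 2^-1 *: b) + sqnorm (2^-1 *: b) =
    2^-1 * (sqnorm a + sqnorm (a + b)).
  rewrite /sqnorm -!big_split /= mulr_sumr; apply: eq_bigr => i _.
  by rewrite !mxE; field.
by apply: powR_midpoint => //; exact: sqnorm_ge0.
Qed.

Lemma enorm_ge0 x : 0 <= enorm x. Proof. exact: sqrtr_ge0. Qed.

Lemma coord_le_enorm x i : `|x 0 i| <= enorm x.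
Proof.
rewrite /enorm -sqrtr_sqr ler_wsqrtr// (bigD1 i)//= lerDl.
by apply: sumr_ge0 => j _; rewrite sqr_ge0.
Qed.

Lemma enorm_le_norm x : enorm x <= n%:R * `|x|.
Proof.
rewrite -[leRHS]ger0_norm ?mulr_ge0// -sqrtr_sqr ler_wsqrtr//.
apply: (@le_trans _ _ (\sum_(i < n) `|x| ^+ 2)).
  apply: ler_sum => i _; rewrite -[_ ^+ 2]ger0_norm ?sqr_ge0// normrX.
  by rewrite lerXn2r ?nnegrE// rV_norm_coord.
rewrite exprMn sumr_const card_ord -[leLHS]mulr_natl; apply: ler_wpM2r.
  by rewrite sqr_ge0.
by rewrite -natrX ler_nat; case: (n) => // k; rewrite -mulnn leq_pmulr.
Qed.

Lemma measurable_enorm G : (forall i, measurable_fun setT (fun x => G x 0 i)) ->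
  measurable_fun setT (fun x => enorm (G x)).
Proof.
move=> mG; apply: (measurableT_comp (f := @Num.sqrt R)).
  by apply: continuous_measurable_fun; exact: sqrt_continuous.
by apply: measurable_sum => i; exact: measurable_funX.
Qed.

Section fixed_exponent.
Variable p : R.
Hypothesis p2 : 2 <= p.

Let p0 : 0 < p. Proof. exact: lt_le_trans p2. Qed.

Definition energy G : \bar R := (\int[mu]_x (enorm (G x) `^ p)%:E)%E.

Lemma energy_ge0 G : (0 <= energy G)%E.
Proof. by apply: integral_ge0 => x _; rewrite lee_fin powR_ge0. Qed.

Lemma measurable_enorm_powR G :
  (forall i, measurable_fun setT (fun x => G x 0 i)) ->
  measurable_fun setT (fun x => (enorm (G x) `^ p)%:E).
Proof.
move=> mG; apply/measurable_EFinP.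
by apply: (measurableT_comp (measurable_powR p)); exact: measurable_enorm.
Qed.

Lemma weak_partialP i z g : is_weak_partial i z g ->
  is_weak_partial i z (weak_partial i z).
Proof. by move=> zg; apply: (xgetPex (cst 0)); exists g. Qed.

Lemma weak_grad_ae z G : (forall i, is_weak_partial i z (fun x => G x 0 i)) ->
  {ae mu, forall x, weak_grad z x = G x}.
Proof.
move=> zG.
have : {ae mu, forall x, forall i, weak_partial i z x = G x 0 i}.
  apply: filter_forall => i.
  exact: weak_partial_unique (weak_partialP (zG i)) (zG i).
by apply: filterS => x h; apply/rowP => i; rewrite mxE.
Qed.

(** Lets any explicitly computed weak gradient replace the chosen representative. *)
Lemma energy_weak_grad z G : (forall i, is_weak_partial i z (fun x => G x 0 i)) ->
  energy (weak_grad z) = energy G.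
Proof.
move=> zG; apply: ae_eq_integral => //.
- apply: measurable_enorm_powR => i.
  rewrite (_ : (fun x => _) = weak_partial i z); last by apply/funext => x; rewrite mxE.
  exact: (weak_partialP (zG i)).1.1.
- by apply: measurable_enorm_powR => i; exact: (zG i).1.1.
by have := weak_grad_ae zG; apply: filterS => x -> _.
Qed.

Lemma grad_norm_poweR z : (grad_norm p z `^ p)%E = energy (weak_grad z).
Proof.
rewrite /grad_norm poweR_Lnorm ?gt_eqF//; apply: eq_integral => x _.
by rewrite /= ger0_norm ?enorm_ge0.
Qed.

Lemma D1p_intro z G : continuous z ->
  (forall i, is_weak_partial i z (fun x => G x 0 i)) -> (energy G < +oo)%E ->
  D1p p z.
Proof.
move=> cz zG Gfin; split => //.
  split; first exact: continuous_locally_integrable.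
  by move=> i; exists (fun x => G x 0 i).
move=> i; have zi := weak_partialP (zG i).
rewrite inE /=; apply/andP; split; first by rewrite inE/=; exact: zi.1.1.
rewrite inE/=; apply: (@lty_poweRy _ _ p); first by rewrite gt_eqF.
rewrite poweR_Lnorm ?gt_eqF//.
apply: le_lt_trans Gfin; rewrite -(energy_weak_grad zG).
apply: ge0_le_integral => //.
- by move=> x _; exact: poweR_ge0.
- rewrite (_ : (fun x => _) = (fun x => (`|weak_partial i z x| `^ p)%:E)).
    apply/measurable_EFinP; apply: (measurableT_comp (measurable_powR p)).
    by apply: measurableT_comp => //; exact: zi.1.1.
  by apply/funext => x; rewrite abse_EFin poweR_EFin.
- apply: measurable_enorm_powR => j.
  rewrite (_ : (fun x => _) = weak_partial j z); last by apply/funext => x; rewrite mxE.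
  exact: (weak_partialP (zG j)).1.1.
move=> x _; rewrite abse_EFin poweR_EFin lee_fin ge0_ler_powR ?nnegrE ?enorm_ge0//.
  exact: ltW.
by have := coord_le_enorm (weak_grad z x) i; rewrite mxE.
Qed.

(** Integrability is given by components, the energy by the Euclidean norm. The latter is at most
    [n] times the sup norm, which is attained at one component, so its [p]-th power is at most the
    sum over components. *)
Lemma D1p_energy z : D1p p z -> (energy (weak_grad z) < +oo)%E /\
  forall i, is_weak_partial i z (weak_partial i z).
Proof.
move=> [[iz zw] zL cz].
have zi i : is_weak_partial i z (weak_partial i z).
  by have [g zg] := zw i; exact: weak_partialP zg.
split=> //.
have mw i : measurable_fun setT (weak_partial i z) := (zi i).1.1.
apply: (@le_lt_trans _ _ ((n%:R `^ p)%:E * \sum_(i < n)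
    \int[mu]_x (`|weak_partial i z x| `^ p)%:E)%E); last first.
  apply: lte_mul_pinfty => //.
  apply: lte_sum_pinfty => i _.
  have := zL i; rewrite inE /= => /andP[_]; rewrite inE/= => h.
  have hp : (\int[mu]_x (`|(EFin \o weak_partial i z) x| `^ p) < +oo)%E.
    by rewrite -poweR_Lnorm ?gt_eqF//; exact: poweR_lty.
  apply: le_lt_trans hp; rewrite le_eqVlt; apply/orP; left; apply/eqP.
  apply: eq_integral => x _.
  by rewrite abse_EFin poweR_EFin.
rewrite -ge0_integral_sum//; last first.
  move=> i; apply/measurable_EFinP; apply: (measurableT_comp (measurable_powR p)).
  exact: measurableT_comp.
rewrite -ge0_integralZl//; last 2 first.
- apply: emeasurable_sum => i; apply/measurable_EFinP.
  apply: (measurableT_comp (measurable_powR p)); exact: measurableT_comp.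
- by move=> x _; apply: sume_ge0 => i _; rewrite lee_fin powR_ge0.
apply: ge0_le_integral => //.
- by move=> x _; rewrite lee_fin powR_ge0.
- apply: measurable_enorm_powR => i.
  by rewrite (_ : (fun x => _) = weak_partial i z)//; apply/funext => x; rewrite mxE.
- apply: emeasurable_funM => //; apply: emeasurable_sum => i; apply/measurable_EFinP.
  apply: (measurableT_comp (measurable_powR p)); exact: measurableT_comp.
move=> x _; rewrite sumEFin -EFinM lee_fin.
apply: (@le_trans _ _ ((n%:R * `|weak_grad z x|) `^ p)).
  by rewrite ge0_ler_powR ?nnegrE ?enorm_ge0 ?mulr_ge0 ?enorm_le_norm// ltW.
rewrite powRM// ler_wpM2l ?powR_ge0//.
have [->|/mx_norm_neq0[[k i] /= E]] := eqVneq `|weak_grad z x| 0.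
  by rewrite powR0 ?gt_eqF// sumr_ge0// => i _; rewrite powR_ge0.
have -> : `|weak_grad z x| = `|weak_partial i z x|.
  by rewrite [LHS]E mxE.
rewrite (bigD1 i)//= lerDl sumr_ge0// => j _; exact: powR_ge0.
Qed.

End fixed_exponent.
End energy.

(** * Polarization of an extremal *)

Lemma ge0_integralDT d (X : measurableType d) (R : realType)
    (m : {measure set X -> \bar R}) (f g : X -> \bar R) :
  measurable_fun setT f -> measurable_fun setT g ->
  (forall x, 0 <= f x)%E -> (forall x, 0 <= g x)%E ->
  (\int[m]_x (f x + g x) = \int[m]_x f x + \int[m]_x g x)%E.
Proof. by move=> mf mg f0 g0; rewrite ge0_integralD. Qed.

Lemma integral_parallelogram_le d (X : measurableType d) (R : realType)
    (m : {measure set X -> \bar R}) (c : R) (f1 f2 g1 g2 : X -> R) : 0 <= c ->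
  measurable_fun setT f1 -> measurable_fun setT f2 ->
  measurable_fun setT g1 -> measurable_fun setT g2 ->
  (forall x, 0 <= f1 x) -> (forall x, 0 <= f2 x) ->
  (forall x, 0 <= g1 x) -> (forall x, 0 <= g2 x) ->
  (forall x, f1 x + f2 x <= c * (g1 x + g2 x)) ->
  (\int[m]_x (f1 x)%:E + \int[m]_x (f2 x)%:E <=
   c%:E * (\int[m]_x (g1 x)%:E + \int[m]_x (g2 x)%:E))%E.
Proof.
move=> c0 /measurable_EFinP mf1 /measurable_EFinP mf2 /measurable_EFinP mg1
  /measurable_EFinP mg2 f10 f20 g10 g20 fg.
rewrite -!ge0_integralDT//; try by move=> x; rewrite lee_fin.
rewrite -ge0_integralZl//; last 2 first.
- exact: emeasurable_funD.
- by move=> x _; rewrite -EFinD lee_fin addr_ge0.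
apply: ge0_le_integral => //.
- by move=> x _; rewrite -EFinD lee_fin addr_ge0.
- exact: emeasurable_funD.
- by apply: emeasurable_funM => //; exact: emeasurable_funD.
by move=> x _; rewrite -!EFinD -EFinM lee_fin.
Qed.

Lemma lee_mean_fin (R : realFieldType) (a c : \bar R) : c \is a fin_num ->
  (a <= 2^-1%:E * (c + c))%E -> (a <= c)%E.
Proof.
by case: c => //= c _; rewrite -EFinD -EFinM (_ : 2^-1 * (c + c) = c) //; field.
Qed.

Lemma normB_widen (R : realDomainType) (a b c d : R) :
  b <= a -> a <= c -> d <= b -> `|a - b| <= `|c - d|.
Proof.
move=> ba ac db; rewrite ger0_norm ?subr_ge0//.
by apply: le_trans (ler_norm _); exact: lerB.
Qed.

Lemma continuous_lin (R : realType) (T : topologicalType) (c d : R) (f g : T -> R) :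
  continuous f -> continuous g -> continuous (fun x => c * f x + d * g x).
Proof.
move=> cf cg x; apply: (@cvgD _ _ _ (nbhs x) _ (fun x => c * f x) (fun x => d * g x)).
  by apply: cvgM; [exact: cvg_cst|exact: cf].
by apply: cvgM; [exact: cvg_cst|exact: cg].
Qed.

Section polarization.
Context {R : realType} {n' : nat}.
Local Notation n := n'.+1.
Implicit Types (x y : 'rV[R]_n) (z : 'rV[R]_n -> R) (G H : 'rV[R]_n -> 'rV[R]_n).
Local Notation mu := (@lebesgue_rV R n).

Definition is_weak_grad z G := forall i, is_weak_partial i z (fun x => G x 0 i).

Lemma is_weak_grad_lin (c d : R) z1 z2 G H : continuous z1 -> continuous z2 ->
  is_weak_grad z1 G -> is_weak_grad z2 H ->
  is_weak_grad (fun x => c * z1 x + d * z2 x) (fun x => c *: G x + d *: H x).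
Proof.
move=> cz1 cz2 zG zH i.
have := is_weak_partial_lin c d (continuous_locally_integrable cz1)
  (continuous_locally_integrable cz2) (zG i) (zH i).
by congr is_weak_partial; apply/funext => x; rewrite !mxE.
Qed.

Lemma measurable_weak_grad z G i : is_weak_grad z G ->
  measurable_fun setT (fun x => G x 0 i).
Proof. by move=> zG; exact: (zG i).1.1. Qed.

Lemma enorm_gt0 x : x != 0 -> 0 < enorm x.
Proof.
move=> x0; rewrite lt_neqAle enorm_ge0 andbT eq_sym; apply: contra x0 => /eqP E.
apply/eqP/rowP => i; have := coord_le_enorm x i.
by rewrite E normr_le0 => /eqP ->; rewrite mxE.
Qed.

Lemma dotpN x y : dotp (- x) y = - dotp x y.
Proof. by rewrite /dotp -sumrN; apply: eq_bigr => i _; rewrite mxE mulNr. Qed.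

Lemma grad_norm_fin (p : R) z : 2 <= p -> (energy p (weak_grad z) < +oo)%E ->
  exists2 a, 0 <= a & grad_norm p z = a%:E.
Proof.
move=> p2 zfin; have p0 : 0 < p by exact: lt_le_trans p2.
have g0 : (0 <= grad_norm p z)%E by exact: Lnorm_ge0.
have gfin : (grad_norm p z < +oo)%E.
  apply: (@lty_poweRy _ _ p); first by rewrite gt_eqF.
  by rewrite (grad_norm_poweR p2).
have gf : grad_norm p z \is a fin_num by rewrite (ge0_fin_numE g0); exact: gfin.
by exists (fine (grad_norm p z)); [exact: fine_ge0|rewrite (fineK gf)].
Qed.

Lemma half_pospart_ge0 y w x : 0 <= half_pospart y w x.
Proof. by rewrite mulr_ge0// le_max lexx orbT. Qed.

Lemma half_pospart_out y w x : dotp x y <= 0 -> half_pospart y w x = 0.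
Proof. by move=> xy; rewrite /half_pospart ltNge xy mul0r. Qed.

Variables (p : R) (v : 'rV[R]_n).
Hypotheses (p2 : 2 <= p) (v0 : v 0 ord0 != 0).
Local Notation s := (mulmx^~ (refl v) : 'rV[R]_n -> 'rV[R]_n).

Let vn0 : v != 0. Proof. by apply: contra v0 => /eqP ->; rewrite mxE. Qed.

Let mps : measure_preserving s. Proof. exact: measure_preserving_refl. Qed.

Let sK : involutive s.
Proof. exact: mulmx_involutive (refl_involutive vn0). Qed.

Lemma is_weak_grad_refl z G : continuous z -> is_weak_grad z G ->
  is_weak_grad (z \o s) (fun x => G (s x) *m refl v).
Proof.
move=> cz zG i.
have := is_weak_partial_involution (refl_involutive vn0) mps i
  (continuous_locally_integrable cz) zG.
congr is_weak_partial; apply/funext => x; rewrite mxE.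
by apply: eq_bigr => j _; rewrite refl_sym mulrC.
Qed.

(** Over the invariant set [b], values at [x] and [s x] are exchanged and reflected. The matrix
    preserves [enorm] and [s] preserves the measure, so the contribution of that set is unchanged;
    the complement is untouched. *)
Lemma energy_refl G (b : pred 'rV[R]_n) :
  (forall i, measurable_fun setT (fun x => G x 0 i)) ->
  measurable_fun setT (fun x => (b x)%:R : R) -> (forall x, b (s x) = b x) ->
  energy p (fun x => if b x then G (s x) *m refl v else G x) = energy p G.
Proof.
move=> mG mb bs.
pose h x := enorm (G x) `^ p.
have h0 x : 0 <= h x := powR_ge0 _ _.
have mh : measurable_fun setT h by apply/measurable_EFinP; exact: measurable_enorm_powR.
pose k1 x := ((b x)%:R * h x)%:E; pose k2 x := ((1 - (b x)%:R) * h x)%:E.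
have k10 x : (0 <= k1 x)%E by rewrite lee_fin mulr_ge0.
have k20 x : (0 <= k2 x)%E.
  by rewrite lee_fin mulr_ge0//; case: (b x); rewrite ?subrr ?subr0.
have mk1 : measurable_fun setT k1 by apply/measurable_EFinP; exact: measurable_funM.
have mk2 : measurable_fun setT k2.
  by apply/measurable_EFinP; apply: measurable_funM => //; exact: measurable_funB.
transitivity (\int[mu]_x (k1 (s x) + k2 x))%E.
  apply: eq_integral => x _; rewrite /k1 /k2 bs -EFinD; congr (_%:E).
  case: (b x); first by rewrite enorm_refl// mul1r subrr mul0r addr0.
  by rewrite mul0r subr0 mul1r add0r.
rewrite (ge0_integralDT mu (measurableT_comp mk1 mps.1) mk2 (fun x => k10 (s x)) k20).
rewrite (ge0_integral_measure_preserving mps mk1 k10) -(ge0_integralDT mu mk1 mk2 k10 k20).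
apply: eq_integral => x _; rewrite /k1 /k2 -EFinD -mulrDl.
by rewrite addrC subrK mul1r.
Qed.

Lemma energy_clarkson G H :
  (forall i, measurable_fun setT (fun x => G x 0 i)) ->
  (forall i, measurable_fun setT (fun x => H x 0 i)) ->
  (energy p (fun x => G x + 2^-1 *: H x)%R + energy p (fun x => 2^-1 *: H x)%R <=
   2^-1%:E * (energy p G + energy p (fun x => G x + H x)%R))%E.
Proof.
move=> mG mH.
have mH2 i : measurable_fun setT (fun x => (2^-1 *: H x) 0 i).
  by under eq_fun do rewrite mxE; exact: measurable_funM.
have mGH i : measurable_fun setT (fun x => (G x + H x) 0 i).
  by under eq_fun do rewrite mxE; exact: measurable_funD.
have mGH2 i : measurable_fun setT (fun x => (G x + 2^-1 *: H x) 0 i).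
  by under eq_fun do rewrite mxE; exact: measurable_funD.
have M (K : 'rV[R]_n -> 'rV[R]_n) (mK : forall i, measurable_fun setT (fun x => K x 0 i)) :=
  measurable_enorm_powR p mK.
have P (K : 'rV[R]_n -> 'rV[R]_n) x : 0 <= enorm (K x) `^ p by exact: powR_ge0.
apply: integral_parallelogram_le => [|||||x|x|x|x|x].
- by rewrite invr_ge0.
- by apply/measurable_EFinP; exact: M mGH2.
- by apply/measurable_EFinP; exact: M mH2.
- by apply/measurable_EFinP; exact: M mG.
- by apply/measurable_EFinP; exact: M mGH.
- exact: (P (fun x => G x + 2^-1 *: H x)).
- exact: (P (fun x => 2^-1 *: H x)).
- exact: P.
- exact: (P (fun x => G x + H x)).
exact: clarkson.
Qed.

Theorem extremal_refl_le u (e : 'rV[R]_n) : morrey_extremal p u ->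
  holder_seminorm p u = (holder_quotient p u e (- e))%:E ->
  u e = 1 -> u (- e) = -1 -> 0 < dotp e v ->
  forall x, 0 < dotp x v -> u (s x) <= u x.
Proof.
move=> [uD _ [C [CM _] uC]] uq ue uNe ev.
have p0 : 0 < p by apply: lt_le_trans p2.
have cu : continuous u by case: uD.
have [Efin uG0] := D1p_energy p2 uD.
pose GU := weak_grad u.
have uG : is_weak_grad u GU.
  move=> i; have := uG0 i; congr is_weak_partial.
  by apply/funext => x; rewrite mxE.
have cs : continuous s := @continuous_mulmx _ _ _.
have cus : continuous (u \o s) by move=> x; apply: continuous_comp; [exact: cs|exact: cu].
(* The explicit coefficients fit [is_weak_grad_lin], as do those of [S], [z] and [d] below. *)
pose w x := 1 * (u \o s) x + (-1) * u x.
have cw : continuous w by exact: continuous_lin.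
have w0 x : dotp x v = 0 -> w x = 0.
  by move=> xv; rewrite /w /= refl_fixed// mul1r mulN1r subrr.
pose GV x := GU (s x) *m refl v.
pose GW x := 1 *: GV x + (-1) *: GU x.
have wG : is_weak_grad w GW.
  by apply: is_weak_grad_lin => //; exact: is_weak_grad_refl.
pose T := half_pospart v w.
have cT : continuous T by exact: continuous_half_pospart.
pose b x := (0 < dotp x v) && (0 < w x).
pose GT x := (b x)%:R *: GW x.
have TG : is_weak_grad T GT.
  move=> i; have := is_weak_partial_half_pospart cw w0 (wG i).
  by congr is_weak_partial; apply/funext => x; rewrite /GT [RHS]mxE.
have cTs : continuous (T \o s) by move=> x; apply: continuous_comp; [exact: cs|exact: cT].
(* [u + S] is the polarization of [u]: the larger of [u] and [u \o s] where
   [dotp x v > 0], the smaller one elsewhere. *)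
pose S x := 1 * T x + (-1) * (T \o s) x.
have cS : continuous S by exact: continuous_lin.
pose GS x := 1 *: GT x + (-1) *: (GT (s x) *m refl v).
have SG : is_weak_grad S GS.
  by apply: is_weak_grad_lin => //; exact: is_weak_grad_refl.
have mU i := measurable_weak_grad i uG.
have mS i := measurable_weak_grad i SG.
have sv x : dotp (s x) v = - dotp x v by exact: dotp_refl_normal.
have E1 : energy p (fun x => GU x + GS x) = energy p GU.
  (* [b x] and [b (s x)] exclude each other, being conditions on opposite sides of the mirror. In
     either case the gradient of [u + S] at [x] is the reflected gradient of [u] at [s x]; outside
     [B] it is that of [u]. *)
  pose B x := b x || b (s x).
  have bb x : b x -> b (s x) = false.
    by move=> /andP[xv _]; rewrite /b sv oppr_gt0 ltNge ltW.
  have mb : measurable [set x | b x] by exact: measurable_half_pos.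
  have mB : measurable_fun setT (fun x => (B x)%:R : R).
    apply: measurable_fun_pred.
    rewrite (_ : [set x | B x] = [set x | b x] `|` s @^-1` [set x | b x]).
      apply: measurableU; first exact: mb.
      by rewrite -[X in measurable X]setTI; exact: mps.1.
    by apply/seteqP; split => x /= => [/orP|[|]] // => [bx|bx]; rewrite /B bx ?orbT.
  have Bs x : B (s x) = B x by rewrite /B sK orbC.
  transitivity (energy p (fun x => if B x then GU (s x) *m refl v else GU x)); last first.
    exact: energy_refl mU mB Bs.
  apply: eq_integral => x _; congr ((enorm _ `^ p)%:E).
  rewrite /B /GS /GT.
  have [bx|nbx] /= := boolP (b x).
    rewrite bb// !scale0r mul0mx scaler0 addr0 !scale1r /GW scale1r scaleN1r.
    by rewrite addrC subrK.
  have [bsx|nbsx] /= := boolP (b (s x)).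
    rewrite scale0r scaler0 add0r !scale1r /GW /GV sK scale1r !scaleN1r.
    rewrite mulmxBl -mulmxA refl_involutive// mulmx1 opprB.
    by rewrite addrC subrK.
  by rewrite !scale0r mul0mx !scaler0 !addr0.
have cl := energy_clarkson mU mS; rewrite E1 in cl.
have Efn : energy p GU \is a fin_num.
  by rewrite (ge0_fin_numE (energy_ge0 p GU)); exact: Efin.
(* The endpoints [u] and [u + S] have equal energy, so the energies of the midpoint [z] and of the
   half-difference [d] add up to at most that of [u]. *)
have {}cl := lee_mean_fin Efn cl.
pose z x := 1 * u x + 2^-1 * S x.
have cz : continuous z by exact: continuous_lin.
pose d x := 2^-1 * S x + 0 * u x.
have cd : continuous d by exact: continuous_lin.
have zG : is_weak_grad z (fun x => GU x + 2^-1 *: GS x).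
  have := is_weak_grad_lin 1 2^-1 cu cS uG SG; congr is_weak_grad.
  by apply/funext => x; rewrite scale1r.
have dG : is_weak_grad d (fun x => 2^-1 *: GS x).
  have := is_weak_grad_lin 2^-1 0 cS cu SG uG; congr is_weak_grad.
  by apply/funext => x; rewrite scale0r addr0.
have Ez := le_trans (leeDl _ (energy_ge0 p _)) cl.
have Ed := le_trans (leeDr _ (energy_ge0 p _)) cl.
have zD : D1p p z by exact: D1p_intro cz zG (le_lt_trans Ez Efin).
have dD : D1p p d by exact: D1p_intro cd dG (le_lt_trans Ed Efin).
have eNe : e != - e.
  apply/eqP => eN; have := dotpN e v.
  by rewrite -eN => /eqP; rewrite -addr_eq0 -mulr2n mulrn_eq0/= gt_eqF.
have D0 : 0 < enorm (e - (- e)) `^ (1 - n%:R / p).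
  by apply: powR_gt0; apply: enorm_gt0; rewrite subr_eq0.
have qle : holder_quotient p u e (- e) <= holder_quotient p z e (- e).
  have nev : dotp (- e) v < 0 by rewrite dotpN oppr_lt0; exact: ev.
  have sev : dotp (s e) v <= 0 by rewrite sv oppr_le0; exact: ltW ev.
  have ze : u e <= z e.
    rewrite /z /S /= [T (s e)](half_pospart_out _ sev).
    rewrite mulr0 addr0 !mul1r lerDl; apply: mulr_ge0; first by rewrite invr_ge0.
    exact: half_pospart_ge0.
  have zNe : z (- e) <= u (- e).
    rewrite /z /S /= [T (- e)](half_pospart_out _ (ltW nev)).
    rewrite mulr0 add0r mul1r mulN1r mulrN gerDl oppr_le0.
    apply: mulr_ge0; first by rewrite invr_ge0.
    exact: half_pospart_ge0.
  rewrite /holder_quotient ler_pM2r; last by rewrite invr_gt0; exact: D0.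
  rewrite ue in ze; rewrite uNe in zNe; rewrite ue uNe.
  by apply: (normB_widen _ ze zNe); exact: le_trans (lerN10 R) ler01.
have q0 : 0 < holder_quotient p u e (- e).
  rewrite /holder_quotient ue uNe; apply: mulr_gt0; last by rewrite invr_gt0; exact: D0.
  by rewrite opprK normr_gt0.
have [a a0 ga] := grad_norm_fin p2 Efin.
have zE := energy_weak_grad p zG.
have dE := energy_weak_grad p dG.
have [c c0 gc] : exists2 c, 0 <= c & grad_norm p z = c%:E.
  by apply: (grad_norm_fin p2); rewrite zE; exact: le_lt_trans Ez Efin.
have Ca : holder_quotient p u e (- e) = C * a.
  by move: uC; rewrite uq ga => -[].
have C0 : 0 < C.
  rewrite ltNge; apply/negP => Cle; move: q0; rewrite Ca ltNge.
  by rewrite mulr_le0_ge0.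
(* [C * a] is the quotient of [u] at [e] and [- e], at most that of [z], hence at most [C * c]; the
   factor [C] is positive and cancels. *)
have ac : a <= c.
  rewrite -(ler_pM2l C0) -Ca -lee_fin.
  rewrite (_ : (C * c)%:E = C%:E * grad_norm p z)%E; last by rewrite gc.
  apply: le_trans (CM z zD); apply: (@le_trans _ _ (holder_quotient p z e (- e))%:E).
    by rewrite lee_fin.
  by apply: ereal_sup_ubound; exists (e, - e); rewrite //= eNe.
have Eac : (energy p GU <= energy p (fun x => GU x + 2^-1 *: GS x)%R)%E.
  rewrite -zE -!(grad_norm_poweR p2) ga gc !poweR_EFin lee_fin.
  by apply: ge0_ler_powR; rewrite ?nnegrE; [exact: ltW p0|exact: a0|exact: c0|exact: ac].
(* The energy of [z] plus that of [d] is at most the energy of [u], hence at most that of [z], which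
   is finite and cancels. *)
have d0 : grad_norm p d = 0%E.
  apply: (@poweR_eq0_eq0 _ _ p); first exact: Lnorm_ge0.
  rewrite (grad_norm_poweR p2) dE; apply/eqP; rewrite eq_le (energy_ge0 p _) andbT.
  have zfn : energy p (fun x => GU x + 2^-1 *: GS x) \is a fin_num.
    by rewrite (ge0_fin_numE (energy_ge0 p _)); exact: le_lt_trans Ez Efin.
  by rewrite -(leeD2lE _ _ zfn) adde0; exact: le_trans cl Eac.
have dcst x y : d x = d y.
  have [->//|xy] := eqVneq x y.
  have : ((holder_quotient p d x y)%:E <= 0)%E.
    apply: (@le_trans _ _ (holder_seminorm p d)).
      by apply: ereal_sup_ubound; exists (x, y); [exact: xy|exact: erefl].
    by apply: le_trans (CM d dD) _; rewrite d0 mule0.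
  rewrite lee_fin /holder_quotient => h.
  have p1 : 0 < enorm (x - y) `^ (1 - n%:R / p).
    by apply: powR_gt0; apply: enorm_gt0; rewrite subr_eq0.
  move: h; rewrite pmulr_lle0; last by rewrite invr_gt0; exact: p1.
  by rewrite normr_le0 subr_eq0 => /eqP.
have dE' y : d y = 2^-1 * (T y - T (s y)).
  by rewrite /d /S mul0r addr0 mul1r mulN1r.
(* The origin is fixed by [s], so [d] vanishes there and everywhere. As [T (s x) = 0], this gives
   [T x = 0], that is [w x <= 0]. *)
move=> x xv; have := dcst x 0; rewrite !dE' mul0mx subrr mulr0.
have sxv : dotp (s x) v <= 0 by rewrite sv oppr_le0; exact: ltW xv.
rewrite [T (s x)](half_pospart_out _ sxv) subr0 => /eqP.
rewrite mulf_eq0 invr_eq0 pnatr_eq0 /T /half_pospart xv mul1r => /eqP h.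
have : w x <= 0 by rewrite -h le_max lexx.
by rewrite /w mul1r mulN1r subr_le0.
Qed.

End polarization.

(** * Approximation of the normal vector *)

Section approximation.
Context {R : realType}.

Lemma le_at_right0 (f : R -> R) (c d : R) : 0 < d -> {for 0, continuous f} ->
  (forall t, 0 < t -> t < d -> f t <= c) -> f 0 <= c.
Proof.
move=> d0 /continuous_atP f0 fc; rewrite leNgt; apply/negP => cf.
have [|r r0 rP] := f0 ((f 0 - c) / 2); first by rewrite divr_gt0// subr_gt0.
pose t := Num.min d r / 2.
have t0 : 0 < t by rewrite divr_gt0// lt_min d0.
have tm : t < Num.min d r by rewrite gtr_pMr ?lt_min ?d0// invf_lt1// ltr1n.
have /andP[td tr] : (t < d) && (t < r) by rewrite -lt_min.
have := fc t t0 td; have := rP t; rewrite sub0r normrN gtr0_norm// => /(_ tr).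
rewrite ler_norml => /andP[_]; move: cf; lra.
Qed.

Lemma continuous_scaled_line (V : normedModType R) (c : R -> R) (a w b : V) :
  {for 0, continuous c} -> {for 0, continuous (fun t => a - c t *: (w + t *: b))}.
Proof.
move=> cc; apply: cvgB; first exact: cvg_cst.
apply: cvgZ; first exact: cc.
apply: cvgD; first exact: cvg_cst.
by apply: cvgZ; [exact: cvg_id|exact: cvg_cst].
Qed.

Lemma continuous_refl_coef (A B P Q S : R) : P != 0 ->
  {for 0, continuous (fun t : R => 2 * (A + t * B) / (P + t * Q + t * (t * S)))}.
Proof.
move=> P0; apply: cvgM.
  apply: cvgM; first exact: cvg_cst.
  by apply: cvgD; [exact: cvg_cst|apply: cvgM; [exact: cvg_id|exact: cvg_cst]].
apply: cvgV; first by rewrite !mul0r !addr0.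
apply: cvgD; first apply: cvgD; first exact: cvg_cst.
  by apply: cvgM; [exact: cvg_id|exact: cvg_cst].
apply: cvgM; first exact: cvg_id.
by apply: cvgM; [exact: cvg_id|exact: cvg_cst].
Qed.

Lemma dotpDZl n (x v y : 'rV[R]_n) (a : R) :
  dotp (x + a *: v) y = dotp x y + a * dotp v y.
Proof. by rewrite -[in LHS](opprK a) scaleNr dotpBZl mulNr opprK. Qed.

Lemma dotp_enorm n (x : 'rV[R]_n) : dotp x x = enorm x ^+ 2.
Proof.
rewrite sqr_sqrtr; first by apply: eq_bigr => i _; rewrite expr2.
by apply: sumr_ge0 => i _; rewrite sqr_ge0.
Qed.

End approximation.

Theorem theorem1p3 (R : realType) (n : nat) (p : R) (n_ge2 : (2 <= n)%N)
    (p_gt_n : n%:R < p) (u : 'rV[R]_n -> R) (u_extremal : morrey_extremal p u)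
    (u_sup : holder_seminorm p u =
      (holder_quotient p u (e_last n_ge2) (- e_last n_ge2))%:E)
    (u_en : u (e_last n_ge2) = 1) (u_Nen : u (- e_last n_ge2) = -1)
    (x1 x2 : 'rV[R]_n) (x12_norm : enorm x1 = enorm x2)
    (x12_last : x1 0 (last_coord n_ge2) <= x2 0 (last_coord n_ge2)) :
  u x1 <= u x2.
Proof.
case: n => [//|n] in n_ge2 p_gt_n u u_extremal u_sup u_en u_Nen x1 x2 x12_norm x12_last *.
have p2 : 2 <= p by rewrite (le_trans _ (ltW p_gt_n))// ler_nat.
have [->|x12] := eqVneq x1 x2; first exact: lexx.
set l := last_coord n_ge2 in x12_last *.
have n0 : (0 < n)%N by exact: n_ge2.
(* The last axis differs from the first because there are at least two coordinates, so making the
   first entry of the normal nonzero leaves its last entry free to be positive. *)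
have l0 : l != ord0 by rewrite -lt0n; exact: n0.
pose w := x2 - x1.
have w0 : 0 < dotp w w by apply: dotp_gt0; rewrite subr_eq0 eq_sym.
(* Equality of the norms is what makes the reflection orthogonal to [w] map [x2] to [x1]. *)
have x2w : dotp x2 w = dotp w w / 2.
  have E : dotp x1 x1 = dotp x2 x2 by rewrite !dotp_enorm x12_norm.
  have wE y : dotp w y = dotp x2 y - dotp x1 y.
    by have := dotpBZl x2 x1 1 y; rewrite scale1r mul1r.
  rewrite (dotpC x2 w) [in RHS]wE !(dotpC _ w) !wE E (dotpC x1 x2).
  by field.
(* Since [w 0 l >= 0], the entries of [b] make [w + t *: b] satisfy the
   nondegeneracy conditions of [extremal_refl_le] for every [0 < t]. *)
pose b : 'rV[R]_n.+1 :=
  \row_i if (i == ord0) && (w 0 ord0 < 0) then -1 else 1.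
pose v t := w + t *: b.
have v0 t : 0 < t -> v t 0 ord0 != 0.
  move=> t0; rewrite /v !mxE eqxx/= -[x2 0 ord0 - x1 0 ord0]/(_ + _).
  case: ltP => w00; [rewrite lt_eqF//|rewrite gt_eqF//].
    by rewrite mulrN1 subr_lt0 (lt_trans _ t0)//; move: w00; rewrite !mxE.
  by rewrite mulr1 ltr_wpDl//; move: w00; rewrite !mxE.
have vl t : 0 < t -> 0 < dotp (e_last n_ge2) (v t).
  move=> t0; rewrite dotp_delta -/l /v !mxE (negbTE l0)/= mulr1.
  by rewrite ltr_wpDl// subr_ge0.
(* For [t < d] the perturbation [t * dotp x2 b] cannot cancel [dotp x2 w], so [x2] stays on the
   positive side of the tilted mirror. *)
pose d := dotp x2 w / (1 + `|dotp x2 b|).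
have den0 : 0 < 1 + `|dotp x2 b| by rewrite ltr_pwDl.
have x2w0 : 0 < dotp x2 w by rewrite x2w divr_gt0.
have d0 : 0 < d by rewrite divr_gt0.
have vE t y : dotp (v t) y = dotp w y + t * dotp b y by exact: dotpDZl.
have x2v t : 0 < t -> t < d -> 0 < dotp x2 (v t).
  move=> t0; rewrite ltr_pdivlMr// => td; rewrite dotpC vE !(dotpC _ x2).
  have : - (t * dotp x2 b) <= t * `|dotp x2 b|.
    by rewrite -mulrN ler_pM2l// -normrN ler_norm.
  by move: td; rewrite mulrDr mulr1; lra.
(* The reflection coefficient for the normal [v t], expanded in powers of [t] so that it is visibly
   continuous at [0], where its value is [1] by [x2w]. *)
pose c t := 2 * (dotp x2 w + t * dotp x2 b) /
  (dotp w w + t * (2 * dotp w b) + t * (t * dotp b b)).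
have gE t : x2 *m refl (v t) = x2 - c t *: v t.
  rewrite reflE; congr (_ - _ *: _); rewrite (dotpC x2) !vE !(dotpC _ (v t)) !vE.
  by rewrite (dotpC b w) /c !(dotpC _ x2); congr (_ / _); ring.
have cg : {for 0, continuous (fun t => x2 - c t *: (w + t *: b))}.
  apply: continuous_scaled_line; apply: continuous_refl_coef.
  by rewrite gt_eqF.
have cu : continuous u by case: u_extremal => -[].
have <- : x2 - c 0 *: (w + 0 *: b) = x1.
  rewrite /c !mul0r !addr0 scale0r addr0 x2w (_ : 2 * _ / _ = 1).
    by rewrite scale1r /w opprB addrC subrK.
  by field; rewrite gt_eqF.
apply: (le_at_right0 (f := fun t => u (x2 - c t *: (w + t *: b))) d0).
  by apply: (continuous_comp (f := fun t => x2 - c t *: (w + t *: b))) => //; exact: cu.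
move=> t t0 td; rewrite -gE.
exact: (extremal_refl_le p2 (v0 t t0) u_extremal u_sup u_en u_Nen (vl t t0) (x2v t t0 td)).
Qed.
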